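(* Let $d\ge2$ and let $E_0\subseteq\mathbb{R}^d$ be a bounded set with $C^{2,\alpha}$-boundary for some $\alpha\in(0,1]$. For $x\in\partial E_0$ let $\nu=\nu(x)$ be the outer unit normal of $E_0$ at $x$ and $H(x;E_0)$ the mean curvature of $\partial E_0$ at $x$. For $h>0$ let $E_1^h:=\{x\in\mathbb{R}^d:(G_h*\chi_{E_0})(x)>1/2\}$ and define for $x\in\partial E_0$ $$z(x):=\begin{cases}\sup\{l\in\mathbb{R}_-: x+l\nu(x)\in E_1^h\}&\text{if }x\notin E_1^h,\\ \inf\{l\in\mathbb{R}_+: x+l\nu(x)\notin E_1^h\}&\text{if }x\in E_1^h.\end{cases}$$ Then for $h$ sufficiently small, uniformly in $x\in\partial E_0$, $$z(x)=-hH(x;E_0)+\mathcal{O}(h^{1+\alpha/2}).$$ Moreover, if $E_0$ has $C^4$-boundary, then, uniformly in $x\in\partial E_0$, $$z(x)=-hH(x;E_0)+\mathcal{O}(h^2).$$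
   Context: $G_h(x):=(4\pi h)^{-d/2}\exp\left(-\frac{|x|^2}{4h}\right)$ is the heat kernel on $\mathbb{R}^d$. The mean curvature $H$ is the sum of the $d-1$ principal curvatures $\kappa_i$, i.e. of the eigenvalues of $\nabla\nu$ on the tangent space, so that it is nonnegative for convex sets. The function $z$ depends on $h$; $\mathcal{O}$ refers to $h\downarrow0$. *)

(* Defs.v *)
From HB Require Import structures.
From mathcomp Require Import all_boot all_order all_algebra.
From mathcomp Require Import all_classical all_reals all_analysis.

Set Implicit Arguments.
Unset Strict Implicit.
Unset Printing Implicit Defensive.
Import Order.TTheory GRing.Theory Num.Theory.
Import numFieldNormedType.Exports.

Local Open Scope classical_set_scope.
Local Open Scope ring_scope.

(* The library norm `|x| on 'rV[R]_d is the sup norm.  It induces the usual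
   topology and the usual bounded sets; everything metric uses enorm. *)
Definition edot (R : realType) (d : nat) (x y : 'rV[R]_d) : R :=
  \sum_(i < d) x ord0 i * y ord0 i.

Definition enorm (R : realType) (d : nat) (x : 'rV[R]_d) : R :=
  Num.sqrt (edot x x).

Definition boundary (T : topologicalType) (A : set T) : set T :=
  closure A `\` A°.

(* Iterated partial derivatives: partial [:: i1; ..; ik] f is
   d_i1 (.. (d_ik f)). *)
Definition partial (R : realType) (m : nat) (s : seq 'I_m) (f : 'rV[R]_m -> R) :
    'rV[R]_m -> R :=
  foldr (fun i g => 'D_(delta_mx ord0 i : 'rV[R]_m) g) f s.

(* U is meant to be open; f is total but only its values on U matter. *)
Definition Ck_on (R : realType) (m k : nat) (U : set 'rV[R]_m)
    (f : 'rV[R]_m -> R) : Prop :=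
  forall s : seq 'I_m, (size s <= k)%N ->
    (forall x, U x -> {for x, continuous (partial s f)}) /\
    ((size s < k)%N -> forall (i : 'I_m) x, U x ->
       derivable (partial s f) x (delta_mx ord0 i : 'rV[R]_m)).

Definition holder_on (R : realType) (m : nat) (a : R) (U : set 'rV[R]_m)
    (f : 'rV[R]_m -> R) : Prop :=
  exists C : R, forall x y, U x -> U y ->
    `|f x - f y| <= C * enorm (x - y) `^ a.

Definition Ck_holder_on (R : realType) (m k : nat) (a : R) (U : set 'rV[R]_m)
    (f : 'rV[R]_m -> R) : Prop :=
  Ck_on k U f /\
  forall s : seq 'I_m, size s = k -> holder_on a U (partial s f).

(* Near each boundary point p, after a rigid motion, E is a subgraph.  The rows
   of T together with n form an orthonormal basis of R^d; relative to the origin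
   p the coordinates of x are ((x - p) *m T^T, edot (x - p) n).  Nothing is
   required of points lying on the graph, so E may be open, closed or neither;
   the graph of g is then exactly the boundary of E in the ball. *)
Definition subgraph_boundary (R : realType) (d : nat)
    (smooth : set 'rV[R]_d.-1 -> ('rV[R]_d.-1 -> R) -> Prop)
    (E : set 'rV[R]_d) : Prop :=
  forall p, boundary E p ->
    exists (r : R) (T : 'M[R]_(d.-1, d)) (n : 'rV[R]_d) (g : 'rV[R]_d.-1 -> R),
      [/\ 0 < r,
          [/\ T *m T^T = 1%:M, T *m n^T = 0 & edot n n = 1],
          smooth [set u | enorm u < r] g &
          forall x, enorm (x - p) < r ->
            (edot (x - p) n < g ((x - p) *m T^T) -> E x) /\
            (g ((x - p) *m T^T) < edot (x - p) n -> ~ E x)].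

Definition Ck_boundary (R : realType) (d k : nat) (E : set 'rV[R]_d) : Prop :=
  subgraph_boundary (Ck_on k) E.

Definition Ck_holder_boundary (R : realType) (d k : nat) (a : R)
    (E : set 'rV[R]_d) : Prop :=
  subgraph_boundary (Ck_holder_on k a) E.

(* The unit vector orthogonal to the tangent space of the boundary at x (the
   third condition: <y - x, n> = o(|y - x|) along the boundary) which points
   out of E. *)
Definition is_outer_normal (R : realType) (d : nat) (E : set 'rV[R]_d)
    (x n : 'rV[R]_d) : Prop :=
  [/\ enorm n = 1,
      \forall t \near (0 : R)^'+, E (x - t *: n) /\ ~ E (x + t *: n) &
      forall e : R, 0 < e -> \forall y \near x, boundary E y ->
        `|edot (y - x) n| <= e * enorm (y - x)].

Definition outer_normal (R : realType) (d : nat) (E : set 'rV[R]_d)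
    (x : 'rV[R]_d) : 'rV[R]_d :=
  xget 0 [set n | is_outer_normal E x n].

(* v |-> v *m S extends to R^d the differential at x of the map outer_normal E
   on the hypersurface boundary E; only its restriction to the tangent space is
   determined. *)
Definition is_normal_differential (R : realType) (d : nat) (E : set 'rV[R]_d)
    (x : 'rV[R]_d) (S : 'M[R]_d) : Prop :=
  forall e : R, 0 < e -> \forall y \near x, boundary E y ->
    enorm (outer_normal E y - outer_normal E x - (y - x) *m S)
      <= e * enorm (y - x).

(* The entries of k are the eigenvalues, with multiplicity, of the differential
   of the normal on the tangent space; the rows of T are an orthonormal basis
   of the tangent space consisting of eigenvectors (principal directions). *)
Definition are_principal_curvatures (R : realType) (d : nat)
    (E : set 'rV[R]_d) (x : 'rV[R]_d) (k : 'rV[R]_d.-1) : Prop :=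
  exists (S : 'M[R]_d) (T : 'M[R]_(d.-1, d)),
    [/\ is_normal_differential E x S,
        T *m T^T = 1%:M,
        T *m (outer_normal E x)^T = 0 &
        forall i, row i T *m S = k ord0 i *: row i T].

(* Unique up to the order of the entries, on which mean_curvature does not
   depend. *)
Definition principal_curvatures (R : realType) (d : nat) (E : set 'rV[R]_d)
    (x : 'rV[R]_d) : 'rV[R]_d.-1 :=
  xget 0 [set k | are_principal_curvatures E x k].

Definition mean_curvature (R : realType) (d : nat) (E : set 'rV[R]_d)
    (x : 'rV[R]_d) : R :=
  \sum_(i < d.-1) principal_curvatures E x ord0 i.

(* Lebesgue measure on R^n, realized on n.-tuple R: the n-fold product of the
   one-dimensional Lebesgue measure. *)
Section lebesgue_measure_tuple.
Variable R : realType.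
Local Notation RT := (measurableTypeR R).

Definition tcons (n : nat) (p : RT * n.-tuple RT) : n.+1.-tuple RT :=
  [tuple of p.1 :: p.2].

Definition tuncons (n : nat) (t : n.+1.-tuple RT) : RT * n.-tuple RT :=
  (tnth t ord0, [tuple of behead t]).

Lemma tunconsK n : cancel (@tuncons n) (@tcons n).
Proof. by move=> t; rewrite /tcons /=; apply/esym/tuple_eta. Qed.

Lemma tconsK n : cancel (@tcons n) (@tuncons n).
Proof.
move=> [a t]; rewrite /tcons /tuncons /=; congr pair; exact: val_inj.
Qed.

Lemma measurable_tcons n : measurable_fun setT (@tcons n).
Proof. exact: measurable_cons. Qed.

Lemma measurable_tuncons n : measurable_fun setT (@tuncons n).
Proof.
apply: measurable_fun_pair; first exact: measurable_tnth.
exact: measurable_behead.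
Qed.

Section step.
Variables (n : nat) (m : {sigma_finite_measure set (n.-tuple RT) -> \bar R}).
Local Open Scope ereal_scope.

Definition lebesgue_cons : set (n.+1.-tuple RT) -> \bar R :=
  pushforward (@lebesgue_measure R \x m) (@tcons n).

HB.instance Definition _ := Measure.copy lebesgue_cons
  (measure_function_pushforward__canonical__measure_function_Measure
    (@lebesgue_measure R \x m) (@measurable_tcons n)).

Lemma lebesgue_cons_sigma_finite : sigma_finite setT lebesgue_cons.
Proof.
have /sigma_finiteP[F [FT ndF Foo]] := sigma_finiteT (@lebesgue_measure R).
have /sigma_finiteP[G [GT ndG Goo]] := sigma_finiteT m.
exists (fun i => @tuncons n @^-1` (F i `*` G i)) => [|i].
  rewrite -preimage_bigcup; apply/esym/seteqP; split=> // t _.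
  have [i _ Fi] : (\bigcup_i F i) (tnth t ord0) by rewrite -FT.
  have [j _ Gj] : (\bigcup_i G i) [tuple of behead t] by rewrite -GT.
  exists (maxn i j) => //; split => /=.
  - by move: Fi; exact/subsetPset/ndF/leq_maxl.
  - by move: Gj; exact/subsetPset/ndG/leq_maxr.
have [mF Fi] := Foo i; have [mG Gi] := Goo i; split.
  rewrite -[X in measurable X]setTI; apply: measurable_tuncons => //.
  exact: measurableX.
rewrite /lebesgue_cons /pushforward -comp_preimage.
rewrite (_ : _ \o _ = id); last by apply/funext => p /=; rewrite tconsK.
by rewrite preimage_id product_measure1E// lte_mul_pinfty// ge0_fin_numE.
Qed.

HB.instance Definition _ := Measure_isSigmaFinite.Build _ _ _ lebesgue_cons
  lebesgue_cons_sigma_finite.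

End step.

Fixpoint lebesgue_tuple (n : nat) :
    {sigma_finite_measure set (n.-tuple RT) -> \bar R} :=
  if n is n'.+1 then lebesgue_cons (lebesgue_tuple n')
  else dirac ([tuple] : 0.-tuple RT).

End lebesgue_measure_tuple.

Definition rV_of_tuple (R : realType) (d : nat)
    (y : d.-tuple (measurableTypeR R)) : 'rV[R]_d :=
  \row_(i < d) (tnth y i : R).

Definition convolution (R : realType) (d : nat) (f g : 'rV[R]_d -> R)
    (x : 'rV[R]_d) : \bar R :=
  (\int[lebesgue_tuple R d]_y
     (f (x - rV_of_tuple y) * g (rV_of_tuple y))%:E)%E.

Definition heat_kernel (R : realType) (d : nat) (h : R) (x : 'rV[R]_d) : R :=
  (4 * pi * h) `^ (- (d%:R / 2)) * expR (- (enorm x ^+ 2 / (4 * h))).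

Definition heat_step (R : realType) (d : nat) (E0 : set 'rV[R]_d) (h : R) :
    set 'rV[R]_d :=
  [set x | ((2^-1)%:E < convolution (heat_kernel h) \1_E0 x)%E].

(* Valued in the extended reals, so that the supremum and infimum of the empty
   set are -oo and +oo. *)
Definition normal_displacement (R : realType) (d : nat) (E0 : set 'rV[R]_d)
    (h : R) (x : 'rV[R]_d) : \bar R :=
  if x \in heat_step E0 h
  then ereal_inf [set l%:E | l in
         [set l : R | 0 <= l /\
           ~ heat_step E0 h (x + l *: outer_normal E0 x)]]
  else ereal_sup [set l%:E | l in
         [set l : R | l <= 0 /\
           heat_step E0 h (x + l *: outer_normal E0 x)]].

(* Main.v *)
Require Import Defs.
From HB Require Import structures.
From mathcomp Require Import all_boot all_order all_algebra.
From mathcomp Require Import all_classical all_reals all_analysis.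
From mathcomp Require Import measurable_realfun normal_distribution.
From mathcomp Require Import ring lra.

Set Implicit Arguments.
Unset Strict Implicit.
Unset Printing Implicit Defensive.
Import Order.TTheory GRing.Theory Num.Theory.
Import numFieldNormedType.Exports.

Local Open Scope classical_set_scope.
Local Open Scope ring_scope.

(** Near a boundary point x with outer normal nu and principal curvatures k_i,
    the set lies under a graph over its tangent space,
    s = gamma(v) = - (1/2) sum_i k_i v_i^2 + c(v) + O(|v|^(2+b)),
    where c is odd of order |v|^3, and b = alpha for a C^(2,alpha) boundary or
    b = 2 for a C^4 boundary.  The heat kernel is a product of
    one-dimensional kernels in every orthonormal frame, so the heat average of
    the set at x + l nu is the integral over v of K_h(v) Phi_h(gamma(v) - l),
    where Phi_h(a) = 1/2 + (4 pi h)^(-1/2) a + O(h^(-3/2) |a|^3) is the average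
    of a half-line.  The second moments of K_h are 2h and odd functions
    integrate to zero, hence for |l| <= L h the average equals
    1/2 + (4 pi h)^(-1/2) (- l - h H + O(h^(1 + b/2))).
    It crosses the level 1/2 only for l within O(h^(1 + b/2)) of - h H, and
    this locates the displacement.  The analysis is local_graph_average,
    heat_average_sandwich and displacement_local; compactness of the boundary
    makes the constants uniform in displacement_uniform.

    The geometry supplies the graph.  A chart g gives the defining function
    phi(y) = <y - p, n0> - g(coordinates of y) with gradient N, and the outer
    normal is N / |N| (outer_normal_defining).  On the tangent space the
    differential of the normal is the projected Hessian of phi divided by |N|,
    a symmetric map; the spectral theorem shows that principal curvatures
    exist, and any choice of them diagonalizes the Hessian in some orthonormal
    frame (principal_curvatures_frame).  In that frame the Taylor expansion of
    phi at x determines on which side of gamma a point lies.  Only two one-sided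
    graph bounds are needed, not the exact graph, so the expansion is solved
    for the height by substitution, with an explicit error and without an
    implicit function theorem (graph_sandwich_of_taylor).  The constants come
    from an expansion of g that is uniform near the origin (chart_expansion), so
    they are the same for all boundary points in a neighbourhood. *)

(** * Euclidean inner product and norm *)

Lemma le_of_eq (R : realType) (x y : R) : x = y -> x <= y.
Proof. by move=> ->. Qed.

Lemma le0_of_le_small (R : realType) (a C : R) : 0 < C ->
  (forall e, 0 < e -> e <= 1 -> a <= C * e) -> a <= 0.
Proof.
move=> C0 H; rewrite leNgt; apply/negP => a0.
have q0 : 0 < Num.min 1 (a / (2 * C)) by rewrite lt_min ltr01 divr_gt0// mulr_gt0.
have := H _ q0; rewrite ge_min lexx => /(_ isT) /le_trans/(_ (ler_wpM2l (ltW C0) _)) K.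
have := K (a / (2 * C)); rewrite ge_min lexx orbT => /(_ isT).
rewrite (_ : C * _ = a / 2); last by field; rewrite gt_eqF.
lra.
Qed.

Section euclid.
Variable R : realType.

Lemma edotE n (x y : 'rV[R]_n) : edot x y = (x *m y^T) ord0 ord0.
Proof. by rewrite /edot mxE; apply: eq_bigr => i _; rewrite mxE. Qed.

Lemma mulmx_trE n (x y : 'rV[R]_n) : x *m y^T = (edot x y)%:M.
Proof. by rewrite edotE -mx11_scalar. Qed.

Lemma edotC n (x y : 'rV[R]_n) : edot x y = edot y x.
Proof. by apply: eq_bigr => i _; rewrite mulrC. Qed.

Lemma edotDl n (x y z : 'rV[R]_n) : edot (x + y) z = edot x z + edot y z.
Proof. by rewrite !edotE mulmxDl mxE. Qed.

Lemma edotDr n (x y z : 'rV[R]_n) : edot x (y + z) = edot x y + edot x z.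
Proof. by rewrite !(edotC x) edotDl. Qed.

Lemma edotZl n a (x y : 'rV[R]_n) : edot (a *: x) y = a * edot x y.
Proof. by rewrite !edotE -scalemxAl mxE. Qed.

Lemma edotZr n a (x y : 'rV[R]_n) : edot x (a *: y) = a * edot x y.
Proof. by rewrite !(edotC x) edotZl. Qed.

Lemma edotNl n (x y : 'rV[R]_n) : edot (- x) y = - edot x y.
Proof. by rewrite -scaleN1r edotZl mulN1r. Qed.

Lemma edotNr n (x y : 'rV[R]_n) : edot x (- y) = - edot x y.
Proof. by rewrite !(edotC x) edotNl. Qed.

Lemma edotBl n (x y z : 'rV[R]_n) : edot (x - y) z = edot x z - edot y z.
Proof. by rewrite edotDl edotNl. Qed.

Lemma edotBr n (x y z : 'rV[R]_n) : edot x (y - z) = edot x y - edot x z.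
Proof. by rewrite edotDr edotNr. Qed.

Lemma edot0l n (x : 'rV[R]_n) : edot 0 x = 0.
Proof. by rewrite -(scale0r 0) edotZl mul0r. Qed.

Lemma edot0r n (x : 'rV[R]_n) : edot x 0 = 0.
Proof. by rewrite edotC edot0l. Qed.

Lemma edot_mulmx m n (x : 'rV[R]_m) (A : 'M[R]_(m, n)) (y : 'rV[R]_n) :
  edot (x *m A) y = edot x (y *m A^T).
Proof. by rewrite !edotE trmx_mul trmxK mulmxA. Qed.

Lemma edot_delta n (x : 'rV[R]_n) i : edot x (delta_mx ord0 i) = x ord0 i.
Proof.
rewrite /edot (bigD1 i)//= mxE !eqxx mulr1 big1 ?addr0// => j ji.
by rewrite mxE eqxx (negbTE ji) mulr0.
Qed.

Lemma edot_ge0 n (x : 'rV[R]_n) : 0 <= edot x x.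
Proof. by apply: sumr_ge0 => i _; rewrite -expr2 sqr_ge0. Qed.

Lemma sqr_enorm n (x : 'rV[R]_n) : enorm x ^+ 2 = edot x x.
Proof. by rewrite sqr_sqrtr// edot_ge0. Qed.

Lemma enorm_ge0 n (x : 'rV[R]_n) : 0 <= enorm x.
Proof. exact: sqrtr_ge0. Qed.

Lemma ler_coord_enorm n (x : 'rV[R]_n) i : `|x ord0 i| <= enorm x.
Proof.
rewrite -(ler_pXn2r (n := 2)) ?nnegrE ?enorm_ge0// sqr_enorm real_normK ?num_real//.
rewrite /edot (bigD1 i)//= -expr2 lerDl; apply: sumr_ge0 => j _.
by rewrite -expr2 sqr_ge0.
Qed.

Lemma enorm_eq0 n (x : 'rV[R]_n) : (enorm x == 0) = (x == 0).
Proof.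
apply/eqP/eqP => [x0|->]; last by rewrite /enorm edot0l sqrtr0.
apply/rowP => i; rewrite mxE; apply/eqP; rewrite -normr_le0 -x0.
exact: ler_coord_enorm.
Qed.

Lemma enorm0 n : enorm (0 : 'rV[R]_n) = 0.
Proof. by apply/eqP; rewrite enorm_eq0. Qed.

Lemma enorm_gt0 n (x : 'rV[R]_n) : (0 < enorm x) = (x != 0).
Proof. by rewrite lt_def enorm_ge0 andbT enorm_eq0. Qed.

Lemma enormZ n a (x : 'rV[R]_n) : enorm (a *: x) = `|a| * enorm x.
Proof. by rewrite /enorm edotZl edotZr mulrA -expr2 sqrtrM ?sqr_ge0// sqrtr_sqr. Qed.

Lemma enormN n (x : 'rV[R]_n) : enorm (- x) = enorm x.
Proof. by rewrite -scaleN1r enormZ normrN1 mul1r. Qed.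

Lemma enormBC n (x y : 'rV[R]_n) : enorm (x - y) = enorm (y - x).
Proof. by rewrite -enormN opprB. Qed.

Lemma edot_enorm n (x : 'rV[R]_n) : (edot x x == 1) = (enorm x == 1).
Proof. by rewrite -sqr_enorm sqrp_eq1 ?enorm_ge0. Qed.

Lemma cauchy_schwarz n (x y : 'rV[R]_n) : `|edot x y| <= enorm x * enorm y.
Proof.
have [->|x0] := eqVneq x 0; first by rewrite edot0l enorm0 mul0r normr0.
rewrite -(ler_pXn2r (n := 2)) ?nnegrE ?mulr_ge0 ?enorm_ge0//.
rewrite exprMn !sqr_enorm real_normK ?num_real//.
have X : 0 < edot x x by rewrite -sqr_enorm exprn_gt0// enorm_gt0.
have := edot_ge0 (edot x x *: y - edot x y *: x).
rewrite edotBl !edotBr !edotZl !edotZr (edotC y x).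
have -> (a b c : R) : a * (a * b) - a * (c * c) - (c * (a * c) - c * (c * a)) =
  a * (a * b - c ^+ 2) by ring.
by rewrite pmulr_rge0// subr_ge0.
Qed.

Lemma ler_edot n (x y : 'rV[R]_n) : edot x y <= enorm x * enorm y.
Proof. by apply: le_trans (cauchy_schwarz x y); exact: ler_norm. Qed.

Lemma ler_enormD n (x y : 'rV[R]_n) : enorm (x + y) <= enorm x + enorm y.
Proof.
rewrite -(ler_pXn2r (n := 2)) ?nnegrE ?addr_ge0 ?enorm_ge0//.
rewrite sqr_enorm edotDl !edotDr (edotC y x) sqrrD !sqr_enorm.
have := ler_edot x y; lra.
Qed.

Lemma ler_enormB n (x y : 'rV[R]_n) : enorm (x - y) <= enorm x + enorm y.
Proof. by rewrite -(enormN y) ler_enormD. Qed.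

Lemma ler_dist_enorm n (x y : 'rV[R]_n) : `|enorm x - enorm y| <= enorm (x - y).
Proof.
rewrite ler_norml; apply/andP; split.
- by have := ler_enormD (y - x) x; rewrite subrK enormBC; lra.
- by have := ler_enormD (x - y) y; rewrite subrK; lra.
Qed.

Lemma ler_enorm_sum n (x : 'rV[R]_n) : enorm x <= \sum_(i < n) `|x ord0 i|.
Proof.
have S0 : 0 <= \sum_(i < n) `|x ord0 i| by apply: sumr_ge0.
rewrite -(ler_pXn2r (n := 2)) ?nnegrE ?enorm_ge0// sqr_enorm /edot expr2.
rewrite big_distrl/=; apply: ler_sum => i _.
rewrite -expr2 -real_normK ?num_real// expr2 ler_wpM2l//.
by rewrite (bigD1 i)//= lerDl sumr_ge0.
Qed.

Lemma pythagoras n (x y : 'rV[R]_n) : edot x y = 0 ->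
  enorm (x + y) ^+ 2 = enorm x ^+ 2 + enorm y ^+ 2.
Proof.
by move=> xy; rewrite !sqr_enorm edotDl !edotDr (edotC y x) xy addr0 add0r.
Qed.

Lemma enorm_mulmx_le m n (A : 'M[R]_(m, n)) :
  exists2 C, 0 <= C & forall x : 'rV[R]_m, enorm (x *m A) <= C * enorm x.
Proof.
exists (\sum_(j < n) enorm (row j A^T)); first by apply: sumr_ge0 => j _; exact: enorm_ge0.
move=> x; apply: (le_trans (ler_enorm_sum _)); rewrite big_distrl/=.
apply: ler_sum => j _; rewrite mulrC; apply: le_trans (cauchy_schwarz _ _).
rewrite mxE; apply: le_of_eq; congr (`|_|).
by apply: eq_bigr => i _; rewrite !mxE.
Qed.

Lemma enorm_isometry m n (A : 'M[R]_(m, n)) (x : 'rV[R]_m) :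
  A *m A^T = 1%:M -> enorm (x *m A) = enorm x.
Proof. by move=> A1; rewrite /enorm edot_mulmx -mulmxA A1 mulmx1. Qed.

(** Coordinates with respect to orthonormal rows: a projection followed by an
    isometry. *)
Lemma enorm_mulmx_tr_le m n (T : 'M[R]_(m, n)) (w : 'rV[R]_n) :
  T *m T^T = 1%:M -> enorm (w *m T^T) <= enorm w.
Proof.
move=> TT; have [->|w0] := eqVneq (w *m T^T) 0; first by rewrite enorm0 enorm_ge0.
rewrite -(ler_pM2r (x := enorm (w *m T^T))) ?enorm_gt0// -expr2 sqr_enorm.
rewrite edot_mulmx trmxK; apply: le_trans (ler_edot _ _) _.
by rewrite enorm_isometry.
Qed.

(** The topology on row vectors comes from the sup norm; all estimates use the
    Euclidean norm, and this lemma and the next two translate between them. *)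
Lemma near_enormP n (x : 'rV[R]_n) (P : 'rV[R]_n -> Prop) :
  (\forall y \near x, P y) <->
  exists2 e, 0 < e & forall y, enorm (y - x) < e -> P y.
Proof.
split=> [/nbhs_ballP[e /= e0 eP]|[e e0 eP]].
- exists e => // y xy; apply: eP; split=> // i j; rewrite (ord1 i).
  rewrite /ball/=; apply: le_lt_trans xy; rewrite enormBC.
  by apply: le_trans (ler_coord_enorm _ j); rewrite !mxE.
- apply/nbhs_ballP; exists (e / n.+1%:R); first by rewrite /= divr_gt0// ltr0n.
  move=> y [_ xy]; apply: eP; apply: (le_lt_trans (ler_enorm_sum _)).
  have [n0|n0] := posnP n.
    by rewrite big1// => i; move: (ltn_ord i); rewrite {2}n0.
  apply: (@le_lt_trans _ _ (\sum_(i < n) e / n.+1%:R)).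
    apply: ler_sum => i _; rewrite !mxE distrC; apply/ltW.
    exact: (xy ord0 i).
  rewrite sumr_const card_ord -[ltLHS]mulr_natr mulrAC -mulrA gtr_pMr//.
  by rewrite ltr_pdivrMr ?ltr0n// mul1r ltr_nat.
Qed.

Lemma continuous_enormP n (f : 'rV[R]_n -> R) (x : 'rV[R]_n) :
  {for x, continuous f} <->
  forall e, 0 < e -> exists2 d, 0 < d &
    forall y, enorm (y - x) < d -> `|f y - f x| < e.
Proof.
split=> [cf e e0|cf].
- have /near_enormP[d d0 H] : \forall y \near x, `|f x - f y| < e.
    exact: (cf _ (nbhsx_ballx (f x) e e0)).
  by exists d => // y /H; rewrite distrC.
- move=> A /nbhs_ballP[e /= e0 eA]; have [d d0 H] := cf e e0.
  by apply/near_enormP; exists d => // y /H ye; apply: eA; rewrite /ball/= distrC.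
Qed.

Lemma bounded_enormP n (A : set 'rV[R]_n) :
  bounded_set A <-> exists C, forall x, A x -> enorm x <= C.
Proof.
have nE (x : 'rV[R]_n) :
    `|x| = \big[Num.max/0]_(ij : 'I_1 * 'I_n) `|x ij.1 ij.2| := mx_normrE x.
split=> [[M [_ /(_ (M + 1))]]|[C AC]].
- rewrite ltrDl ltr01 => /(_ isT) AM; exists (n%:R * (M + 1)) => x Ax.
  apply: (le_trans (ler_enorm_sum _)).
  have -> : n%:R * (M + 1) = \sum_(i < n) (M + 1).
    by rewrite sumr_const card_ord mulr_natl.
  apply: ler_sum => i _; apply: le_trans (AM _ Ax).
  rewrite nE.
  exact: (le_bigmax _ (fun ij : 'I_1 * 'I_n => `|x ij.1 ij.2|) (ord0, i)).
- exists C; split; first exact: num_real.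
  move=> M CM x Ax; change (`|x : 'rV[R]_n| <= M); rewrite nE.
  have xM := le_trans (AC _ Ax) (ltW CM).
  apply/bigmax_leP; split => /=; first exact: le_trans (enorm_ge0 x) xM.
  by move=> [i j] _; rewrite (ord1 i)/=; apply: le_trans xM; exact: ler_coord_enorm.
Qed.

End euclid.

(** * Lebesgue measure on tuples: translations and product integrands *)

Section lebesgue_tuple_invariance.
Variable R : realType.
Local Notation RT := (measurableTypeR R).
Local Notation leb := (@lebesgue_measure R).
Local Open Scope ereal_scope.

(** Holds without measurability because integrals of nonnegative functions are
    suprema over simple functions below.  It lets the indicator of an arbitrary
    set be compared with measurable functions. *)
Lemma ge0_le_integral_nomeas d (T : measurableType d)
    (mu : {measure set T -> \bar R}) (f g : T -> \bar R) :
  (forall x, 0 <= f x) -> (forall x, f x <= g x) ->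
  \int[mu]_x f x <= \int[mu]_x g x.
Proof.
move=> f0 fg; have g0 x : 0 <= g x by exact: le_trans (fg x).
rewrite !ge0_integralTE//; apply: le_ereal_sup => _ [h hf <-].
by exists h => // x; exact: le_trans (fg x).
Qed.

Lemma integral_lebesgue_shift (a : R) (f : RT -> \bar R) :
  measurable_fun [set: RT] f -> (forall x, 0 <= f x) ->
  \int[leb]_x f (a + x)%R = \int[leb]_x f x.
Proof.
move=> mf f0.
have ma : measurable_fun [set: RT] (fun x : RT => (a + x)%R : RT).
  by apply: (@measurable_funD _ RT R) => //; exact: measurable_cst.
pose mu : {measure set RT -> \bar R} :=
  measure_function_pushforward__canonical__measure_function_Measure leb ma.
have E A : measurable A -> leb A = mu A.
  apply: lebesgue_measure_unique => X [[x y] _ <-].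
  rewrite /mu/= /pushforward.
  have -> : (fun x0 : RT => (a + x0)%R) @^-1` `]x, y] =
      `](x - a)%R, (y - a)%R]%classic.
    by apply/seteqP; split => z /=; rewrite !in_itv/= => /andP[? ?]; apply/andP; split; lra.
  rewrite !lebesgue_measure_itv/= !lte_fin ltrD2r.
  by case: ifP => // _; rewrite -!EFinB; congr EFin; lra.
transitivity (\int[mu]_x f x).
  by rewrite /mu (@ge0_integral_pushforward _ _ _ _ R _ ma)//.
apply: eq_measure_integral => A mA _; exact/esym/E.
Qed.

Local Notation mu n := (lebesgue_tuple R n).
Local Notation RTn n := (n.-tuple RT).

Lemma integral_lebesgue_tupleS n (f : RTn n.+1 -> \bar R) :
  measurable_fun [set: RTn n.+1] f -> (forall t, 0 <= f t) ->
  \int[mu n.+1]_t f t = \int[leb]_x \int[mu n]_t f (tcons (x, t)).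
Proof.
move=> mf f0.
transitivity (\int[leb \x mu n]_p (f \o @tcons R n) p).
  exact: (ge0_integral_pushforward (@measurable_tcons R n)).
apply: (fubini_tonelli1 (f \o @tcons R n)); last by move=> ? /=; exact: f0.
by apply: measurableT_comp => //; exact: measurable_tcons.
Qed.

Lemma integral_lebesgue_tuple0 (f : RTn 0 -> \bar R) :
  measurable_fun [set: RTn 0] f -> \int[mu 0]_t f t = f [tuple].
Proof. by move=> mf; rewrite /= integral_dirac//= diracT mul1e. Qed.

Definition tuple_of_rV n (v : 'rV[R]_n) : RTn n := [tuple (v ord0 i : RT) | i < n].

Lemma tuple_of_rVK n : cancel (@tuple_of_rV n) (@rV_of_tuple R n).
Proof. by move=> v; apply/rowP => i; rewrite mxE tnth_mktuple. Qed.

Lemma rV_of_tupleK n : cancel (@rV_of_tuple R n) (@tuple_of_rV n).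
Proof. by move=> t; apply: eq_from_tnth => i; rewrite tnth_mktuple mxE. Qed.

(** Row vectors carry no sigma-algebra, so measurability of a vector-valued map
    is expressed coordinatewise. *)
Definition measurable_rV d (T : measurableType d) n (F : T -> 'rV[R]_n) :=
  forall i, measurable_fun [set: T] (fun x => F x ord0 i).

Lemma measurable_tuple_of_rV d (T : measurableType d) n (F : T -> 'rV[R]_n) :
  measurable_rV F -> measurable_fun [set: T] (fun x => tuple_of_rV (F x)).
Proof.
move=> mF; apply/measurable_fun_tnthP => i /=.
rewrite (_ : _ \o _ = fun x => F x ord0 i); first exact: mF.
by apply/funext => x /=; rewrite tnth_mktuple.
Qed.

Lemma measurable_rV_of_tuple d (T : measurableType d) n (F : T -> RTn n) :
  measurable_fun [set: T] F -> measurable_rV (fun x => rV_of_tuple (F x)).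
Proof.
move=> mF i; under eq_fun do rewrite mxE.
exact: (measurableT_comp (measurable_tnth i) mF).
Qed.

Lemma measurable_rVD d (T : measurableType d) n (F G : T -> 'rV[R]_n) :
  measurable_rV F -> measurable_rV G -> measurable_rV (fun x => F x + G x)%R.
Proof.
by move=> mF mG i; under eq_fun do rewrite mxE; exact: measurable_funD.
Qed.

Lemma measurable_rVN d (T : measurableType d) n (F : T -> 'rV[R]_n) :
  measurable_rV F -> measurable_rV (fun x => (- F x)%R).
Proof.
move=> mF i; under eq_fun do rewrite mxE.
exact: (measurable_funN (mF i)).
Qed.

Lemma measurable_rV_mulmx d (T : measurableType d) m n (F : T -> 'rV[R]_m)
    (A : 'M[R]_(m, n)) : measurable_rV F -> measurable_rV (fun x => F x *m A).
Proof.
move=> mF i; under eq_fun do rewrite mxE.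
by apply: measurable_sum => j; apply: measurable_funM => //; exact: measurable_cst.
Qed.

Lemma measurable_rV_cst d (T : measurableType d) n (a : 'rV[R]_n) :
  measurable_rV (fun _ : T => a).
Proof. by move=> i; exact: measurable_cst. Qed.

Lemma measurable_edot d (T : measurableType d) n (F G : T -> 'rV[R]_n) :
  measurable_rV F -> measurable_rV G ->
  measurable_fun [set: T] (fun x => edot (F x) (G x)).
Proof. by move=> mF mG; apply: measurable_sum => i; exact: measurable_funM. Qed.

Lemma rV_of_tcons n x (t : RTn n) :
  rV_of_tuple (tcons (x, t)) = row_mx (x%:M : 'M[R]_1) (rV_of_tuple t)
    :> 'rV[R]_(1 + n).
Proof.
apply/rowP => i; rewrite !mxE; case: splitP => j ij.
  rewrite (ord1 j) !mxE eqxx mulr1n (_ : i = ord0)//.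
  by apply/val_inj; rewrite /= ij (ord1 j).
by rewrite mxE (_ : i = lift ord0 j) ?tnthS//; apply/val_inj; rewrite /= ij.
Qed.

(** One coordinate at a time, by translation invariance on the line and the
    iterated integral. *)
Lemma integral_lebesgue_tuple_shift n (a : 'rV[R]_n) (f : RTn n -> \bar R) :
  measurable_fun [set: RTn n] f -> (forall t, 0 <= f t) ->
  \int[mu n]_t f (tuple_of_rV (a + rV_of_tuple t)) = \int[mu n]_t f t.
Proof.
elim: n a f => [|n IH] a f mf f0.
  rewrite !integral_lebesgue_tuple0//; first by congr f; exact/val_inj/size0nil/size_tuple.
  apply: measurableT_comp => //; apply: measurable_tuple_of_rV.
  by apply: measurable_rVD; [exact: measurable_rV_cst|exact: measurable_rV_of_tuple].
have msh : measurable_fun [set: RTn n.+1]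
    (fun t => f (tuple_of_rV (a + rV_of_tuple t))).
  apply: measurableT_comp => //; apply: measurable_tuple_of_rV.
  by apply: measurable_rVD; [exact: measurable_rV_cst|exact: measurable_rV_of_tuple].
rewrite !integral_lebesgue_tupleS//.
have E x t : f (tuple_of_rV (a + rV_of_tuple (tcons (x, t)))) =
    f (tcons ((a ord0 ord0 + x)%R,
       tuple_of_rV ((\row_i a ord0 (lift ord0 i)) + rV_of_tuple t))).
  congr f; apply: eq_from_tnth => i; rewrite tnth_mktuple !mxE.
  by case: (unliftP ord0 i) => [j ->|->]; rewrite ?tnthS ?tnth_mktuple ?mxE ?tnthS.
under eq_integral do under eq_integral do rewrite E.
have mt : measurable_fun [set: RT * RTn n] (fun p => f (tcons p)).
  by apply: measurableT_comp => //; exact: measurable_tcons.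
under eq_integral => x _.
  rewrite (IH _ (fun t => f (tcons ((a ord0 ord0 + x)%R, t))))//.
    over.
  exact: (measurable_fun_pair2 _ mt).
rewrite (integral_lebesgue_shift (a ord0 ord0) (f := fun x => \int[mu n]_t f (tcons (x, t))))//.
  exact: (measurable_fun_fubini_tonelli_F (fun p => f (tcons p))).
by move=> x; exact: integral_ge0.
Qed.

Lemma integral_lebesgue_tuple_prod n (f : 'I_n -> RT -> R) (c : 'I_n -> R) :
  (forall i, measurable_fun [set: RT] (f i)) -> (forall i x, (0 <= f i x)%R) ->
  (forall i, \int[leb]_x (f i x)%:E = (c i)%:E) ->
  \int[mu n]_t (\prod_(i < n) f i (tnth t i))%:E = (\prod_(i < n) c i)%:E.
Proof.
move=> + + +; elim: n f c => [|n IH] f c mf f0 fc.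
  rewrite integral_lebesgue_tuple0 ?big_ord0//.
  by under eq_fun do rewrite big_ord0; exact: measurable_cst.
have mp m (g : 'I_m -> RT -> R) : (forall i, measurable_fun [set: RT] (g i)) ->
    measurable_fun [set: RTn m] (fun t => (\prod_(i < m) g i (tnth t i))%:E).
  move=> mg; apply/measurable_EFinP; apply: measurable_prod => i _.
  exact: (measurableT_comp (mg i) (measurable_tnth i)).
have p0 m (g : 'I_m -> RT -> R) (t : RTn m) : (forall i x, (0 <= g i x)%R) ->
    0 <= (\prod_(i < m) g i (tnth t i))%:E.
  by move=> g0; rewrite lee_fin; apply: prodr_ge0 => i _.
rewrite integral_lebesgue_tupleS//; [|exact: mp|by move=> t; exact: p0].
have E x (t : RTn n) : (\prod_(i < n.+1) f i (tnth (tcons (x, t)) i))%:E =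
    (f ord0 x)%:E * (\prod_(i < n) f (lift ord0 i) (tnth t i))%:E.
  by rewrite big_ord_recl EFinM; under eq_bigr do rewrite tnthS.
under eq_integral => x _.
  under eq_integral do rewrite E.
  rewrite ge0_integralZl//=; last 3 first.
  - exact: (mp n (fun i => f (lift ord0 i))).
  - by move=> t _; exact: (p0 n (fun i => f (lift ord0 i))).
  - by rewrite lee_fin.
  rewrite (IH (fun i => f (lift ord0 i)) (fun i => c (lift ord0 i)))//.
  over.
rewrite /= ge0_integralZr//=; last 3 first.
- by apply/measurable_EFinP; exact: mf.
- by move=> x _; rewrite lee_fin.
- rewrite lee_fin; apply: prodr_ge0 => i _; rewrite -lee_fin -fc.
  by apply: integral_ge0 => x _; rewrite lee_fin.
by rewrite fc big_ord_recl EFinM.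
Qed.

End lebesgue_tuple_invariance.

(** * The heat kernel and rotation invariance *)

Section heat_kernel_tuple.
Variable R : realType.
Local Notation RT := (measurableTypeR R).
Local Notation leb := (@lebesgue_measure R).
Local Notation mu n := (lebesgue_tuple R n).
Local Notation RTn n := (n.-tuple RT).

Definition heat1_peak (h : R) : R := (Num.sqrt (4 * pi * h))^-1.

Definition heat1 (h x : R) : R := heat1_peak h * expR (- (x ^+ 2 / (4 * h))).

Lemma heat1_peak_gt0 h : 0 < h -> 0 < heat1_peak h.
Proof. by move=> h0; rewrite invr_gt0 sqrtr_gt0 !mulr_gt0// pi_gt0. Qed.

Lemma heat1_ge0 h x : 0 <= heat1 h x.
Proof. by rewrite mulr_ge0 ?expR_ge0// invr_ge0 sqrtr_ge0. Qed.

Lemma measurable_heat1 h : measurable_fun [set: RT] (heat1 h).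
Proof.
apply: measurable_funM; first exact: measurable_cst.
apply: measurableT_comp => //; apply: measurableT_comp => //.
by apply: measurable_funM; [exact: measurable_funX|exact: measurable_cst].
Qed.

Lemma heat1_normal_pdf h : 0 < h -> heat1 h = normal_pdf 0 (Num.sqrt (2 * h)).
Proof.
move=> h0; have s0 : Num.sqrt (2 * h) != 0 by rewrite gt_eqF// sqrtr_gt0 mulr_gt0.
apply/funext => x; rewrite normal_pdfE// /normal_peak /normal_fun /heat1 /heat1_peak.
rewrite sqr_sqrtr ?mulr_ge0// ?ltW// subr0; congr (_^-1 * expR _).
  by congr Num.sqrt; rewrite -mulr_natr; ring.
by rewrite -[2 * h *+ 2]mulr_natr mulNr; congr (- (_ / _)); ring.
Qed.

Lemma integral_heat1 h : 0 < h -> (\int[leb]_x (heat1 h x)%:E = 1)%E.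
Proof. by move=> h0; rewrite heat1_normal_pdf// integral_normal_pdf. Qed.

Lemma heat_kernel_prod n h (v : 'rV[R]_n) : 0 < h ->
  heat_kernel h v = \prod_(i < n) heat1 h (v ord0 i).
Proof.
move=> h0; rewrite /heat_kernel /heat1 big_split/= prodr_const card_ord.
congr (_ * _); last first.
  rewrite sqr_enorm /edot mulr_suml -sumrN expR_sum; apply: eq_bigr => i _.
  by rewrite -expr2.
have p0 : 0 <= 4 * pi * h :> R by rewrite !mulr_ge0 ?pi_ge0// ltW.
rewrite /heat1_peak -powR12_sqrt// -powRN -[RHS]powR_mulrn ?powR_ge0// -powRrM.
by congr (_ `^ _); rewrite mulrC mulNr mulrC.
Qed.

Lemma heat_kernel_ge0 n h (v : 'rV[R]_n) : 0 <= heat_kernel h v.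
Proof. by rewrite mulr_ge0// ?powR_ge0 ?expR_ge0. Qed.

Lemma heat_kernelE n h (v : 'rV[R]_n) : 0 < h ->
  heat_kernel h v = heat1_peak h ^+ n * expR (- (edot v v / (4 * h))).
Proof.
move=> h0; rewrite heat_kernel_prod// big_split/= prodr_const card_ord.
by congr (_ * _); rewrite /edot mulr_suml -sumrN expR_sum.
Qed.

Lemma measurable_heat_kernel d (T : measurableType d) n h (F : T -> 'rV[R]_n) :
  0 < h -> measurable_rV F -> measurable_fun [set: T] (fun t => heat_kernel h (F t)).
Proof.
move=> h0 mF; under eq_fun do rewrite heat_kernelE//.
apply: measurable_funM; first exact: measurable_cst.
apply: measurableT_comp => //; apply: measurableT_comp => //.
by apply: measurable_funM; [exact: measurable_edot|exact: measurable_cst].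
Qed.

Lemma measurable_rV_id n : measurable_rV (@rV_of_tuple R n).
Proof. exact: (measurable_rV_of_tuple (F := id)). Qed.

Lemma integral_heat_kernel n h : 0 < h ->
  (\int[mu n]_t (heat_kernel h (rV_of_tuple t))%:E = 1)%E.
Proof.
move=> h0; transitivity ((\prod_(i < n) (1 : R))%:E); last by rewrite big1.
rewrite -(@integral_lebesgue_tuple_prod _ n (fun=> heat1 h)).
- by apply: eq_integral => t _; rewrite heat_kernel_prod//; under eq_bigr do rewrite mxE.
- by move=> _; exact: measurable_heat1.
- by move=> _ x; exact: heat1_ge0.
- by move=> _; exact: integral_heat1.
Qed.

Lemma heat_kernelN n h (v : 'rV[R]_n) : heat_kernel h (- v) = heat_kernel h v.
Proof. by rewrite /heat_kernel enormN. Qed.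

Local Open Scope ereal_scope.

(** Integrate g(s) f(s + t O) over s and t, where g is the Gaussian of integral
    1.  The t-integral is translation invariant, so the result is the left-hand
    side.  Exchanging the order and translating s by t O turns it into the
    integral of g(s O^T - t) f(s), because g is rotation invariant; integrating
    over t leaves the right-hand side.  Thus rotation invariance of Lebesgue
    measure follows from translation invariance and Fubini alone. *)
Lemma integral_lebesgue_tuple_orth n (O : 'M[R]_n) (f : RTn n -> \bar R) :
  O *m O^T = 1%:M -> measurable_fun [set: RTn n] f -> (forall t, 0 <= f t) ->
  \int[mu n]_t f (tuple_of_rV (rV_of_tuple t *m O)) = \int[mu n]_t f t.
Proof.
move=> O1 mf f0; have O1' : O^T *m O = 1%:M by apply/mulmx1C.
pose g v : R := heat_kernel 1 (v : 'rV[R]_n).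
have g0 v : (0 <= g v)%R by exact: heat_kernel_ge0.
have g1 : \int[mu n]_t (g (rV_of_tuple t))%:E = 1 by rewrite integral_heat_kernel.
have mid := @measurable_rV_id n.
have mfO d (T : measurableType d) (F : T -> 'rV[R]_n) : measurable_rV F ->
    measurable_fun [set: T] (fun x => f (tuple_of_rV (F x))).
  by move=> mF; apply: measurableT_comp => //; exact: measurable_tuple_of_rV.
have mg d (T : measurableType d) (F : T -> 'rV[R]_n) : measurable_rV F ->
    measurable_fun [set: T] (fun x => (g (F x))%:E).
  by move=> mF; apply/measurable_EFinP; exact: measurable_heat_kernel.
have mfst : measurable_rV (fun p : RTn n * RTn n => rV_of_tuple p.1).
  exact: measurable_rV_of_tuple.
have msnd : measurable_rV (fun p : RTn n * RTn n => rV_of_tuple p.2).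
  exact: measurable_rV_of_tuple.
set I := LHS.
pose F (p : RTn n * RTn n) : \bar R := (g (rV_of_tuple p.1))%:E *
  f (tuple_of_rV (rV_of_tuple p.1 + rV_of_tuple p.2 *m O)).
have F0 p : 0 <= F p by rewrite mule_ge0// lee_fin.
have mF : measurable_fun [set: RTn n * RTn n] F.
  apply: emeasurable_funM; first exact: mg.
  by apply: mfO; apply: measurable_rVD => //; exact: measurable_rV_mulmx.
transitivity (\int[mu n]_s \int[mu n]_t F (s, t)).
  transitivity (\int[mu n]_s ((g (rV_of_tuple s))%:E * I)).
    rewrite ge0_integralZr ?g1 ?mul1e//.
    - exact: mg.
    - by move=> s _; rewrite lee_fin.
    - exact: integral_ge0.
  apply: eq_integral => s _; rewrite /F/= ge0_integralZl//; last 2 first.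
  - apply: mfO; apply: measurable_rVD; first exact: measurable_rV_cst.
    exact: measurable_rV_mulmx.
  - by rewrite lee_fin.
  congr (_ * _); rewrite /I.
  rewrite -(integral_lebesgue_tuple_shift (rV_of_tuple s *m O^T)%R).
  - apply: eq_integral => t _; rewrite tuple_of_rVK mulmxDl -mulmxA O1' mulmx1//.
  - by apply: mfO; exact: measurable_rV_mulmx.
  - by [].
rewrite fubini_tonelli//.
pose G (p : RTn n * RTn n) : \bar R :=
  (g (rV_of_tuple p.1 *m O^T - rV_of_tuple p.2))%:E * f p.1.
have G0 p : 0 <= G p by rewrite mule_ge0// lee_fin.
have mG : measurable_fun [set: RTn n * RTn n] G.
  apply: emeasurable_funM; last exact: measurableT_comp.
  apply: mg; apply: measurable_rVD; first exact: measurable_rV_mulmx.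
  exact: measurable_rVN.
transitivity (\int[mu n]_t \int[mu n]_s G (s, t)).
  apply: eq_integral => t _.
  rewrite -(@integral_lebesgue_tuple_shift R n (rV_of_tuple t *m O) (fun s => G (s, t))).
  - apply: eq_integral => s _; rewrite /F /G/= tuple_of_rVK [(_ *m O + _)%R]addrC.
    by rewrite mulmxDl -mulmxA O1 mulmx1 addrK /g /heat_kernel enorm_isometry ?trmxK.
  - exact: (measurable_fun_pair1 t mG).
  - by [].
rewrite -fubini_tonelli//; apply: eq_integral => s _.
rewrite /G/= ge0_integralZr//; last 2 first.
  apply: mg.
  apply: measurable_rVD; first exact: measurable_rV_cst.
  exact: measurable_rVN.
  by move=> t _; rewrite lee_fin.
rewrite -[RHS]mul1e; congr (_ * _); rewrite -g1.
rewrite -(@integral_lebesgue_tuple_shift R n (- (rV_of_tuple s *m O^T))%R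
  (fun t => (g (rV_of_tuple t))%:E)).
- by apply: eq_integral => t _; rewrite /= tuple_of_rVK /g -heat_kernelN opprB addrC.
- exact: mg.
- by move=> t; rewrite lee_fin.
Qed.

Lemma integral_lebesgue_tuple_rigid n (a : 'rV[R]_n) (O : 'M[R]_n)
    (f : RTn n -> \bar R) :
  O *m O^T = 1%:M -> measurable_fun [set: RTn n] f -> (forall t, 0 <= f t) ->
  \int[mu n]_t f (tuple_of_rV (a + rV_of_tuple t *m O)) = \int[mu n]_t f t.
Proof.
move=> O1 mf f0; rewrite -(integral_lebesgue_tuple_shift a mf f0).
rewrite -(integral_lebesgue_tuple_orth
  (f := fun t => f (tuple_of_rV (a + rV_of_tuple t))) O1) => //.
- by apply: eq_integral => t _; rewrite tuple_of_rVK.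
- apply: measurableT_comp => //; apply: measurable_tuple_of_rV.
  by apply: measurable_rVD; [exact: measurable_rV_cst|exact: measurable_rV_id].
Qed.

End heat_kernel_tuple.

(** * The heat flow of a half-line *)

Section heat1_halfline.
Variable R : realType.
Local Notation RT := (measurableTypeR R).
Local Notation leb := (@lebesgue_measure R).
Local Notation H h D := (\int[leb]_(x in D) (heat1 h x)%:E)%E.

Lemma heat1_le (h x : R) : 0 < h -> heat1 h x <= heat1_peak h.
Proof.
move=> h0; apply: ler_piMr; first by rewrite ltW ?heat1_peak_gt0.
rewrite -[leRHS]expR0 ler_expR oppr_le0 divr_ge0 ?sqr_ge0// mulr_ge0//.
exact: ltW.
Qed.

Lemma heat1_ge (h x : R) : 0 < h -> heat1_peak h * (1 - x ^+ 2 / (4 * h)) <= heat1 h x.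
Proof.
by move=> h0; apply: ler_wpM2l; [rewrite ltW ?heat1_peak_gt0|exact: expR_ge1Dx].
Qed.

Lemma heat1_itv (D : interval R) (h a m : R) : 0 < h -> 0 <= m -> 0 <= a ->
  leb [set` D] = a%:E -> (forall x, x \in D -> `|x| <= m) ->
  exists2 c, H h [set` D] = c%:E &
    heat1_peak h * (a * (1 - m ^+ 2 / (4 * h))) <= c <= heat1_peak h * a.
Proof.
move=> h0 m0 a0 Da Dm; have k0 := heat1_peak_gt0 h0.
have mH : measurable_fun [set` D] (fun x => (heat1 h x)%:E).
  by apply/measurable_EFinP/measurable_funTS; exact: measurable_heat1.
have U : (H h [set` D] <= (heat1_peak h * a)%:E)%E.
  rewrite EFinM -Da -integral_cst//; apply: ge0_le_integral => //.
  - by move=> x _; rewrite lee_fin heat1_ge0.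
  - by move=> x _; rewrite lee_fin heat1_le.
have H0 : (0 <= H h [set` D])%E.
  by apply: integral_ge0 => x _; rewrite lee_fin heat1_ge0.
have fH : H h [set` D] \is a fin_num.
  by rewrite ge0_fin_numE// (le_lt_trans U)// ltry.
exists (fine (H h [set` D])); first by rewrite fineK.
rewrite -!lee_fin !fineK// U andbT.
have [s0|s0] := leP (1 - m ^+ 2 / (4 * h)) 0.
  apply: le_trans H0; rewrite lee_fin; apply: mulr_ge0_le0; first exact: ltW.
  exact: mulr_ge0_le0.
rewrite (_ : heat1_peak h * _ = heat1_peak h * (1 - m ^+ 2 / (4 * h)) * a); last by ring.
rewrite EFinM -Da -integral_cst//; apply: ge0_le_integral => //.
- by move=> x _; rewrite lee_fin mulr_ge0 ?ltW.
- move=> x xD; rewrite lee_fin; apply: le_trans (heat1_ge x h0).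
  apply: ler_wpM2l; first exact: ltW.
  rewrite lerD2l lerN2 ler_pM2r ?invr_gt0 ?mulr_gt0//.
  by rewrite -[x ^+ 2]real_normK ?num_real// lerXn2r ?nnegrE// Dm.
Qed.

(** The kernel is even with integral 1. *)
Lemma heat1_half (h : R) : 0 < h -> H h `]-oo, (0 : R)%R[ = (2^-1)%:E.
Proof.
move=> h0.
have mH D : measurable_fun D (fun x => (heat1 h x)%:E).
  by apply/measurable_EFinP/measurable_funTS; exact: measurable_heat1.
have := integral_heat1 h0.
rewrite ge0_symfun_integralT; last 3 first.
- by move=> x; exact: heat1_ge0.
- move=> x; rewrite /heat1; apply: cvgM; first exact: cvg_cst.
  apply: continuous_comp; last exact: continuous_expR.
  apply: cvgN; apply: cvgM; last exact: cvg_cst.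
  exact: exprn_continuous.
- by move=> x; rewrite /= /heat1 sqrrN.
rewrite -set_itvcy => h1.
have hp : H h `[(0 : R)%R, +oo[ = (2^-1)%:E.
  have: (0 <= H h `[(0 : R)%R, +oo[)%E.
    by apply: integral_ge0 => x _; rewrite lee_fin heat1_ge0.
  move: h1; case: (integral _ _ _) => [r||]//=; last by rewrite gt0_muley ?lte_fin.
  by rewrite -EFinM => -[r1] _; congr EFin; lra.
have := integral_heat1 h0.
rewrite -(setUv `]-oo, (0 : R)[%classic) ge0_integral_setU//=; try exact: mH.
- rewrite setCitvl hp.
  have : forall I : \bar R, (I + (2^-1)%:E)%E = 1%E -> I = (2^-1)%:E.
    by move=> [r||]//=; rewrite -EFinD => -[r1]; congr EFin; lra.
  exact.
- exact: measurableC.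
- by move=> x _; rewrite lee_fin heat1_ge0.
- by rewrite disj_set2E setICr eqxx.
Qed.

(** Add to the half-line below 0, or remove from it, the interval between 0
    and a.  The error is cubic in a because the kernel is flat at its peak. *)
Lemma heat1_cdf (h a : R) : 0 < h -> exists2 c, H h `]-oo, a[ = c%:E &
  `|c - (2^-1 + heat1_peak h * a)| <= heat1_peak h * (`|a| ^+ 3 / (4 * h)).
Proof.
move=> h0.
have mH D : measurable_fun D (fun x => (heat1 h x)%:E).
  by apply/measurable_EFinP/measurable_funTS; exact: measurable_heat1.
have disj (x y : R) : [disjoint `]-oo, x[ & `[x, y[]%classic.
  rewrite disj_set2E; apply/eqP; rewrite -subset0 => z /=.
  by rewrite !in_itv/= => -[zx /andP[]]; rewrite leNgt zx.
have lb (x y : R) : x <= y -> leb `[x, y[%classic = (y - x)%:E.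
  rewrite lebesgue_measure_itv/= lte_fin le_eqVlt => /predU1P[->|->]//.
  by rewrite ltxx subrr.
have [a0|/ltW a0] := leP 0 a.
- have -> : `]-oo, a[%classic = `]-oo, (0 : R)[%classic `|` `[(0 : R), a[%classic.
    apply/seteqP; split => z /=; rewrite !in_itv/=.
      by move=> za; have [|] := ltP z 0; [left|right].
    by move=> [/lt_le_trans->//|/andP[]].
  rewrite ge0_integral_setU//=; try exact: mH; last by move=> x _; rewrite lee_fin heat1_ge0.
  rewrite heat1_half//.
  have [||c -> /andP[c1 c2]] := @heat1_itv `[(0 : R)%R, a[ h a a h0 a0 a0.
  - by rewrite lb// subr0.
  - by move=> x; rewrite in_itv/= => /andP[x0 xa]; rewrite ger0_norm// ltW.
  exists (2^-1 + c) => //; rewrite (ger0_norm a0).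
  have -> : 2^-1 + c - (2^-1 + heat1_peak h * a) = c - heat1_peak h * a by ring.
  rewrite ler0_norm ?subr_le0// opprB lerBlDr -lerBlDl; apply: le_trans c1.
  by apply: le_of_eq; field; rewrite gt_eqF.
- have E : `]-oo, (0 : R)[%classic = `]-oo, a[%classic `|` `[a, (0 : R)[%classic :> set R.
    apply/seteqP; split => z /=; rewrite !in_itv/=.
      by move=> za; have [|] := ltP z a; [left|right].
    by move=> [/lt_le_trans->//|/andP[]].
  have := heat1_half h0; rewrite E.
  rewrite ge0_integral_setU//=; try exact: mH; last by move=> x _; rewrite lee_fin heat1_ge0.
  have a0' : 0 <= - a by rewrite oppr_ge0.
  have [||c -> /andP[c1 c2]] := @heat1_itv `[a, (0 : R)%R[ h (- a) (- a) h0 a0' a0'.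
  - by rewrite lb// sub0r.
  - by move=> x; rewrite in_itv/= => /andP[ax x0]; rewrite ltr0_norm// lerN2.
  have : forall I : \bar R, (I + c%:E)%E = (2^-1)%:E ->
      exists2 r, I = r%:E & r + c = 2^-1.
    by move=> [r||]//=; rewrite -EFinD => -[r1]; exists r.
  move=> /[apply] -[r -> rc].
  exists r => //; rewrite (ler0_norm a0).
  have -> : r - (2^-1 + heat1_peak h * a) = - (c - heat1_peak h * - a) by rewrite -rc; ring.
  rewrite normrN ler0_norm ?subr_le0// opprB lerBlDr -lerBlDl; apply: le_trans c1.
  by apply: le_of_eq; field; rewrite gt_eqF.
Qed.

End heat1_halfline.

(** * Moments of the heat kernel *)

Section has_integral.
Context d (T : measurableType d) (R : realType) (mu : {measure set T -> \bar R}).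
Implicit Types (f g : T -> R) (a b c : R).

(** Integrability and value together, so that pointwise identities and
    inequalities can be integrated without repeating side conditions. *)
Definition has_integral f c :=
  mu.-integrable [set: T] (EFin \o f) /\ (\int[mu]_x (f x)%:E = c%:E)%E.

Lemma ge0_has_integral f c : measurable_fun [set: T] f -> (forall x, 0 <= f x) ->
  (\int[mu]_x (f x)%:E = c%:E)%E -> has_integral f c.
Proof.
move=> mf f0 fc; split=> //; apply/integrableP; split; first exact/measurable_EFinP.
under eq_integral do rewrite /= ger0_norm//.
by rewrite fc ltry.
Qed.

Lemma has_integralD f g a b : has_integral f a -> has_integral g b ->
  has_integral (fun x => f x + g x) (a + b).
Proof.
move=> [fi fa] [gi gb]; split.
  apply: (eq_integrable measurableT _ _ _ (integrableD measurableT fi gi)).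
  by move=> x _; rewrite /= EFinD.
under eq_integral do rewrite EFinD.
by rewrite integralD//= fa gb.
Qed.

Lemma has_integralZ f a c : has_integral f a ->
  has_integral (fun x => c * f x) (c * a).
Proof.
move=> [fi fa]; split.
  apply: (eq_integrable measurableT _ _ _ (integrableZl measurableT c fi)).
  by move=> x _; rewrite /= EFinM.
under eq_integral do rewrite EFinM.
by rewrite integralZl//= fa.
Qed.

Lemma has_integral_sum n (f : 'I_n -> T -> R) (a : 'I_n -> R) :
  (forall i, has_integral (f i) (a i)) ->
  has_integral (fun x => \sum_(i < n) f i x) (\sum_(i < n) a i).
Proof.
elim: n f a => [|n IH] f a fa.
  rewrite big_ord0; split.
    apply: (eq_integrable measurableT _ _ _ (integrable0 mu setT)) => x _.
    by rewrite /= big_ord0.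
  by rewrite integral0_eq// => x _; rewrite big_ord0.
rewrite big_ord_recl.
rewrite (_ : (fun _ => _) = fun x => f ord0 x + \sum_(i < n) f (lift ord0 i) x).
  by apply: has_integralD => //; exact: IH.
by apply/funext => x; rewrite big_ord_recl.
Qed.

Lemma has_integral_le f g a b : has_integral f a -> has_integral g b ->
  (forall x, f x <= g x) -> a <= b.
Proof.
move=> [fi fa] [gi gb] fg; rewrite -lee_fin -fa -gb.
by apply: le_integral => // x _; rewrite lee_fin.
Qed.

Lemma has_integral_dom f g b : measurable_fun [set: T] f -> has_integral g b ->
  (forall x, 0 <= f x <= g x) -> exists a, has_integral f a.
Proof.
move=> mf [gi gb] fg.
have f0 x : 0 <= f x by have /andP[] := fg x.
have g0 x : 0 <= g x by have /andP[? ?] := fg x; apply: (@le_trans _ _ (f x)).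
have fi : mu.-integrable [set: T] (EFin \o f).
  apply: (le_integrable measurableT _ _ gi); first exact/measurable_EFinP.
  by move=> x _; rewrite /= lee_fin !ger0_norm//; have /andP[] := fg x.
exists (fine (\int[mu]_x (f x)%:E)); split => //.
by rewrite fineK//; exact: integrable_fin_num.
Qed.

End has_integral.

Section gauss_moments.
Variable R : realType.
Local Notation RT := (measurableTypeR R).
Local Notation leb := (@lebesgue_measure R).
Local Notation mu n := (lebesgue_tuple R n).
Local Notation RTn n := (n.-tuple RT).

Lemma has_integral_heat1 (h : R) : 0 < h -> has_integral leb (heat1 h) 1.
Proof.
move=> h0; apply: ge0_has_integral; [exact: measurable_heat1|exact: heat1_ge0|].
exact: integral_heat1.
Qed.

Lemma heat1_peak_scale (h u : R) : 0 < h -> 0 < u -> heat1_peak (h / u ^+ 2) = u * heat1_peak h.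
Proof.
move=> h0 u0; rewrite /heat1_peak mulrA sqrtrM ?mulr_ge0 ?pi_ge0 ?ltW//.
by rewrite sqrtrV ?sqr_ge0// sqrtr_sqr gtr0_norm// invfM invrK mulrC.
Qed.

(** Multiplying a Gaussian by a Gaussian exponential changes its variance. *)
Lemma heat1_tilt (h u x : R) : 0 < h -> 0 < u ->
  heat1 h x * expR ((1 - u ^+ 2) * (x ^+ 2 / (4 * h))) =
  u^-1 * heat1 (h / u ^+ 2) x.
Proof.
move=> h0 u0; rewrite /heat1 heat1_peak_scale// !mulrA mulVf ?gt_eqF// mul1r.
rewrite -mulrA -expRD; congr (_ * expR _).
by field; rewrite !gt_eqF.
Qed.

Lemma has_integral_heat1_tilt (h u : R) : 0 < h -> 0 < u ->
  has_integral leb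
    (fun x => heat1 h x * expR ((1 - u ^+ 2) * (x ^+ 2 / (4 * h)))) u^-1.
Proof.
move=> h0 u0; rewrite (_ : (fun _ => _) = fun x => u^-1 * heat1 (h / u ^+ 2) x).
  rewrite -[X in has_integral _ _ X]mulr1; apply: has_integralZ.
  by apply: has_integral_heat1; rewrite divr_gt0 ?exprn_gt0.
by apply/funext => x; exact: heat1_tilt.
Qed.

(** The tilted integral is 1/u for every u > 0, and exp(y) >= 1 + y bounds it
    below by 1 + (1 - u^2) c with c = m / 4h.  Both sides agree at u = 1, so the
    tangent inequality forces c = 1/2.  This replaces differentiation under the
    integral or integration by parts. *)
Lemma has_integral_heat1_sqr (h : R) : 0 < h ->
  has_integral leb (fun x => heat1 h x * x ^+ 2) (2 * h).
Proof.
move=> h0; have h40 : 0 < 4 * h by rewrite mulr_gt0.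
have mm : measurable_fun [set: RT] (fun x => heat1 h x * x ^+ 2).
  by apply: measurable_funM; [exact: measurable_heat1|exact: measurable_funX].
have [m Hm] : exists m, has_integral leb (fun x => heat1 h x * x ^+ 2) m.
  have u0 : 0 < Num.sqrt (2^-1 : R) by rewrite sqrtr_gt0 invr_gt0.
  have H := has_integralZ (2 * (4 * h)) (has_integral_heat1_tilt h0 u0).
  apply: (has_integral_dom mm H) => x.
  rewrite mulr_ge0 ?heat1_ge0 ?sqr_ge0//= [leRHS]mulrCA; apply: ler_wpM2l; first exact: heat1_ge0.
  rewrite sqr_sqrtr ?invr_ge0//.
  set y := _ / _; have -> : x ^+ 2 = 4 * h * y by rewrite mulrC divfK ?gt_eqF.
  have := expR_ge1Dx ((1 - 2^-1) * y).
  set e := expR _ => He; rewrite [leRHS](_ : _ = 4 * h * (2 * e)); last by ring.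
  rewrite ler_pM2l//; have : 0 < e by exact: expR_gt0.
  by move: He; lra.
suff -> : 2 * h = m by [].
have key u : 0 < u -> 1 + (1 - u ^+ 2) * (m / (4 * h)) <= u^-1.
  move=> u0.
  have Hs := has_integralD (has_integral_heat1 h0) (has_integralZ ((1 - u ^+ 2) / (4 * h)) Hm).
  have := has_integral_le Hs (has_integral_heat1_tilt h0 u0).
  rewrite [_ * m](_ : _ = (1 - u ^+ 2) * (m / (4 * h))); last by rewrite mulrAC mulrA.
  apply => x; rewrite -{1}[heat1 h x]mulr1 mulrCA -mulrDr.
  apply: ler_wpM2l; first exact: heat1_ge0.
  by rewrite mulrAC -mulrA; exact: expR_ge1Dx.
set c := m / (4 * h) in key *.
suff cE : c = 2^-1.
  apply: (mulIf (negbT (gt_eqF (_ : 0 < (4 * h)^-1)))); rewrite ?invr_gt0// -/c cE.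
  by field; rewrite gt_eqF.
have key2 u : 0 < u -> (1 - u) * (c * (u * (1 + u))) <= 1 - u.
  move=> u0; have := key _ u0; rewrite -(ler_pM2l u0) mulfV ?gt_eqF// => k.
  have -> : (1 - u) * (c * (u * (1 + u))) = u * (1 + (1 - u ^+ 2) * c) - u by ring.
  by lra.
have c_ge0 : 0 <= c.
  rewrite divr_ge0 ?(ltW h40)//.
  have H0 := has_integralZ 0 Hm; rewrite mul0r in H0.
  by apply: (has_integral_le H0 Hm) => x; rewrite mul0r mulr_ge0 ?heat1_ge0 ?sqr_ge0.
have c_gt0 : 0 < c.
  rewrite lt_def c_ge0 andbT; apply/eqP => c0.
  have := @key2 2 (ltr0Sn _ _); rewrite c0; lra.
have u0 : 0 < Num.sqrt (2 * c)^-1 by rewrite sqrtr_gt0 invr_gt0 mulr_gt0.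
have := key2 _ u0; have := @sqr_sqrtr _ (2 * c)^-1.
rewrite invr_ge0 mulr_ge0// => /(_ isT).
set u := Num.sqrt _ in u0 * => u2.
have cu : c * u ^+ 2 = 2^-1 by rewrite u2; field; rewrite gt_eqF.
rewrite [c * (u * (1 + u))](_ : _ = c * u ^+ 2 + c * u); last by ring.
rewrite cu => k3.
have [u1|u1|u1] := ltgtP u 1.
- exfalso; move: k3; rewrite -[leRHS]mulr1 ler_pM2l ?subr_gt0//.
  have : c * u ^+ 2 < c * u by rewrite ltr_pM2l// expr2 gtr_pMl.
  rewrite cu; lra.
- exfalso; move: k3; rewrite -[leRHS]mulr1 ler_nM2l ?subr_lt0//.
  have : c * u < c * u ^+ 2 by rewrite ltr_pM2l// expr2 ltr_pMr.
  rewrite cu; lra.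
- by move: cu; rewrite u1 expr1n mulr1.
Qed.

Lemma has_integral_heat_kernel n (h : R) : 0 < h ->
  has_integral (mu n) (fun t => heat_kernel h (rV_of_tuple t)) 1.
Proof.
move=> h0; apply: ge0_has_integral.
- by apply: measurable_heat_kernel => //; exact: measurable_rV_id.
- by move=> t; exact: heat_kernel_ge0.
- exact: integral_heat_kernel.
Qed.

Lemma has_integral_heat_kernel_sqr n (h : R) (i : 'I_n) : 0 < h ->
  has_integral (mu n)
    (fun t => heat_kernel h (rV_of_tuple t) * tnth t i ^+ 2) (2 * h).
Proof.
move=> h0; apply: ge0_has_integral.
- apply: measurable_funM.
    by apply: measurable_heat_kernel => //; exact: measurable_rV_id.
  by apply: measurable_funX; exact: measurable_tnth.
- by move=> t; rewrite mulr_ge0 ?heat_kernel_ge0 ?sqr_ge0.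
pose f j (x : RT) := if j == i then heat1 h x * x ^+ 2 else heat1 h x : R.
pose c (j : 'I_n) : R := if j == i then 2 * h else 1.
transitivity ((\prod_(j < n) c j)%:E); last first.
  by rewrite (bigD1 i)//= /c eqxx big1 ?mulr1// => j /negbTE ->.
rewrite -(@integral_lebesgue_tuple_prod _ n f).
- apply: eq_integral => t _; rewrite heat_kernel_prod//; congr EFin.
  rewrite (bigD1 i)//= [RHS](bigD1 i)//= /f eqxx mulrAC mxE; congr (_ * _).
  by apply: eq_bigr => j /negbTE ->; rewrite mxE.
- move=> j; rewrite /f; case: (j == i); last exact: measurable_heat1.
  by apply: measurable_funM; [exact: measurable_heat1|exact: measurable_funX].
- move=> j x; rewrite /f; case: (j == i); last exact: heat1_ge0.
  by apply: mulr_ge0; [exact: heat1_ge0|exact: sqr_ge0].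
- move=> j; rewrite /f /c; case: (j == i); last exact: integral_heat1.
  by have [_] := has_integral_heat1_sqr h0.
Qed.

(** The exponential halves the exponent of the kernel, which becomes the
    kernel at time 2h.  Used to dominate all polynomial error terms at once. *)
Lemma has_integral_heat_kernel_exp n (h : R) : 0 < h ->
  has_integral (mu n)
    (fun t => heat_kernel h (rV_of_tuple t) *
       expR (edot (rV_of_tuple t) (rV_of_tuple t) / (8 * h))) (Num.sqrt 2 ^+ n).
Proof.
move=> h0; have h20 : 0 < 2 * h by rewrite mulr_gt0.
have k2 : heat1_peak h = Num.sqrt 2 * heat1_peak (2 * h).
  rewrite /heat1_peak (_ : 4 * pi * (2 * h) = 2 * (4 * pi * h)); last by ring.
  by rewrite (@sqrtrM _ 2)// invfM mulrA mulfV ?mul1r// gt_eqF// sqrtr_gt0.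
rewrite (_ : (fun _ => _) = fun t : RTn n => Num.sqrt 2 ^+ n * heat_kernel (2 * h) (rV_of_tuple t)).
  rewrite -[X in has_integral _ _ X]mulr1; apply: has_integralZ.
  exact: has_integral_heat_kernel.
apply/funext => t; rewrite !heat_kernelE// k2 exprMn -!mulrA; congr (_ * (_ * _)).
by rewrite -expRD; congr expR; field; rewrite gt_eqF.
Qed.

End gauss_moments.

(** * Heat averages in an orthonormal frame *)

Section heat_average.
Variable R : realType.
Local Notation RT := (measurableTypeR R).
Local Notation leb := (@lebesgue_measure R).
Local Notation mu n := (lebesgue_tuple R n).
Local Notation RTn n := (n.-tuple RT).

Definition orthonormal_frame n (nu : 'rV[R]_n.+1) (T : 'M[R]_(n, n.+1)) :=
  [/\ T *m T^T = 1%:M, T *m nu^T = 0 & edot nu nu = 1].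

Definition frame_mx n (nu : 'rV[R]_n.+1) (T : 'M[R]_(n, n.+1)) : 'M[R]_n.+1 :=
  col_mx nu T.

Lemma frame_mx_orth n (nu : 'rV[R]_n.+1) (T : 'M[R]_(n, n.+1)) :
  orthonormal_frame nu T -> frame_mx nu T *m (frame_mx nu T)^T = 1%:M.
Proof.
move=> [TT Tnu nn]; rewrite /frame_mx (tr_col_mx nu T).
apply: (etrans (mul_col_row nu T nu^T T^T)).
rewrite mulmx_trE nn TT Tnu -[nu *m T^T]trmxK trmx_mul trmxK Tnu trmx0.
exact/esym/(@scalar_mx_block _ 1 n).
Qed.

Lemma rV_of_tcons_frame n (nu : 'rV[R]_n.+1) (T : 'M[R]_(n, n.+1)) s (t : RTn n) :
  rV_of_tuple (tcons (s, t)) *m frame_mx nu T = s *: nu + rV_of_tuple t *m T.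
Proof.
rewrite /frame_mx rV_of_tcons.
by apply: (etrans (mul_row_col s%:M _ nu T)); rewrite mul_scalar_mx.
Qed.

Lemma edot_tcons n s (t : RTn n) :
  edot (rV_of_tuple (tcons (s, t))) (rV_of_tuple (tcons (s, t))) =
  s ^+ 2 + edot (rV_of_tuple t) (rV_of_tuple t).
Proof.
rewrite /edot big_ord_recl !mxE/= expr2; congr (_ + _).
by apply: eq_bigr => i _; rewrite !mxE tnthS.
Qed.

Local Notation K h t := (heat_kernel h (rV_of_tuple t)).

(** The rigid motion t |-> z + s nu + t T preserves Lebesgue measure and the
    kernel. *)
Lemma heat_average_frameE n (nu : 'rV[R]_n.+1) (T : 'M[R]_(n, n.+1)) (h : R)
    (z : 'rV[R]_n.+1) (b : RTn n.+1 -> R) :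
  0 < h -> orthonormal_frame nu T -> measurable_fun [set: RTn n.+1] b ->
  (forall t, 0 <= b t) ->
  (\int[mu n.+1]_t (K h t * b t)%:E =
   \int[mu n.+1]_y (heat_kernel h (z - rV_of_tuple y) *
      b (tuple_of_rV ((rV_of_tuple y - z) *m (frame_mx nu T)^T)))%:E)%E.
Proof.
move=> h0 /frame_mx_orth MM mb b0; set M := frame_mx nu T in MM *.
have maff (O : 'M[R]_n.+1) : measurable_rV (fun y : RTn n.+1 => (rV_of_tuple y - z) *m O).
  apply: measurable_rV_mulmx; apply: measurable_rVD; first exact: measurable_rV_id.
  exact: measurable_rV_cst.
rewrite -(integral_lebesgue_tuple_rigid z (O := M)
  (f := fun y => (heat_kernel h (z - rV_of_tuple y) *
      b (tuple_of_rV ((rV_of_tuple y - z) *m M^T)))%:E)) //.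
- apply: eq_integral => t _; rewrite tuple_of_rVK.
  have -> : z + rV_of_tuple t *m M - z = rV_of_tuple t *m M by rewrite addrC addKr.
  rewrite -mulmxA MM mulmx1 rV_of_tupleK; congr ((_ * _)%:E).
  by rewrite opprD addNKr heat_kernelN /heat_kernel enorm_isometry.
- apply/measurable_EFinP; apply: measurable_funM.
    rewrite (_ : (fun _ => _) = fun y : RTn n.+1 =>
      heat_kernel h ((rV_of_tuple y - z) *m 1%:M)); last first.
      by apply/funext => y; rewrite mulmx1 -heat_kernelN opprB.
    exact: measurable_heat_kernel.
  by apply: measurableT_comp => //; exact: measurable_tuple_of_rV.
- by move=> t; rewrite lee_fin mulr_ge0 ?heat_kernel_ge0.
Qed.

(** The set need not be measurable, so its indicator is only compared with
    measurable functions. *)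
Lemma convolution_le n (nu : 'rV[R]_n.+1) (T : 'M[R]_(n, n.+1)) (h : R) (E : set 'rV[R]_n.+1)
    (z : 'rV[R]_n.+1) (b : RTn n.+1 -> R) :
  0 < h -> orthonormal_frame nu T -> measurable_fun [set: RTn n.+1] b ->
  (forall t, 0 <= b t) ->
  (forall t, E (z + rV_of_tuple t *m frame_mx nu T) -> 1 <= b t) ->
  (convolution (heat_kernel h) \1_E z <= \int[mu n.+1]_t (K h t * b t)%:E)%E.
Proof.
move=> h0 o mb b0 Eb; rewrite (heat_average_frameE z h0 o mb b0).
have MM := mulmx1C (frame_mx_orth o).
apply: ge0_le_integral_nomeas => y; rewrite lee_fin.
  by rewrite mulr_ge0 ?heat_kernel_ge0// indicE ler0n.
apply: ler_wpM2l; first exact: heat_kernel_ge0.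
rewrite indicE; case: (boolP (_ \in E)) => [/set_mem Ey|_]; last exact: b0.
by apply: Eb; rewrite tuple_of_rVK -mulmxA MM mulmx1 addrC subrK.
Qed.

Lemma convolution_ge n (nu : 'rV[R]_n.+1) (T : 'M[R]_(n, n.+1)) (h : R) (E : set 'rV[R]_n.+1)
    (z : 'rV[R]_n.+1) (b : RTn n.+1 -> R) :
  0 < h -> orthonormal_frame nu T -> measurable_fun [set: RTn n.+1] b ->
  (forall t, 0 <= b t <= 1) ->
  (forall t, ~ E (z + rV_of_tuple t *m frame_mx nu T) -> b t = 0) ->
  (\int[mu n.+1]_t (K h t * b t)%:E <= convolution (heat_kernel h) \1_E z)%E.
Proof.
move=> h0 o mb b01 Eb; have b0 t : 0 <= b t by have /andP[] := b01 t.
rewrite (heat_average_frameE z h0 o mb b0).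
have MM := mulmx1C (frame_mx_orth o).
apply: ge0_le_integral_nomeas => y; rewrite lee_fin.
  by rewrite mulr_ge0 ?heat_kernel_ge0.
apply: ler_wpM2l; first exact: heat_kernel_ge0.
rewrite indicE; case: (boolP (_ \in E)) => [_|/negP nEy].
  by have /andP[] := b01 (tuple_of_rV ((rV_of_tuple y - z) *m (frame_mx nu T)^T)).
rewrite Eb// tuple_of_rVK -mulmxA MM mulmx1 addrC subrK => /mem_set.
exact: nEy.
Qed.

Definition heat1_cdf_fun (h a : R) : R := fine (\int[leb]_(x in `]-oo, a[) (heat1 h x)%:E).

Lemma heat1_cdf_funE (h a : R) : 0 < h ->
  (\int[leb]_x (heat1 h x * (x < a)%R%:R)%:E)%E = (heat1_cdf_fun h a)%:E.
Proof.
move=> h0; have [c cE _] := heat1_cdf a h0; rewrite /heat1_cdf_fun cE/= -cE.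
rewrite [RHS]integral_mkcond; apply: eq_integral => x _; rewrite patchE.
case: ifPn => xa; last first.
  by move: xa; rewrite notin_setE/= in_itv/= => /negP/negbTE ->; rewrite mulr0.
by move: xa; rewrite inE/= in_itv/= => ->; rewrite mulr1.
Qed.

Lemma heat1_cdf_fun_approx (h a : R) : 0 < h ->
  `|heat1_cdf_fun h a - (2^-1 + heat1_peak h * a)| <= heat1_peak h * (`|a| ^+ 3 / (4 * h)).
Proof. by move=> h0; have [c cE] := heat1_cdf a h0; rewrite /heat1_cdf_fun cE. Qed.

Lemma heat1_cdf_fun_ge0 (h a : R) : 0 <= heat1_cdf_fun h a.
Proof. by apply: fine_ge0; apply: integral_ge0 => x _; rewrite lee_fin heat1_ge0. Qed.

Lemma heat_kernel_tcons n h s (t : RTn n) : 0 < h ->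
  K h (tcons (s, t)) = heat1 h s * K h t.
Proof.
move=> h0; rewrite !heat_kernel_prod// big_ord_recl !mxE/=; congr (_ * _).
by apply: eq_bigr => i _; rewrite !mxE tnthS.
Qed.

Definition subgraph_ind n (G : RTn n -> R) (t : RTn n.+1) : R :=
  (tnth t ord0 < G [tuple of behead t])%R%:R.

Lemma measurable_bool_nat d (T : measurableType d) (b : T -> bool) :
  measurable_fun [set: T] b -> measurable_fun [set: T] (fun t => (b t)%:R : R).
Proof.
move=> mb; rewrite (_ : (fun _ => _) = fun t => if b t then 1 else 0).
  by apply: measurable_fun_ifT => //; exact: measurable_cst.
by apply/funext => t; case: (b t).
Qed.

Lemma measurable_subgraph_ind n (G : RTn n -> R) :
  measurable_fun [set: RTn n] G -> measurable_fun [set: RTn n.+1] (subgraph_ind G).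
Proof.
move=> mG; apply: measurable_bool_nat; apply: measurable_fun_ltr.
  exact: measurable_tnth.
by apply: measurableT_comp => //; exact: measurable_behead.
Qed.

(** Fubini in the normal direction: a vertical line meets the subgraph in a
    half-line, whose average is heat1_cdf_fun. *)
Lemma has_integral_subgraph n h (G : RTn n -> R) : 0 < h ->
  measurable_fun [set: RTn n] G ->
  exists a, has_integral (mu n.+1) (fun t => K h t * subgraph_ind G t) a /\
            has_integral (mu n) (fun t => K h t * heat1_cdf_fun h (G t)) a.
Proof.
move=> h0 mG.
have mK m : measurable_fun [set: RTn m] (fun t => K h t).
  by apply: measurable_heat_kernel => //; exact: measurable_rV_id.
have mf : measurable_fun [set: RTn n.+1] (fun t => K h t * subgraph_ind G t).
  by apply: measurable_funM; [exact: mK|exact: measurable_subgraph_ind].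
have f0 t : (0 <= (K h t * subgraph_ind G t)%:E)%E.
  by rewrite lee_fin mulr_ge0 ?heat_kernel_ge0.
have [a fa] : exists a, has_integral (mu n.+1) (fun t => K h t * subgraph_ind G t) a.
  apply: (has_integral_dom mf (has_integral_heat_kernel n.+1 h0)) => t.
  rewrite -lee_fin f0/= ler_piMr ?heat_kernel_ge0// /subgraph_ind.
  by case: (_ < _).
exists a; split=> //; case: fa => _ fa.
have mf' : measurable_fun [set: RTn n.+1] (fun t => (K h t * subgraph_ind G t)%:E).
  exact/measurable_EFinP.
have mF : measurable_fun [set: RT * RTn n] (fun p => (K h (tcons p) * subgraph_ind G (tcons p))%:E).
  by apply: (measurableT_comp mf'); exact: measurable_tcons.
have E t : (\int[leb]_x (K h (tcons (x, t)) * subgraph_ind G (tcons (x, t)))%:E =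
    (K h t * heat1_cdf_fun h (G t))%:E)%E.
  under eq_integral => x _.
    rewrite heat_kernel_tcons// (mulrC (heat1 h x)) -mulrA EFinM.
    rewrite (_ : subgraph_ind G (tcons (x, t)) = (x < G t)%R%:R); last first.
      by rewrite /subgraph_ind; congr ((_ < G _)%R%:R); exact: val_inj.
    over.
  rewrite /= ge0_integralZl//=.
  - by rewrite heat1_cdf_funE// EFinM.
  - apply/measurable_EFinP; apply: measurable_funM; first exact: measurable_heat1.
    apply: measurable_bool_nat; apply: measurable_fun_ltr => //; exact: measurable_cst.
  - by move=> x _; rewrite lee_fin mulr_ge0 ?heat1_ge0.
  - by rewrite lee_fin heat_kernel_ge0.
apply: ge0_has_integral.
- apply/measurable_EFinP; rewrite (_ : EFin \o _ = fun t => (\int[leb]_x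
    (K h (tcons (x, t)) * subgraph_ind G (tcons (x, t)))%:E)%E); last first.
    by apply/funext => t /=; rewrite E.
  exact: (measurable_fun_fubini_tonelli_G (fun p => (K h (tcons p) * subgraph_ind G (tcons p))%:E)).
- by move=> t; rewrite mulr_ge0 ?heat_kernel_ge0 ?heat1_cdf_fun_ge0.
- under eq_integral do rewrite -E.
  rewrite -fa integral_lebesgue_tupleS//.
  by rewrite -(fubini_tonelli (fun p => (K h (tcons p) * subgraph_ind G (tcons p))%:E)).
Qed.

Lemma has_integral_even n (f : RTn n -> R) a : has_integral (mu n) f a ->
  (forall t, 0 <= f t) ->
  has_integral (mu n) (fun t => f (tuple_of_rV (- rV_of_tuple t))) a.
Proof.
move=> [fi fa] f0; have mf := measurable_int _ fi; apply: ge0_has_integral => //.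
- have /measurable_EFinP mf' := mf; apply: measurableT_comp => //.
  by apply: measurable_tuple_of_rV; apply: measurable_rVN; exact: measurable_rV_id.
- rewrite -fa -(@integral_lebesgue_tuple_orth R n (-1)%:M (fun t => (f t)%:E)) //=.
  + by apply: eq_integral => t _; rewrite mul_mx_scalar scaleN1r.
  + by rewrite tr_scalar_mx -scalar_mxM mulrNN mulr1.
Qed.

End heat_average.

(** * The heat average of a subgraph *)

Section graph_average.
Variable R : realType.
Local Notation RT := (measurableTypeR R).
Local Notation mu n := (lebesgue_tuple R n).
Local Notation RTn n := (n.-tuple RT).
Local Notation K h t := (heat_kernel h (rV_of_tuple t)).

Lemma powR_le1D (t p : R) : 0 <= t -> 0 <= p <= 1 -> t `^ p <= 1 + t.
Proof.
move=> t0 /andP[p0 p1]; have [t1|/ltW t1] := leP t 1.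
  apply: (@le_trans _ _ (1 `^ p)); first by rewrite ge0_ler_powR ?nnegrE.
  by rewrite powR1 lerDl.
apply: (@le_trans _ _ (t `^ 1)); first exact: ler_powR.
by rewrite powRr1// lerDr.
Qed.

Lemma sqr_le_powR1D (h b : R) : 0 < h -> h <= 1 -> 0 <= b <= 2 ->
  h ^+ 2 <= h `^ (1 + b / 2).
Proof.
move=> h0 h1 /andP[b0 b2]; rewrite -powR_mulrn ?(ltW h0)//.
have [->|hn1] := eqVneq h 1; first by rewrite !powR1.
by rewrite ger_powR ?h0//; lra.
Qed.

(** The errors below have degree at most 6 in 1 + |v|^2 / 8h, hence this power. *)
Lemma pow6_le_expR (y : R) : 0 <= y -> (1 + y) ^+ 6 <= 6 ^+ 6 * expR y.
Proof.
move=> y0.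
have -> : expR y = expR (y / 6) ^+ 6 by rewrite -expRM_natr divfK.
rewrite -exprMn lerXn2r ?nnegrE ?mulr_ge0 ?addr_ge0 ?expR_ge0//.
have := expR_ge1Dx (y / 6); lra.
Qed.

(** The graph bound of the hypersurface over its tangent space at a boundary
    point: above for e = 1, below for e = -1. *)
Definition local_graph n (k : 'rV[R]_n) (c : 'rV[R]_n -> R) (M b e : R)
    (v : 'rV[R]_n) : R :=
  - (2^-1 * \sum_(i < n) k ord0 i * v ord0 i ^+ 2) + c v +
  e * (M * (enorm v ^+ 2 * enorm v `^ b)).

Lemma quad_form_le n (k v : 'rV[R]_n) (M : R) : (forall i, `|k ord0 i| <= M) ->
  `|\sum_(i < n) k ord0 i * v ord0 i ^+ 2| <= M * enorm v ^+ 2.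
Proof.
move=> kM; rewrite sqr_enorm /edot mulr_sumr.
apply: le_trans (ler_norm_sum _ _ _) _; apply: ler_sum => i _.
by rewrite normrM -expr2 (ger0_norm (sqr_ge0 _)) ler_wpM2r ?sqr_ge0.
Qed.

Section bounds.
Variables (n : nat) (k : 'rV[R]_n) (c : 'rV[R]_n -> R) (M b e L : R).
Hypotheses (b02 : 0 <= b <= 2) (M0 : 0 <= M) (L0 : 0 <= L) (e1 : `|e| = 1).
Hypotheses (kM : forall i, `|k ord0 i| <= M)
  (c_odd : forall v, c (- v) = - c v) (c_le : forall v, `|c v| <= M * enorm v ^+ 3).
Variable h : R.
Hypotheses (h0 : 0 < h) (h1 : h <= 1).
Variable (v : 'rV[R]_n).
Let Y := edot v v / (8 * h).

Let Y0 : 0 <= Y. Proof. by rewrite divr_ge0 ?edot_ge0// mulr_ge0// ltW. Qed.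

Let aY : enorm v ^+ 2 = 8 * h * Y.
Proof. by rewrite sqr_enorm mulrC divfK// gt_eqF// mulr_gt0. Qed.

Let a0 : 0 <= enorm v. Proof. exact: enorm_ge0. Qed.

Let ab : enorm v `^ b <= 8 * h `^ (b / 2) * (1 + Y).
Proof.
have Y8 : 0 <= 8 * Y by apply: mulr_ge0.
have -> : enorm v `^ b = h `^ (b / 2) * (8 * Y) `^ (b / 2).
  rewrite -powRM ?(ltW h0) ?Y8// mulrA (mulrC h) -aY.
  by rewrite -powR_mulrn// -powRrM mulrC divfK.
rewrite mulrAC mulrC ler_wpM2r ?powR_ge0//.
have H : 0 <= b / 2 <= 1 by case/andP: b02 => ? ?; apply/andP; split; lra.
by apply: le_trans (powR_le1D _ H) _; move: Y0; lra.
Qed.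

Let hb1 : h `^ (b / 2) <= 1.
Proof.
apply: (@le_trans _ _ (1 `^ (b / 2))); last by rewrite powR1.
rewrite ge0_ler_powR ?nnegrE ?(ltW h0)//.
by case/andP: b02 => ? ?; lra.
Qed.

Let hhb : h * h `^ (b / 2) = h `^ (1 + b / 2).
Proof.
by rewrite powRD ?powRr1 ?(ltW h0)//; apply/implyP => _; rewrite gt_eqF.
Qed.

Let rem_le : M * (enorm v ^+ 2 * enorm v `^ b) <= 64 * M * h `^ (1 + b / 2) * (1 + Y) ^+ 2.
Proof.
apply: (@le_trans _ _ (M * ((8 * h * Y) * (8 * h `^ (b / 2) * (1 + Y))))).
  apply: ler_wpM2l => //; rewrite aY; apply: ler_wpM2l => //.
  by rewrite -aY sqr_ge0.
rewrite -hhb.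
have -> : M * ((8 * h * Y) * (8 * h `^ (b / 2) * (1 + Y))) =
   64 * M * (h * h `^ (b / 2)) * (Y * (1 + Y)) by ring.
apply: ler_wpM2l; first by rewrite !mulr_ge0 ?powR_ge0 ?(ltW h0).
by move: Y0; nra.
Qed.

(** In the variable Y = |v|^2 / 8h all terms are of order h (1 + Y)^2, the scale
    of the heights seen by the heat kernel at time h. *)
Lemma local_graph_size (l : R) : `|l| <= L * h ->
  `|local_graph k c M b e v - l| <= (132 * M + L) * h * (1 + Y) ^+ 2.
Proof.
move=> lL.
have q := quad_form_le v kM; have cl := c_le v.
have c3 : M * enorm v ^+ 3 <= 64 * M * h * (1 + Y) ^+ 2.
  apply: (@le_trans _ _ (M * (enorm v ^+ 2 * (1 + enorm v ^+ 2)))).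
    rewrite ler_wpM2l// exprS mulrC ler_wpM2l ?sqr_ge0//.
    by move: a0 (sqr_ge0 (enorm v - 1)); nra.
  rewrite aY (_ : M * _ = 8 * M * h * (Y * (1 + 8 * h * Y))); last by ring.
  rewrite (_ : 64 * M * h * _ = 8 * M * h * (8 * (1 + Y) ^+ 2)); last by ring.
  rewrite ler_wpM2l ?mulr_ge0 ?(ltW h0)//.
  have : h * (Y * Y) <= Y * Y by rewrite ler_piMl// mulr_ge0.
  by move: Y0; nra.
have r3 : M * (enorm v ^+ 2 * enorm v `^ b) <= 64 * M * h * (1 + Y) ^+ 2.
  apply: (le_trans rem_le); rewrite ler_wpM2r ?sqr_ge0// ler_wpM2l ?mulr_ge0//.
  by rewrite -hhb ler_piMr// ltW.
have q3 : M * enorm v ^+ 2 <= 8 * M * h * (1 + Y) ^+ 2.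
  rewrite aY (_ : M * _ = 8 * M * h * Y); last by ring.
  rewrite ler_wpM2l ?mulr_ge0 ?(ltW h0)//; by move: Y0; nra.
have l3 : L * h <= L * h * (1 + Y) ^+ 2.
  rewrite ler_peMr ?mulr_ge0 ?(ltW h0)//; by move: Y0; nra.
rewrite /local_graph.
set Q := \sum_(i < n) _ in q *; set C3 := c v in cl *.
have r0 : `|e * (M * (enorm v ^+ 2 * enorm v `^ b))| <= 64 * M * h * (1 + Y) ^+ 2.
  by rewrite normrM e1 mul1r ger0_norm// !mulr_ge0 ?powR_ge0 ?sqr_ge0.
move: r0; set rr := e * _ => r0.
have -> : (132 * M + L) * h * (1 + Y) ^+ 2 =
  4 * M * h * (1 + Y) ^+ 2 + 64 * M * h * (1 + Y) ^+ 2 + 64 * M * h * (1 + Y) ^+ 2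
  + L * h * (1 + Y) ^+ 2 by ring.
move: (1 + Y) => Z in q3 c3 r3 l3 r0 *.
apply: le_trans (ler_normB _ _) _; apply: lerD; last exact: le_trans lL l3.
apply: le_trans (ler_normD _ _) _; apply: lerD => //.
apply: le_trans (ler_normD _ _) _; apply: lerD; last exact: le_trans cl c3.
rewrite normrN normrM ger0_norm ?invr_ge0//.
by move: (le_trans q q3); lra.
Qed.

(** Adding the values at v and - v removes the odd part c; the remaining error
    is of order h^(1 + b/2) and not h^(3/2). *)
Lemma local_graph_sym (l : R) :
  `|(local_graph k c M b e v - l) + (local_graph k c M b e (- v) - l) -
    (- (\sum_(i < n) k ord0 i * v ord0 i ^+ 2) - 2 * l)| <=
  128 * M * h `^ (1 + b / 2) * (1 + Y) ^+ 2.
Proof.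
rewrite /local_graph enormN c_odd.
have -> : \sum_(i < n) k ord0 i * (- v) ord0 i ^+ 2 = \sum_(i < n) k ord0 i * v ord0 i ^+ 2.
  by apply: eq_bigr => i _; rewrite mxE sqrrN.
set q := \sum_(i < n) _; set r := M * _.
have -> : - (2^-1 * q) + c v + e * r - l + (- (2^-1 * q) - c v + e * r - l) -
    (- q - 2 * l) = e * (2 * r) by field.
rewrite normrM e1 mul1r ger0_norm; last by rewrite !mulr_ge0 ?powR_ge0 ?sqr_ge0.
by have := rem_le; rewrite -/r; lra.
Qed.

End bounds.

Section average.
Variables (n : nat) (k : 'rV[R]_n) (c : 'rV[R]_n -> R) (M b e L : R).
Hypotheses (b02 : 0 <= b <= 2) (M0 : 0 <= M) (L0 : 0 <= L) (e1 : `|e| = 1).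
Hypotheses (kM : forall i, `|k ord0 i| <= M)
  (c_odd : forall v, c (- v) = - c v) (c_le : forall v, `|c v| <= M * enorm v ^+ 3).
Variable h : R.
Hypotheses (h0 : 0 < h) (h1 : h <= 1).
Let A := 132 * M + L.
Let B := (128 * M + A ^+ 3) * 6 ^+ 6.

Let A0 : 0 <= A. Proof. by rewrite addr_ge0// mulr_ge0. Qed.

Let B0 : 0 <= B. Proof. by rewrite mulr_ge0// addr_ge0 ?exprn_ge0 ?mulr_ge0. Qed.

(** Linearize the half-line average at both heights.  The cubic error of the
    linearization is (4 pi h)^(-1/2) h^2 times a power of 1 + Y, at most
    the graph error because b <= 2 and h <= 1. *)
Lemma heat1_cdf_sym (l : R) (v : 'rV[R]_n) : `|l| <= L * h ->
  `|heat1_cdf_fun h (local_graph k c M b e v - l) +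
    heat1_cdf_fun h (local_graph k c M b e (- v) - l) -
    (1 + heat1_peak h * (- (\sum_(i < n) k ord0 i * v ord0 i ^+ 2) - 2 * l))| <=
  heat1_peak h * (B * h `^ (1 + b / 2)) * expR (edot v v / (8 * h)).
Proof.
move=> lL.
have G1 := local_graph_size b02 M0 L0 e1 kM c_le h0 h1 v lL.
have G2 := local_graph_size b02 M0 L0 e1 kM c_le h0 h1 (- v) lL.
have G3 := local_graph_sym k b02 M0 e1 c_odd h0 v l.
rewrite edotNl edotNr opprK in G2.
have Y0 : 0 <= edot v v / (8 * h) by rewrite divr_ge0 ?edot_ge0// mulr_ge0// ltW.
have y6 := pow6_le_expR Y0.
move: (edot v v / (8 * h)) => Y in G1 G2 G3 Y0 y6 *.
move: G1 G2 G3; set u1 := local_graph _ _ _ _ _ v - l.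
set u2 := local_graph _ _ _ _ _ (- v) - l; set q := \sum_(i < n) _ => G1 G2 G3.
have k0 := heat1_peak_gt0 h0.
have C1 := heat1_cdf_fun_approx u1 h0; have C2 := heat1_cdf_fun_approx u2 h0.
have hb := sqr_le_powR1D h0 h1 b02.
have cube (u : R) : `|u| <= A * h * (1 + Y) ^+ 2 ->
    heat1_peak h * (`|u| ^+ 3 / (4 * h)) <= heat1_peak h * (A ^+ 3 / 4 * h `^ (1 + b / 2) * (1 + Y) ^+ 6).
  move=> uA; rewrite ler_wpM2l ?(ltW k0)// ler_pdivrMr ?mulr_gt0//.
  apply: (@le_trans _ _ ((A * h * (1 + Y) ^+ 2) ^+ 3)).
    rewrite lerXn2r ?nnegrE//; apply: mulr_ge0; last exact: sqr_ge0.
    by apply: mulr_ge0 => //; exact: ltW.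
  rewrite (_ : _ ^+ 3 = A ^+ 3 * h * (1 + Y) ^+ 6 * h ^+ 2); last by ring.
  rewrite (_ : _ * (4 * h) = A ^+ 3 * h * (1 + Y) ^+ 6 * h `^ (1 + b / 2)); last by field.
  apply: ler_wpM2l => //; apply: mulr_ge0; last by rewrite exprn_ge0 ?addr_ge0.
  by apply: mulr_ge0; [rewrite exprn_ge0|exact: ltW].
have D1 := le_trans C1 (cube _ G1); have D2 := le_trans C2 (cube _ G2).
have D3 : heat1_peak h * `|u1 + u2 - (- q - 2 * l)| <=
    heat1_peak h * (128 * M * h `^ (1 + b / 2) * (1 + Y) ^+ 6).
  rewrite ler_wpM2l ?(ltW k0)//; apply: le_trans G3 _.
  by rewrite ler_wpM2l ?mulr_ge0 ?powR_ge0// ler_weXn2l// lerDl.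
set p1 := heat1_cdf_fun h u1 in D1 *; set p2 := heat1_cdf_fun h u2 in D2 *.
have -> : p1 + p2 - (1 + heat1_peak h * (- q - 2 * l)) =
  (p1 - (2^-1 + heat1_peak h * u1)) + (p2 - (2^-1 + heat1_peak h * u2)) +
  heat1_peak h * (u1 + u2 - (- q - 2 * l)) by field.
apply: le_trans (ler_normD _ _) _.
rewrite normrM (gtr0_norm k0).
apply: le_trans (lerD (le_trans (ler_normD _ _) (lerD D1 D2)) D3) _.
rewrite [leLHS](_ : _ = heat1_peak h *
  ((128 * M + A ^+ 3 / 2) * h `^ (1 + b / 2) * (1 + Y) ^+ 6)); last by field.
rewrite [leRHS](_ : _ = heat1_peak h *
  ((128 * M + A ^+ 3) * h `^ (1 + b / 2) * (6 ^+ 6 * expR Y))); last first.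
  by rewrite /B; ring.
apply: ler_wpM2l; first exact: ltW.
apply: ler_pM => //.
- by rewrite mulr_ge0 ?powR_ge0// addr_ge0 ?mulr_ge0 ?divr_ge0 ?exprn_ge0.
- by rewrite exprn_ge0// addr_ge0.
- rewrite ler_wpM2r ?powR_ge0// lerD2l ler_pdivrMr// ler_peMr ?exprn_ge0//.
  by rewrite ler1n.
Qed.

Hypothesis mc : measurable_fun [set: RTn n] (fun t => c (rV_of_tuple t)).

Lemma measurable_local_graph :
  measurable_fun [set: RTn n] (fun t => local_graph k c M b e (rV_of_tuple t)).
Proof.
have mi i : measurable_fun [set: RTn n] (fun t => rV_of_tuple t ord0 i).
  exact: measurable_rV_id.
have me : measurable_fun [set: RTn n] (fun t => edot (rV_of_tuple t) (rV_of_tuple t)).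
  by apply: measurable_edot; exact: measurable_rV_id.
have mn : measurable_fun [set: RTn n] (fun t => enorm (rV_of_tuple t)).
  by apply: (measurableT_comp (continuous_measurable_fun (@sqrt_continuous R)) me).
apply: measurable_funD; first apply: measurable_funD => //.
- apply: (measurable_funN (f := fun t => 2^-1 * \sum_(i < n) k ord0 i * rV_of_tuple t ord0 i ^+ 2)).
  apply: measurable_funM; first exact: measurable_cst.
  apply: measurable_sum => i; apply: measurable_funM; first exact: measurable_cst.
  exact: measurable_funX.
- apply: measurable_funM; first exact: measurable_cst.
  apply: measurable_funM; first exact: measurable_cst.
  apply: measurable_funM; first exact: measurable_funX.
  by apply: (measurableT_comp (measurable_powR b)).
Qed.

(** Symmetrize in v, then integrate heat1_cdf_sym against the kernel: the second
    moments 2h turn the quadratic part into the mean curvature. *)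
Lemma local_graph_average (l : R) : `|l| <= L * h ->
  exists2 a, has_integral (mu n.+1) (fun t => K h t *
      subgraph_ind (fun t => local_graph k c M b e (rV_of_tuple t) - l) t) a &
    `|a - (2^-1 + heat1_peak h * (- l - h * \sum_(i < n) k ord0 i))| <=
    heat1_peak h * (B * Num.sqrt 2 ^+ n * h `^ (1 + b / 2)).
Proof.
move=> lL; have k0 := heat1_peak_gt0 h0.
have mG : measurable_fun [set: RTn n] (fun t => local_graph k c M b e (rV_of_tuple t) - l).
  by apply: measurable_funB; [exact: measurable_local_graph|exact: measurable_cst].
have [a [a1 a2]] := has_integral_subgraph h0 mG.
exists a => //.
have a3 := has_integral_even a2 (fun t => mulr_ge0 (heat_kernel_ge0 _ _) (heat1_cdf_fun_ge0 _ _)).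
have a4 := has_integralD a2 a3.
set w := heat1_peak h * (B * h `^ (1 + b / 2)).
have ref (s : R) : has_integral (mu n) (fun t =>
    (1 - heat1_peak h * (2 * l)) * K h t +
    (- heat1_peak h * \sum_(i < n) k ord0 i * (K h t * tnth t i ^+ 2) +
     s * w * (K h t * expR (edot (rV_of_tuple t) (rV_of_tuple t) / (8 * h)))))
    ((1 - heat1_peak h * (2 * l)) * 1 +
     (- heat1_peak h * \sum_(i < n) k ord0 i * (2 * h) + s * w * Num.sqrt 2 ^+ n)).
  apply: has_integralD; first by apply: has_integralZ; exact: has_integral_heat_kernel.
  apply: has_integralD; last by apply: has_integralZ; exact: has_integral_heat_kernel_exp.
  apply: has_integralZ; apply: has_integral_sum => i; apply: has_integralZ.
  exact: has_integral_heat_kernel_sqr.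
have pt t : `|K h t * heat1_cdf_fun h (local_graph k c M b e (rV_of_tuple t) - l) +
     K h (tuple_of_rV (- rV_of_tuple t)) * heat1_cdf_fun h (local_graph k c M b e
        (rV_of_tuple (tuple_of_rV (- rV_of_tuple t))) - l) -
     ((1 - heat1_peak h * (2 * l)) * K h t +
       - heat1_peak h * \sum_(i < n) k ord0 i * (K h t * tnth t i ^+ 2))| <=
     w * (K h t * expR (edot (rV_of_tuple t) (rV_of_tuple t) / (8 * h))).
  rewrite tuple_of_rVK heat_kernelN.
  rewrite (_ : \sum_(i < n) _ = K h t * \sum_(i < n) k ord0 i * rV_of_tuple t ord0 i ^+ 2); last first.
    by rewrite mulr_sumr; apply: eq_bigr => i _; rewrite mxE; ring.
  have := heat1_cdf_sym (rV_of_tuple t) lL; rewrite -/w.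
  set p1 := heat1_cdf_fun _ _; set p2 := heat1_cdf_fun _ _; set q := \sum_(i < n) _ => H.
  rewrite (_ : _ - _ = K h t * (p1 + p2 - (1 + heat1_peak h * (- q - 2 * l)))); last by ring.
  by rewrite normrM (ger0_norm (heat_kernel_ge0 _ _)) mulrCA ler_wpM2l ?heat_kernel_ge0.
have U := has_integral_le a4 (ref 1) _.
have D := has_integral_le (ref (-1)) a4 _.
have {}U := U (fun t => _); have {}D := D (fun t => _).
have P0 : 0 <= heat1_peak h * (B * Num.sqrt 2 ^+ n * h `^ (1 + b / 2)).
  apply: mulr_ge0; first exact: ltW.
  by apply: mulr_ge0; [apply: mulr_ge0 => //; exact: exprn_ge0|exact: powR_ge0].
rewrite ler_distl; apply/andP; split.
- have : (1 - heat1_peak h * (2 * l)) * 1 +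
     (- heat1_peak h * \sum_(i < n) k ord0 i * (2 * h) + -1 * w * Num.sqrt 2 ^+ n) <= a + a.
    apply: D => t; have := pt t; rewrite ler_distl => /andP[+ _].
    by apply: le_trans; apply: le_of_eq; ring.
  rewrite -mulr_suml /w; set S := \sum_(i < n) _; set r := Num.sqrt 2 ^+ n in P0 *.
  by move: P0; lra.
- have : a + a <= (1 - heat1_peak h * (2 * l)) * 1 +
     (- heat1_peak h * \sum_(i < n) k ord0 i * (2 * h) + 1 * w * Num.sqrt 2 ^+ n).
    apply: U => t; have := pt t; rewrite ler_distl => /andP[_ +].
    by move=> /le_trans; apply; apply: le_of_eq; ring.
  rewrite -mulr_suml /w; set S := \sum_(i < n) _; set r := Num.sqrt 2 ^+ n in P0 *.
  by move: P0; lra.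
Qed.

End average.

End graph_average.

(** * The heat average of a set squeezed between two graphs *)

Section heat_average_expansion.
Variable R : realType.
Local Notation RT := (measurableTypeR R).
Local Notation mu n := (lebesgue_tuple R n).
Local Notation RTn n := (n.-tuple RT).
Local Notation K h t := (heat_kernel h (rV_of_tuple t)).

(** The sign e of local_graph selects the lower graph (-1) or the upper one
    (1); nothing is said about points between them. *)
Definition graph_sandwich n (E : set 'rV[R]_n.+1) (x nu : 'rV[R]_n.+1)
    (T : 'M[R]_(n, n.+1)) (k : 'rV[R]_n) (c : 'rV[R]_n -> R) (M b r : R) :=
  forall (v : 'rV[R]_n) (s : R), enorm v < r -> `|s| < r ->
    (s < local_graph k c M b (-1) v -> E (x + (s *: nu + v *m T))) /\
    (local_graph k c M b 1 v < s -> ~ E (x + (s *: nu + v *m T))).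

(** Turns a tail of order h^2 into the error shape of local_graph_average, a
    multiple of the peak value. *)
Lemma sqr_le_heat1_peak (h b : R) : 0 < h -> h <= 1 -> 0 <= b <= 2 ->
  h ^+ 2 <= heat1_peak h * (4 * h `^ (1 + b / 2)).
Proof.
move=> h0 h1 b02; apply: (le_trans (sqr_le_powR1D h0 h1 b02)).
rewrite mulrA ler_peMl ?powR_ge0// /heat1_peak mulrC ler_pdivlMr ?mul1r.
  rewrite -(ler_pXn2r (n := 2)) ?nnegrE// ?sqrtr_ge0//.
  rewrite sqr_sqrtr ?mulr_ge0 ?pi_ge0 ?(ltW h0)//.
  have p4 : pi <= 4 :> R by have := pihalf_lt2 R; lra.
  have := @pi_ge0 R; nra.
by rewrite sqrtr_gt0 !mulr_gt0// pi_gt0.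
Qed.

(** The function (|t| / rho)^4 is at least 1 outside the ball of radius rho, so
    its average bounds the mass where the sandwich says nothing. *)
Lemma has_integral_tail n (h rho : R) : 0 < h -> 0 < rho ->
  exists2 a, has_integral (mu n) (fun t => K h t *
      (edot (rV_of_tuple t) (rV_of_tuple t) / rho ^+ 2) ^+ 2) a &
    a <= 64 * 6 ^+ 6 / rho ^+ 4 * Num.sqrt 2 ^+ n * h ^+ 2.
Proof.
move=> h0 r0.
have mf : measurable_fun [set: RTn n] (fun t => K h t *
      (edot (rV_of_tuple t) (rV_of_tuple t) / rho ^+ 2) ^+ 2).
  apply: measurable_funM.
    by apply: measurable_heat_kernel => //; exact: measurable_rV_id.
  apply: measurable_funX; apply: measurable_funM; last exact: measurable_cst.
  by apply: measurable_edot; exact: measurable_rV_id.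
have H := has_integralZ (64 * 6 ^+ 6 / rho ^+ 4 * h ^+ 2) (has_integral_heat_kernel_exp n h0).
have le (t : RTn n) : 0 <= K h t * (edot (rV_of_tuple t) (rV_of_tuple t) / rho ^+ 2) ^+ 2 <=
   64 * 6 ^+ 6 / rho ^+ 4 * h ^+ 2 * (K h t *
       expR (edot (rV_of_tuple t) (rV_of_tuple t) / (8 * h))).
  rewrite mulr_ge0 ?sqr_ge0 ?heat_kernel_ge0//= [leRHS]mulrCA.
  apply: ler_wpM2l; first exact: heat_kernel_ge0.
  set w := edot _ _; set Y := w / (8 * h).
  have Y0 : 0 <= Y by rewrite divr_ge0 ?edot_ge0// mulr_ge0// ltW.
  have -> : w = Y * (8 * h) by rewrite divfK// gt_eqF// mulr_gt0.
  rewrite (_ : _ ^+ 2 = 64 / rho ^+ 4 * h ^+ 2 * Y ^+ 2); last first.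
    by field; rewrite gt_eqF.
  rewrite (_ : _ * expR Y = 64 / rho ^+ 4 * h ^+ 2 * (6 ^+ 6 * expR Y)); last by ring.
  apply: ler_wpM2l.
    by rewrite mulr_ge0 ?sqr_ge0// divr_ge0// exprn_ge0// ltW.
  apply: le_trans (pow6_le_expR Y0).
  apply: (@le_trans _ _ ((1 + Y) ^+ 2)); first by rewrite lerXn2r ?nnegrE ?addr_ge0 ?lerDr.
  by rewrite ler_weXn2l// lerDl.
have [a Ha] := has_integral_dom mf H le; exists a => //.
have := has_integral_le Ha H (fun t => proj2 (andP (le t))).
by move=> /le_trans; apply; apply: le_of_eq; ring.
Qed.

(** Inside a ball the set contains one subgraph and is contained in another;
    outside it the kernel has mass O(h^2).  The upper bound uses the subgraph
    shifted by h^2, which changes the average within the error and makes the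
    strict inequality in subgraph_ind cover the points on the graph. *)
Lemma heat_average_sandwich n (M b L r : R) :
  0 <= b <= 2 -> 0 <= M -> 0 <= L -> 0 < r ->
  exists C h0 : R, [/\ 0 <= C, 0 < h0, h0 <= 1 &
    forall (E : set 'rV[R]_n.+1) (x nu : 'rV[R]_n.+1) (T : 'M[R]_(n, n.+1))
        (k : 'rV[R]_n) (c : 'rV[R]_n -> R),
      orthonormal_frame nu T -> (forall i, `|k ord0 i| <= M) ->
      (forall v, c (- v) = - c v) -> (forall v, `|c v| <= M * enorm v ^+ 3) ->
      measurable_fun [set: RTn n] (fun t => c (rV_of_tuple t)) ->
      graph_sandwich E x nu T k c M b r ->
      forall h l : R, 0 < h -> h < h0 -> `|l| <= L * h ->
      let S := \sum_(i < n) k ord0 i in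
      ((2^-1 + heat1_peak h * (- l - h * S - C * h `^ (1 + b / 2)))%:E <=
         convolution (heat_kernel h) \1_E (x + l *: nu) /\
       convolution (heat_kernel h) \1_E (x + l *: nu) <=
         (2^-1 + heat1_peak h * (- l - h * S + C * h `^ (1 + b / 2)))%:E)%E].
Proof.
move=> b02 M0 L0 r0.
pose rho := r / 2; have rho0 : 0 < rho by rewrite divr_gt0.
pose B := (128 * M + (132 * M + (L + 1)) ^+ 3) * 6 ^+ 6 * Num.sqrt 2 ^+ n.
pose D := 64 * 6 ^+ 6 / rho ^+ 4 * Num.sqrt 2 ^+ n.+1.
have L10 : 0 <= L + 1 by rewrite addr_ge0.
have B0 : 0 <= B.
  by rewrite mulr_ge0 ?exprn_ge0// mulr_ge0 ?exprn_ge0// addr_ge0 ?exprn_ge0 ?addr_ge0 ?mulr_ge0.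
have D0 : 0 <= D.
  by rewrite mulr_ge0 ?exprn_ge0// mulr_ge0// invr_ge0 exprn_ge0 ?(ltW rho0).
exists (B + 1 + 4 * D), (Num.min 1 (rho / (L + 1))).
split; [by rewrite !addr_ge0// mulr_ge0| |by rewrite ge_min lexx|].
  by rewrite lt_min ltr01 divr_gt0// ltr_wpDl.
move=> E x nu T k c fr kM codd cle mc sand h l h0.
rewrite lt_min => /andP[/ltW h1 hr] lL S.
have k0 := heat1_peak_gt0 h0.
have hb := sqr_le_powR1D h0 h1 b02; have hk := sqr_le_heat1_peak h0 h1 b02.
have lr : `|l| < rho.
  apply: (le_lt_trans lL); apply: (@le_lt_trans _ _ ((L + 1) * h)).
    by rewrite ler_wpM2r ?(ltW h0)// lerDl.
  by move: hr; rewrite ltr_pdivlMr ?ltr_wpDl// mulrC.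
have [tau Htau tauD] := has_integral_tail n.+1 h0 rho0.
rewrite -/D in tauD.
have tauk : tau <= heat1_peak h * (4 * D * h `^ (1 + b / 2)).
  apply: (le_trans tauD); rewrite (_ : heat1_peak h * _ = D * (heat1_peak h * (4 * h `^ (1 + b / 2)))); last by ring.
  exact: ler_wpM2l.
have me : measurable_fun [set: RTn n.+1] (fun t => edot (rV_of_tuple t) (rV_of_tuple t)).
  by apply: measurable_edot; exact: measurable_rV_id.
pose ball (t : RTn n.+1) := edot (rV_of_tuple t) (rV_of_tuple t) < rho ^+ 2.
(* inside the ball the sandwich applies at height s + l *)
have inball s (t : RTn n) : ball (tcons (s, t)) ->
    enorm (rV_of_tuple t) < r /\ `|s + l| < r.
  rewrite /ball edot_tcons -sqr_enorm => H.
  have tr : enorm (rV_of_tuple t) < rho.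
    rewrite -(ltr_pXn2r (n := 2)) ?nnegrE ?enorm_ge0 ?(ltW rho0)//.
    by apply: le_lt_trans H; rewrite lerDr sqr_ge0.
  have sr : `|s| < rho.
    rewrite -(ltr_pXn2r (n := 2)) ?nnegrE ?(ltW rho0)// real_normK ?num_real//.
    by apply: le_lt_trans H; rewrite lerDl sqr_ge0.
  have rE : r = rho + rho by rewrite /rho; field.
  split; first by rewrite rE; move: tr rho0; lra.
  by rewrite rE; apply: le_lt_trans (ler_normD _ _) _; exact: ltrD.
have pos s (t : RTn n) : x + l *: nu + rV_of_tuple (tcons (s, t)) *m frame_mx nu T =
    x + ((s + l) *: nu + rV_of_tuple t *m T).
  by rewrite rV_of_tcons_frame scalerDl -!addrA; congr (_ + _); rewrite addrCA addrA.
have tconsE (t : RTn n.+1) : t = tcons (tnth t ord0, [tuple of behead t]).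
  exact/esym/(tunconsK t).
have ind_tcons G s (t : RTn n) : subgraph_ind G (tcons (s, t)) = (s < G t)%R%:R :> R.
  by rewrite /subgraph_ind; congr ((_ < G _)%R%:R); exact: val_inj.
have i01 (G : RTn n -> R) t : 0 <= subgraph_ind G t <= 1.
  by rewrite /subgraph_ind; case: ltP; rewrite ?lexx ?ler01.
split.
- have e1 : `|-1 : R| = 1 by rewrite normrN1.
  have lL' : `|l| <= (L + 1) * h.
    by apply: (le_trans lL); rewrite ler_wpM2r ?(ltW h0)// lerDl.
  have [a Ha Ba] := local_graph_average b02 M0 L10 e1 kM codd cle h0 h1 mc lL'.
  set G := (fun t => _ - l) in Ha.
  have mG : measurable_fun [set: RTn n] G.
    apply: measurable_funB; last exact: measurable_cst.
    exact: measurable_local_graph.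
  pose bt (t : RTn n.+1) : R := subgraph_ind G t * (ball t)%:R.
  have mb : measurable_fun [set: RTn n.+1] bt.
    apply: measurable_funM; first exact: measurable_subgraph_ind.
    by apply: measurable_bool_nat; apply: measurable_fun_ltr => //; exact: measurable_cst.
  have bt01 t : 0 <= bt t <= 1.
    have := i01 G t; rewrite /bt; case: (ball t); first by rewrite mulr1.
    by rewrite mulr0 lexx ler01.
  have btE t : ~ E (x + l *: nu + rV_of_tuple t *m frame_mx nu T) -> bt t = 0.
    rewrite (tconsE t); set s := tnth t ord0; set v := [tuple of behead t].
    rewrite pos /bt ind_tcons => nE.
    have [/inball[vr sr]|_] := boolP (ball _); last by rewrite mulr0.
    have [sG _] := sand _ _ vr sr.
    case: ltP => [sv|]; last by rewrite mul0r.
    by exfalso; apply: nE; apply: sG; rewrite -ltrBrDr.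
  apply: le_trans (convolution_ge h0 fr mb bt01 btE).
  have mKb : measurable_fun [set: RTn n.+1] (fun t => K h t * bt t).
    apply: measurable_funM => //.
    by apply: measurable_heat_kernel => //; exact: measurable_rV_id.
  have [be Hbe] : exists be, has_integral (mu n.+1) (fun t => K h t * bt t) be.
    apply: (has_integral_dom mKb (has_integral_heat_kernel n.+1 h0)) => t.
    have /andP[b0 b1] := bt01 t.
    by rewrite mulr_ge0 ?heat_kernel_ge0//= ler_piMr// heat_kernel_ge0.
  have [_ ->] := Hbe; rewrite lee_fin.
  have : a <= be + tau.
    apply: (has_integral_le Ha (has_integralD Hbe Htau)) => t.
    rewrite -mulrDr; apply: ler_wpM2l; first exact: heat_kernel_ge0.
    rewrite /bt; have [_|] := boolP (ball t); first by rewrite mulr1 lerDl sqr_ge0.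
    rewrite /ball -leNgt mulr0 add0r => H.
    apply: (@le_trans _ _ 1); first by have /andP[] := i01 G t.
    by rewrite expr_ge1// ?divr_ge0 ?edot_ge0 ?sqr_ge0// ler_pdivlMr ?mul1r// exprn_gt0.
  move: Ba tauk; rewrite ler_distl -/B => /andP[+ _].
  move: k0 (powR_ge0 h (1 + b / 2)) B0 D0; set p := h `^ _; set kk := heat1_peak h.
  move=> k0 p0 B0' D0' Q1 Q2 Q3.
  have Q4 : 0 <= kk * p by rewrite mulr_ge0// ltW.
  rewrite -/S in Q1; lra.
- have e1 : `|1 : R| = 1 by rewrite normr1.
  have lL' : `|l - h ^+ 2| <= (L + 1) * h.
    apply: (le_trans (ler_normB _ _)); rewrite mulrDl mul1r lerD//.
    by rewrite ger0_norm ?sqr_ge0// expr2 ler_piMr// ltW.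
  have [a Ha Ba] := local_graph_average b02 M0 L10 e1 kM codd cle h0 h1 mc lL'.
  set G := (fun t => _ - (l - _)) in Ha.
  have mG : measurable_fun [set: RTn n] G.
    apply: measurable_funB; last exact: measurable_cst.
    exact: measurable_local_graph.
  pose bt (t : RTn n.+1) : R := subgraph_ind G t +
    (edot (rV_of_tuple t) (rV_of_tuple t) / rho ^+ 2) ^+ 2.
  have i0 t : 0 <= subgraph_ind G t by have /andP[] := i01 G t.
  have mb : measurable_fun [set: RTn n.+1] bt.
    apply: measurable_funD; first exact: measurable_subgraph_ind.
    apply: measurable_funX; apply: measurable_funM => //; exact: measurable_cst.
  have bt0 t : 0 <= bt t by rewrite addr_ge0 ?sqr_ge0.
  have btE t : E (x + l *: nu + rV_of_tuple t *m frame_mx nu T) -> 1 <= bt t.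
    rewrite (tconsE t); set s := tnth t ord0; set v := [tuple of behead t].
    rewrite pos => Es.
    have [/[dup] bv /inball[vr sr]|] := boolP (ball (tcons (s, v))); last first.
      rewrite /ball -leNgt => H; apply: (@le_trans _ _ (0 + 1)); first by rewrite add0r.
      apply: lerD => //.
      by rewrite expr_ge1// ?divr_ge0 ?edot_ge0 ?sqr_ge0// ler_pdivlMr ?mul1r// exprn_gt0.
    have [_ sG] := sand _ _ vr sr.
    apply: (@le_trans _ _ (1 + 0)); first by rewrite addr0.
    apply: lerD; last exact: sqr_ge0.
    rewrite ind_tcons; case: ltP => // Gs; exfalso; apply: sG Es.
    apply: lt_le_trans (_ : G v + l <= _); last by rewrite lerD2r.
    by rewrite /G opprB addrA -addrA addrAC; have := exprn_gt0 2 h0; lra.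
  apply: (le_trans (convolution_le h0 fr mb bt0 btE)).
  have [_] := has_integralD Ha Htau.
  rewrite (_ : (fun _ => _) = (fun t => (K h t * bt t)%:E)); last first.
    by apply/funext => t; rewrite /bt mulrDr.
  move=> ->; rewrite lee_fin.
  move: Ba tauk; rewrite ler_distl -/B => /andP[_ +].
  have Q5 := ler_wpM2l (ltW k0) hb.
  move: k0 (powR_ge0 h (1 + b / 2)) B0 D0 Q5; set p := h `^ _; set kk := heat1_peak h.
  move=> k0 p0 B0' D0' Q5 Q1 Q2.
  rewrite -/S in Q1; lra.
Qed.

End heat_average_expansion.

(** * From the heat average to the normal displacement *)

Section displacement.
Variable R : realType.
Local Notation RT := (measurableTypeR R).
Local Notation RTn n := (n.-tuple RT).

Lemma lee_dist_fin (a : \bar R) (m w : R) :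
  ((m - w)%:E <= a)%E -> (a <= (m + w)%:E)%E -> (`|a - m%:E| <= w%:E)%E.
Proof.
case: a => [a||]; last 2 first.
- by move=> _; rewrite leye_eq.
- by rewrite leeNy_eq.
by rewrite !lee_fin => ? ?; rewrite ler_distl; apply/andP.
Qed.

(** Both cases of the definition see the same crossing from above 1/2 to at most
    1/2 inside [m - w, m + w].  The slack w < w' makes m - w' and m + w' members
    of the sets whose supremum and infimum are taken. *)
Lemma normal_displacement_bound n (E : set 'rV[R]_n) (h m w w' L : R) x :
  0 <= w -> w < w' -> `|m| + w' <= L ->
  (forall l, `|l| <= L -> l < m - w -> heat_step E h (x + l *: outer_normal E x)) ->
  (forall l, `|l| <= L -> m + w <= l -> ~ heat_step E h (x + l *: outer_normal E x)) ->
  (`|normal_displacement E h x - m%:E| <= w'%:E)%E.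
Proof.
move=> w0 ww' mL I1 I2.
have mN := ler_norm (- m); have mP := ler_norm m; rewrite normrN in mN.
have x0 : x + 0 *: outer_normal E x = x by rewrite scale0r addr0.
have L0 : `|0 : R| <= L by rewrite normr0; have := normr_ge0 m; lra.
rewrite /normal_displacement; case: ifPn => [/set_mem xE|xE].
- have mw : 0 < m + w.
    by rewrite ltNge; apply/negP => mw; apply: (I2 0 L0 mw); rewrite x0.
  apply: lee_dist_fin.
  + apply: le_ereal_inf_tmp => _ [l [l0 lE] <-]; rewrite lee_fin leNgt; apply/negP => lm.
    by apply: lE; apply: I1; rewrite ?ger0_norm//; lra.
  + apply: ereal_inf_lbound; exists (m + w') => //; split; first lra.
    by apply: I2; [rewrite ger0_norm; lra|lra].
- have {}xE : ~ heat_step E h x by move=> /mem_set; exact/negP.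
  have mw : m - w <= 0.
    by rewrite leNgt; apply/negP => mw; apply: xE; rewrite -x0; exact: I1.
  apply: lee_dist_fin.
  + apply: ereal_sup_ubound; exists (m - w') => //; split; first lra.
    by apply: I1; [rewrite ler0_norm; lra|lra].
  + apply: ge_ereal_sup => _ [l [l0 lE] <-]; rewrite lee_fin leNgt; apply/negP => lm.
    by apply: I2 lE; [rewrite ler0_norm; lra|lra].
Qed.

(** One M and one r serve all boundary points near p. *)
Definition local_graph_data n (E : set 'rV[R]_n.+1) (b : R) (p : 'rV[R]_n.+1)
    (rho M r : R) :=
  forall x, boundary E x -> enorm (x - p) < rho ->
    exists (T : 'M[R]_(n, n.+1)) (c : 'rV[R]_n -> R),
      [/\ orthonormal_frame (outer_normal E x) T,
          (forall i, `|principal_curvatures E x ord0 i| <= M),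
          (forall v, c (- v) = - c v) /\ (forall v, `|c v| <= M * enorm v ^+ 3),
          measurable_fun [set: RTn n] (fun t => c (rV_of_tuple t)) &
          graph_sandwich E x (outer_normal E x) T (principal_curvatures E x) c M b r].

(** The average at x + l nu is 1/2 + (4 pi h)^(-1/2) (- l - h H) up to an error,
    so its position relative to 1/2 is known once |l + h H| exceeds the error. *)
Lemma displacement_local n (E : set 'rV[R]_n.+1) (b : R) (p : 'rV[R]_n.+1) (rho M r : R) :
  0 < b <= 2 -> 0 <= M -> 0 < r -> local_graph_data E b p rho M r ->
  exists2 C, 0 < C & forall h x, 0 < h -> h < C^-1 -> boundary E x -> enorm (x - p) < rho ->
    (`|normal_displacement E h x - (- (h * mean_curvature E x))%:E|
          <= (C * h `^ (1 + b / 2))%:E)%E.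
Proof.
move=> b02 M0 r0 data.
have /andP[b0 b2] := b02; have b02' : 0 <= b <= 2 by rewrite ltW.
pose L := n%:R * M + 1.
have L0 : 0 <= L by rewrite addr_ge0// mulr_ge0.
have [C1 [h1 [C10 h10 h11 avg]]] := heat_average_sandwich n b02' M0 L0 r0.
have C10' : 0 < C1 + 1 by rewrite ltr_wpDl.
(* below h2 the error term is at most h, so that the range |l| <= L h suffices *)
pose h2 := (C1 + 1) `^ (- (2 / b)).
have h20 : 0 < h2 by rewrite powR_gt0.
have i1 : 0 < h1^-1 by rewrite invr_gt0.
have i2 : 0 < h2^-1 by rewrite invr_gt0.
exists (C1 + 1 + h1^-1 + h2^-1); first by move: C10' i1 i2; lra.
move=> h x h0 hC Bx xp; have [T [c [fr kM [codd cle] mc sand]]] := data x Bx xp.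
have inv_lt a : 0 < a -> a^-1 <= C1 + 1 + h1^-1 + h2^-1 -> h < a.
  move=> a0 aC; apply: (lt_le_trans hC); rewrite -[leRHS]invrK lef_pV2 ?posrE ?invr_gt0//.
  by move: C10' i1 i2; lra.
have hh1 : h < h1.
  by apply: inv_lt => //; move: C10' i2; lra.
have hh2 : h < h2.
  by apply: inv_lt => //; move: C10' i1; lra.
have {}avg := avg _ _ _ _ _ _ fr kM codd cle mc sand h.
set S := \sum_(i < n) _ in avg.
have SM : `|S| <= n%:R * M.
  apply: le_trans (ler_norm_sum _ _ _) _.
  rewrite (_ : n%:R * M = \sum_(i < n) M); last by rewrite sumr_const card_ord mulr_natl.
  by apply: ler_sum => i _.
have hb : (C1 + 1) * h `^ (b / 2) <= 1.
  have : h `^ (b / 2) <= h2 `^ (b / 2).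
    by rewrite ge0_ler_powR ?nnegrE ?(ltW h0) ?(ltW h20) ?(ltW hh2)// divr_ge0// ltW.
  have -> : h2 `^ (b / 2) = (C1 + 1)^-1.
    rewrite /h2 -powRrM (_ : - (2 / b) * (b / 2) = -1); last by field; rewrite gt_eqF.
    by rewrite powR_inv1// ltW.
  by rewrite -(ler_pM2l C10') mulfV ?gt_eqF.
have pE : h `^ (1 + b / 2) = h * h `^ (b / 2).
  by rewrite powRD ?powRr1 ?(ltW h0)//; apply/implyP => _; rewrite gt_eqF.
have p0 : 0 < h `^ (1 + b / 2) by rewrite powR_gt0.
have k0 := heat1_peak_gt0 h0.
have -> : - (h * mean_curvature E x) = - (h * S) by [].
apply: (@le_trans _ _ ((C1 + 1) * h `^ (1 + b / 2))%:E); last first.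
  by rewrite lee_fin ler_wpM2r ?(ltW p0)//; move: i1 i2; lra.
apply: (@normal_displacement_bound _ _ _ _ (C1 * h `^ (1 + b / 2)) _ (L * h)).
- by rewrite mulr_ge0 ?(ltW p0).
- by rewrite ltr_pM2r// ltrDl.
- rewrite normrN normrM (gtr0_norm h0) pE mulrCA -mulrDr mulrC ler_wpM2r ?(ltW h0)//.
  by rewrite /L lerD.
- move=> l lL lm; rewrite /heat_step/=.
  have [lo _] := avg l h0 hh1 lL; apply: lt_le_trans lo.
  by rewrite lte_fin ltrDl pmulr_rgt0//; lra.
- move=> l lL lm; rewrite /heat_step/=; apply/negP; rewrite -leNgt.
  have [_ up] := avg l h0 hh1 lL; apply: (le_trans up).
  by rewrite lee_fin gerDl pmulr_rle0//; lra.
Qed.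

(** The boundary of a bounded set is compact, so finitely many of the
    neighbourhoods of the local statement cover it. *)
Lemma displacement_uniform n (E : set 'rV[R]_n.+1) (b : R) :
  0 < b <= 2 -> bounded_set E ->
  (forall p, boundary E p -> exists rho M r, [/\ 0 < rho, 0 <= M, 0 < r &
      local_graph_data E b p rho M r]) ->
  exists C h0 : R, 0 < h0 /\
     forall (h : R) (x : 'rV[R]_n.+1), 0 < h -> h < h0 -> boundary E x ->
       (`|normal_displacement E h x - (- (h * mean_curvature E x))%:E|
          <= (C * h `^ (1 + b / 2))%:E)%E.
Proof.
move=> b02 bE loc.
have cB : compact (boundary E).
  apply: bounded_closed_compact.
    have [C EC] := (bounded_enormP E).1 bE.
    apply/bounded_enormP; exists (C + 1) => x [clx _].
    have /clx[y [Ey]] : nbhs x [set y | enorm (y - x) < 1].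
      by apply/near_enormP; exists 1.
    rewrite /= enormBC => xy; have := ler_enormD (x - y) y; rewrite subrK.
    have := EC _ Ey; lra.
  rewrite /boundary setDE; apply: closedI; first exact: closed_closure.
  exact/open_closedC/open_interior.
pose P (C : R) (x : 'rV[R]_n.+1) := boundary E x -> forall h, 0 < h -> h < C^-1 ->
   (`|normal_displacement E h x - (- (h * mean_curvature E x))%:E|
          <= (C * h `^ (1 + b / 2))%:E)%E.
have := (compact_near_coveringP (boundary E)).1 cB R (pinfty_nbhs R) P _.
case=> [p Bp|C [_ HC]].
  have [rho [M [r [rho0 M0 r0 data]]]] := loc p Bp.
  have [C C0 HC] := displacement_local b02 M0 r0 data.
  exists ([set x | enorm (x - p) < rho], [set C' | C < C']).
    split; first by apply/near_enormP; exists rho.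
    by apply: nbhs_pinfty_gt; exact: num_real.
  move=> [x C'] [/= xp CC'] Bx h h0 hC'.
  apply: (le_trans (HC h x h0 _ Bx xp)).
    by apply: (lt_trans hC'); rewrite ltf_pV2 ?posrE// (lt_trans C0).
  by rewrite lee_fin ler_wpM2r ?powR_ge0// ltW.
exists (`|C| + 1), (`|C| + 1)^-1; split; first by rewrite invr_gt0 ltr_wpDl.
move=> h x h0 h1 Bx; apply: HC => //.
by have := ler_norm C; lra.
Qed.

End displacement.

(** * Linearization of functions with continuous partial derivatives *)

Section line_calculus.
Variable R : realType.

Lemma is_derive_line (V : normedModType R) (f : V -> R) (y v : V) (t : R) :
  derivable f (y + t *: v) v ->
  is_derive t (1 : R) (fun s => f (y + s *: v)) ('D_v f (y + t *: v)).
Proof.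
move=> df.
have E : (fun h : R => h^-1 *: (((fun s => f (y + s *: v)) \o shift t) (h *: (1 : R)) - f (y + t *: v))) =
    (fun h : R => h^-1 *: ((f \o shift (y + t *: v)) (h *: v) - f (y + t *: v))).
  apply/funext => h /=; congr (_ *: (f _ - _)).
  by rewrite [_%:A]mulr1 scalerDl addrCA.
by apply: DeriveDef; rewrite /derivable /derive E.
Qed.

Lemma MVT_itv (F dF : R -> R) (a b : R) : a <= b ->
  (forall t : R, a <= t <= b -> is_derive t (1 : R) F (dF t)) ->
  exists2 c, a <= c <= b & F b - F a = dF c * (b - a).
Proof.
move=> ab dFt.
have [||c] := @MVT_segment R F dF a b ab.
- by move=> t /[!in_itv]/= /andP[ta tb]; apply: dFt; rewrite !ltW.
- apply: derivable_within_continuous => t /[!in_itv]/= tab.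
  by have [] := dFt t tab.
- by rewrite in_itv/= => cab E; exists c.
Qed.

Lemma MVT_line (V : normedModType R) (f : V -> R) (y v : V) (a : R) :
  (forall s : R, `|s| <= `|a| -> derivable f (y + s *: v) v) ->
  exists2 s, `|s| <= `|a| & f (y + a *: v) - f y = a * 'D_v f (y + s *: v).
Proof.
move=> df; have f0 : f y = f (y + 0 *: v) by rewrite scale0r addr0.
rewrite f0; have [a0|/ltW a0] := leP 0 a.
- have [t /andP[t0 ta]|c /andP[c0 ca] ->] :=
      @MVT_itv (fun s => f (y + s *: v)) (fun s => 'D_v f (y + s *: v)) _ _ a0.
    by apply: is_derive_line; apply: df; rewrite !ger0_norm.
  by exists c; rewrite ?ger0_norm// subr0 mulrC.
- have [t /andP[ta t0]|c /andP[ca c0] E] :=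
      @MVT_itv (fun s => f (y + s *: v)) (fun s => 'D_v f (y + s *: v)) _ _ a0.
    by apply: is_derive_line; apply: df; rewrite !ler0_norm// lerN2.
  exists c; first by rewrite !ler0_norm// lerN2.
  by rewrite -[LHS]opprB E sub0r mulrN opprK mulrC.
Qed.

Lemma MVT_bound01 (F dF : R -> R) (B : R) : F 0 = 0 ->
  (forall t : R, 0 <= t <= 1 -> is_derive t (1 : R) F (dF t)) ->
  (forall t : R, 0 <= t <= 1 -> `|dF t| <= B) ->
  forall t : R, 0 <= t <= 1 -> `|F t| <= B.
Proof.
move=> F0 dFt B1 t /andP[t0 t1].
have [s /andP[s0 st]|c /andP[c0 ct]] := @MVT_itv F dF 0 t t0.
  by apply: dFt; rewrite s0 (le_trans st).
rewrite F0 !subr0 => ->; rewrite normrM (ger0_norm t0).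
have dB : `|dF c| <= B by apply: B1; rewrite c0 (le_trans ct).
by apply: le_trans dB; rewrite ler_piMr.
Qed.

Section partials.
Variable m : nat.
Local Notation V := 'rV[R]_m.
Local Notation dlt i := (delta_mx ord0 i : V).
Local Notation D i f := ('D_(dlt i) f).
Implicit Types (f g : V -> R) (u w : V).

(** Written as the domain of a chart in subgraph_boundary, to which it is
    convertible. *)
Definition eball (r : R) : set V := [set u | enorm u < r].

Lemma eball_open r u : eball r u ->
  exists2 d, 0 < d & forall w, enorm w < d -> eball r (u + w).
Proof.
rewrite /eball/= => ur; exists (r - enorm u); first by rewrite subr_gt0.
by move=> w wd; apply: le_lt_trans (ler_enormD _ _) _; rewrite addrC -ltrBrDr.
Qed.

Lemma eball_segment (r : R) u w (t : R) : eball r u -> eball r (u + w) -> 0 <= t <= 1 ->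
  eball r (u + t *: w).
Proof.
rewrite /eball/= => ur uwr /andP[t0 t1].
have -> : u + t *: w = (1 - t) *: u + t *: (u + w).
  by rewrite scalerDr addrA -scalerDl subrK scale1r.
apply: le_lt_trans (ler_enormD _ _) _; rewrite !enormZ ger0_norm ?subr_ge0// ger0_norm//.
have [->|t1'] := eqVneq t 1; first by rewrite subrr mul0r add0r mul1r.
have : (1 - t) * enorm u < (1 - t) * r.
  by rewrite ltr_pM2l// subr_gt0 lt_def eq_sym t1'.
have : t * enorm (u + w) <= t * r by rewrite ler_wpM2l// ltW.
by lra.
Qed.

Definition C1_on (U : set V) f := forall u, U u -> forall i,
  derivable f u (dlt i) /\ {for u, continuous (D i f)}.

(** Telescoping along the coordinates of w, with the mean value theorem on each
    segment. *)
Lemma C1_on_grad r f u : C1_on (eball r) f -> eball r u ->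
  forall e, 0 < e -> exists2 d, 0 < d & forall w, enorm w < d ->
    `|f (u + w) - f u - \sum_(i < m) w ord0 i * D i f u| <= e * enorm w.
Proof.
move=> C1 ur e e0; have [d1 d10 ud1] := eball_open ur.
pose e' := e / m.+1%:R; have e'0 : 0 < e' by rewrite divr_gt0// ltr0n.
have [d2 d20 ud2] : exists2 d, 0 < d & forall w, enorm w < d ->
    forall i, `|D i f (u + w) - D i f u| < e'.
  have : \forall y \near u, forall i, `|D i f y - D i f u| < e'.
    apply: (@filter_forall _ _ (fun i y => `|D i f y - D i f u| < e')
      (nbhs u) (@nbhs_filter V u)) => i.
    have /continuous_enormP/(_ e' e'0) := (C1 u ur i).2.
    by move=> [d d0 H]; apply/near_enormP; exists d.
  move=> /near_enormP[d d0 H]; exists d => // w wd; apply: H.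
  by rewrite addrC addKr.
exists (Num.min d1 d2); first by rewrite lt_min d10.
move=> w; rewrite lt_min => /andP[wd1 wd2].
(* w is approached coordinate by coordinate *)
pose p k : V := \row_i (if (i < k)%N then w ord0 i else 0).
have p0 : p 0%N = 0 by apply/rowP => i; rewrite !mxE.
have pm : p m = w by apply/rowP => i; rewrite !mxE ltn_ord.
have pS (k : 'I_m) : p k.+1 = p k + w ord0 k *: dlt k.
  apply/rowP => i; rewrite !mxE eqxx/= ltnS leq_eqVlt.
  have [->|ik] := eqVneq i k; first by rewrite eqxx ltnn add0r mulr1.
  by rewrite (negbTE (_ : (i : nat) != k))//= mulr0 addr0.
have pw (k : 'I_m) s : `|s| <= `|w ord0 k| -> enorm (p k + s *: dlt k) <= enorm w.
  move=> sw; rewrite -(ler_pXn2r (n := 2)) ?nnegrE ?enorm_ge0// !sqr_enorm.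
  apply: ler_sum => i _; rewrite -!expr2 !mxE eqxx/=.
  rewrite -[leLHS]real_normK ?num_real// -[leRHS]real_normK ?num_real//.
  rewrite lerXn2r ?nnegrE//; have [->|ik] := eqVneq i k.
    by rewrite ltnn add0r mulr1.
  by rewrite mulr0 addr0; case: ifP => // _; rewrite normr0.
have step (k : 'I_m) : `|f (u + p k.+1) - f (u + p k) - w ord0 k * D k f u| <= e' * `|w ord0 k|.
  rewrite pS addrA.
  have [s sw|s sw ->] := @MVT_line _ f (u + p k) (dlt k) (w ord0 k).
    rewrite -addrA; apply: (C1 _ _ k).1; apply: ud1.
    exact: le_lt_trans (pw k s sw) wd1.
  rewrite -mulrBr normrM mulrC ler_wpM2r// -addrA; apply/ltW/ud2.
  exact: le_lt_trans (pw k s sw) wd2.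
have -> : f (u + w) - f u = \sum_(k < m) (f (u + p k.+1) - f (u + p k)).
  rewrite -(big_mkord xpredT (fun k => f (u + p k.+1) - f (u + p k))).
  by rewrite (telescope_sumr (fun k => f (u + p k)))// pm p0 addr0.
rewrite -sumrB; apply: le_trans (ler_norm_sum _ _ _) _.
apply: (@le_trans _ _ (\sum_(i < m) e' * enorm w)).
  apply: ler_sum => i _; apply: (le_trans (step i)).
  by rewrite ler_wpM2l ?(ltW e'0)// ler_coord_enorm.
rewrite sumr_const card_ord -[leLHS]mulr_natr mulrAC ler_wpM2r ?enorm_ge0//.
by rewrite /e' mulrAC ler_pdivrMr ?ltr0n// ler_wpM2l ?(ltW e0)// ler_nat.
Qed.

End partials.
End line_calculus.

(** * Taylor expansion in several variables *)

Section taylor.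
Variable R : realType.

Lemma is_derive_subF (F G : R -> R) (t a b : R) :
  is_derive t (1 : R) F a -> is_derive t (1 : R) G b ->
  is_derive t (1 : R) (fun s => F s - G s) (a - b).
Proof. by move=> Fa Gb; exact: is_deriveB. Qed.

Lemma is_derive_lin_sum n (w : 'I_n -> R) (F : 'I_n -> R -> R) (t : R) (a : 'I_n -> R) :
  (forall i, is_derive t (1 : R) (F i) (a i)) ->
  is_derive t (1 : R) (fun s => \sum_(i < n) w i * F i s) (\sum_(i < n) w i * a i).
Proof.
move=> Fa.
rewrite (_ : (fun _ => _) = \sum_(i < n) (w i *: F i)); last first.
  by apply/funext => s; rewrite fct_sumE.
by apply: is_derive_sum => i; exact: is_deriveZ.
Qed.

(** F k stands for the k-th derivative of F 0.  Only the variation of the N-th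
    derivative is bounded, so that a Hoelder condition on it can be used. *)
Lemma taylor_bound (N : nat) (F : nat -> R -> R) (B : R) :
  (forall j (t : R), (j < N)%N -> 0 <= t <= 1 -> is_derive t (1 : R) (F j) (F j.+1 t)) ->
  (forall t : R, 0 <= t <= 1 -> `|F N t - F N 0| <= B) ->
  forall t : R, 0 <= t <= 1 ->
    `|F 0%N t - \sum_(k < N.+1) (F k 0 / k`!%:R) * t ^+ k| <= B.
Proof.
elim: N F => [|N IH] F dF FB t t01.
  by rewrite big_ord_recl big_ord0 addr0 expr0 mulr1 fact0 divr1; exact: FB.
pose P s := \sum_(k < N.+2) (F k 0 / k`!%:R) * s ^+ k.
pose Q s := \sum_(k < N.+1) (F k.+1 0 / k`!%:R) * s ^+ k.
apply: (@MVT_bound01 R (fun s => F 0%N s - P s) (fun s => F 1%N s - Q s)) => //.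
- rewrite /P big_ord_recl/= fact0 divr1 expr0 mulr1 big1 ?addr0 ?subrr// => i _.
  by rewrite /bump /= expr0n/= mulr0.
- move=> s s01; apply: is_derive_subF; first exact: dF.
  rewrite (_ : P = fun s => F 0%N 0 - \sum_(k < N.+1) (- (F k.+1 0 / k.+1`!%:R)) * s ^+ k.+1); last first.
    apply/funext => z; rewrite /P big_ord_recl/= fact0 divr1 expr0 mulr1.
    by congr (_ + _); rewrite -sumrN; apply: eq_bigr => i _; rewrite mulNr opprK.
  rewrite (_ : Q s = 0 - \sum_(k < N.+1) (- (F k.+1 0 / k.+1`!%:R)) * (k.+1%:R * s ^+ k)); last first.
    rewrite sub0r -sumrN; apply: eq_bigr => k _.
    have k0 : k.+1%:R != 0 :> R by rewrite pnatr_eq0.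
    have f0 : k`!%:R != 0 :> R by rewrite pnatr_eq0 -lt0n fact_gt0.
    rewrite factS natrM; move: (k.+1%:R) (k`!%:R) k0 f0 => a b a0 b0.
    by field; rewrite a0 b0.
  apply: (@is_derive_subF (fun=> F 0%N 0)).
  apply: is_derive_lin_sum => k; apply: DeriveDef; first exact: exprn_derivable.
  by rewrite exp_derive [_ *: 1]mulr1.
- move=> s s01; apply: (IH (fun j => F j.+1)) => // j z jN z01.
  exact: dF.
Qed.

Section dirpoly.
Variable m : nat.
Local Notation V := 'rV[R]_m.
Local Notation dlt i := (delta_mx ord0 i : V).
Local Notation D i f := ('D_(dlt i) f).
Implicit Types (f g : V -> R) (u w : V).

(** k! times the homogeneous term of degree k of the Taylor expansion at x, as a
    polynomial in w. *)
Fixpoint dirpoly k w f (x : V) : R :=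
  if k is k'.+1 then \sum_(i < m) w ord0 i * dirpoly k' w (D i f) x else f x.

Lemma partial_rcons s i f : partial (rcons s i) f = partial s (D i f).
Proof. by rewrite /partial foldr_rcons. Qed.

Lemma Ck_on_C1 k (U : set V) f : Ck_on k.+1 U f -> C1_on U f.
Proof.
move=> Ck u Uu i; split; first by have [_ /(_ isT i u Uu)] := Ck [::] isT.
by have [/(_ u Uu)] := Ck [:: i] isT.
Qed.

Lemma Ck_on_D k (U : set V) f i : Ck_on k.+1 U f -> Ck_on k U (D i f).
Proof.
move=> Ck s sk; rewrite -partial_rcons.
have sk1 : (size (rcons s i) <= k.+1)%N by rewrite size_rcons ltnS.
have [c d] := Ck _ sk1; split => // sk'.
by apply: d; rewrite size_rcons ltnS.
Qed.

Lemma Ck_on_le k l (U : set V) f : (k <= l)%N -> Ck_on l U f -> Ck_on k U f.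
Proof.
move=> kl Cl s sk; have [c d] := Cl s (leq_trans sk kl); split => // sk'.
exact: d (leq_trans sk' kl).
Qed.

Lemma Ck_on_ball k r rho f : rho <= r -> Ck_on k (eball r) f -> Ck_on k (eball rho) f.
Proof.
move=> rr Ck s sk; have [c d] := Ck s sk; split=> [x xr|sk' i x xr].
  by apply: c; exact: lt_le_trans xr rr.
by apply: (d sk' i x); exact: lt_le_trans xr rr.
Qed.

Lemma is_derive_C1_line r f u w (t : R) : C1_on (eball r) f -> eball r (u + t *: w) ->
  is_derive t (1 : R) (fun s => f (u + s *: w)) (\sum_(i < m) w ord0 i * D i f (u + t *: w)).
Proof.
move=> C1 ut; set L := \sum_(i < m) _.
have cv : (fun h : R => h^-1 *: (((fun s => f (u + s *: w)) \o shift t) (h *: (1 : R))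
    - f (u + t *: w))) @ 0^' --> L.
  apply/cvgrPdist_lt => e e0.
  have e'0 : 0 < e / (enorm w + 1) by rewrite divr_gt0// ltr_wpDl// enorm_ge0.
  have [d d0 H] := C1_on_grad C1 ut e'0.
  have dw : 0 < d / (enorm w + 1) by rewrite divr_gt0// ltr_wpDl// enorm_ge0.
  near=> h.
  have h0 : h != 0 by near: h; exact: nbhs_dnbhs_neq.
  have hd : `|h| < d / (enorm w + 1) by near: h; exact: dnbhs0_lt.
  rewrite /= [_%:A]mulr1 scalerDl.
  have hw : enorm (h *: w) < d.
    rewrite enormZ; move: hd; rewrite ltr_pdivlMr ?ltr_wpDl ?enorm_ge0// => hd.
    by apply: le_lt_trans hd; rewrite ler_wpM2l// lerDl.
  have := H _ hw; rewrite (_ : \sum_(i < m) _ = h * L); last first.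
    by rewrite /L mulr_sumr; apply: eq_bigr => i _; rewrite mxE mulrA.
  rewrite (_ : u + (h *: w + t *: w) = u + t *: w + h *: w); last first.
    by rewrite -addrA [h *: w + _]addrC.
  set A := f _ - f _ => AB.
  have -> : L - h^-1 *: A = - (h^-1 * (A - h * L)).
    by rewrite mulrBr mulKf// opprB.
  rewrite normrN normrM normfV; rewrite ltr_pdivrMl ?normr_gt0//.
  apply: (le_lt_trans AB); rewrite enormZ mulrCA ltr_pM2l ?normr_gt0//.
  by rewrite mulrAC ltr_pdivrMr ?ltr_wpDl ?enorm_ge0// ltr_pM2l// ltrDl.
apply: DeriveDef; first by apply/cvg_ex; exists L.
exact/cvg_lim.
Unshelve. all: by end_near. Qed.

Lemma is_derive_dirpoly k r f u w (t : R) : Ck_on k.+1 (eball r) f ->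
  eball r (u + t *: w) ->
  is_derive t (1 : R) (fun s => dirpoly k w f (u + s *: w)) (dirpoly k.+1 w f (u + t *: w)).
Proof.
elim: k f => [|k IH] f Ck ut.
  exact: (is_derive_C1_line (Ck_on_C1 Ck) ut).
apply: (@is_derive_lin_sum m (fun i => w ord0 i)
  (fun i s => dirpoly k w (D i f) (u + s *: w))) => i.
by apply: IH => //; exact: Ck_on_D.
Qed.

Lemma dirpoly_le k w f x (B : R) :
  (forall s, size s = k -> `|partial s f x| <= B) ->
  `|dirpoly k w f x| <= B * (\sum_(i < m) `|w ord0 i|) ^+ k.
Proof.
elim: k f => [|k IH] f sB; first by rewrite expr0 mulr1; exact: (sB [::]).
rewrite /= exprS mulrCA mulr_suml; apply: le_trans (ler_norm_sum _ _ _) _.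
apply: ler_sum => i _; rewrite normrM ler_wpM2l//; apply: IH => s sk.
by rewrite -partial_rcons; apply: sB; rewrite size_rcons sk.
Qed.

Lemma dirpoly_dist k w f x y (B : R) :
  (forall s, size s = k -> `|partial s f x - partial s f y| <= B) ->
  `|dirpoly k w f x - dirpoly k w f y| <= B * (\sum_(i < m) `|w ord0 i|) ^+ k.
Proof.
elim: k f => [|k IH] f sB; first by rewrite expr0 mulr1; exact: (sB [::]).
rewrite /= exprS mulrCA mulr_suml -sumrB; apply: le_trans (ler_norm_sum _ _ _) _.
apply: ler_sum => i _; rewrite -mulrBr normrM ler_wpM2l//; apply: IH => s sk.
by rewrite -!partial_rcons; apply: sB; rewrite size_rcons sk.
Qed.

(** The k-th derivative along w is a homogeneous polynomial of degree k in w. *)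
Lemma dirpoly_lip k (v w : V) f x (B S : R) : 0 <= B ->
  \sum_(i < m) `|v ord0 i| <= S -> \sum_(i < m) `|w ord0 i| <= S ->
  (forall s, size s = k -> `|partial s f x| <= B) ->
  `|dirpoly k v f x - dirpoly k w f x| <=
     k%:R * B * S ^+ k.-1 * \sum_(i < m) `|(v - w) ord0 i|.
Proof.
move=> B0 vS wS; have S0 : 0 <= S by apply: le_trans vS; exact: sumr_ge0.
elim: k f => [|k IH] f sB; first by rewrite /= subrr normr0 !mul0r.
have sB' i s : size s = k -> `|partial s (D i f) x| <= B.
  by move=> sk; rewrite -partial_rcons; apply: sB; rewrite size_rcons sk.
set d := \sum_(i < m) _ in IH *.
have d0 : 0 <= d by exact: sumr_ge0.
have -> : dirpoly k.+1 v f x - dirpoly k.+1 w f x =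
   \sum_(i < m) v ord0 i * (dirpoly k v (D i f) x - dirpoly k w (D i f) x) +
   \sum_(i < m) (v - w) ord0 i * dirpoly k w (D i f) x.
  rewrite /= -sumrB -big_split/=; apply: eq_bigr => i _; rewrite !mxE.
  by move: (dirpoly k v _ x) (dirpoly k w _ x) => a b; ring.
have T1 : `|\sum_(i < m) v ord0 i * (dirpoly k v (D i f) x - dirpoly k w (D i f) x)| <=
    k%:R * B * S ^+ k * d.
  apply: le_trans (ler_norm_sum _ _ _) _.
  apply: (@le_trans _ _ ((\sum_(i < m) `|v ord0 i|) * (k%:R * B * S ^+ k.-1 * d))).
    rewrite mulr_suml; apply: ler_sum => i _; rewrite normrM ler_wpM2l//.
    exact/IH/sB'.
  case: k {IH sB sB'} => [|k]; first by rewrite !mul0r mulr0.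
  apply: (@le_trans _ _ (S * (k.+1%:R * B * S ^+ k * d))).
    by rewrite ler_wpM2r// !mulr_ge0// exprn_ge0.
  by rewrite exprS; apply: le_of_eq; ring.
have T2 : `|\sum_(i < m) (v - w) ord0 i * dirpoly k w (D i f) x| <= B * S ^+ k * d.
  apply: le_trans (ler_norm_sum _ _ _) _; rewrite mulrC mulr_suml.
  apply: ler_sum => i _; rewrite normrM ler_wpM2l//.
  apply: le_trans (@dirpoly_le k w (D i f) x B (sB' i)) _; rewrite ler_wpM2l// lerXn2r ?nnegrE//.
  exact: sumr_ge0.
apply: le_trans (ler_normD _ _) _; apply: le_trans (lerD T1 T2) _.
by apply: le_of_eq; rewrite /= -natr1; ring.
Qed.

Lemma dirpolyN k w f x : dirpoly k (- w) f x = (-1) ^+ k * dirpoly k w f x.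
Proof.
elim: k f => [|k IH] f; first by rewrite expr0 mul1r.
by rewrite /= mulr_sumr; apply: eq_bigr => i _; rewrite IH mxE exprS; ring.
Qed.

Lemma taylor_dirpoly N r f u w (B : R) : Ck_on N (eball r) f ->
  eball r u -> eball r (u + w) ->
  (forall t : R, 0 <= t <= 1 -> `|dirpoly N w f (u + t *: w) - dirpoly N w f u| <= B) ->
  `|f (u + w) - \sum_(k < N.+1) dirpoly k w f u / k`!%:R| <= B.
Proof.
move=> CN ur uwr HB.
have z : u + 0 *: w = u by rewrite scale0r addr0.
have -> : \sum_(k < N.+1) dirpoly k w f u / k`!%:R =
    \sum_(k < N.+1) (dirpoly k w f (u + 0 *: w) / k`!%:R) * 1 ^+ k.
  by apply: eq_bigr => k _; rewrite expr1n mulr1 z.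
rewrite -[in X in f (u + X)](scale1r w).
apply: (@taylor_bound N (fun k s => dirpoly k w f (u + s *: w)) B) => [j t jN t01|t t01|].
- apply: (is_derive_dirpoly (r := r)); last exact: eball_segment.
  exact: Ck_on_le CN.
- by rewrite z; exact: HB.
- by rewrite ler01 lexx.
Qed.

(** The second difference over a square of side a equals a^2 times either mixed
    derivative up to e a^2. *)
Lemma clairaut r f u i j : Ck_on 2 (eball r) f -> eball r u ->
  D i (D j f) u = D j (D i f) u.
Proof.
move=> C2 ur.
apply/eqP; rewrite -subr_eq0 -normr_le0.
apply: (@le0_of_le_small _ _ 6) => // e e0 _.
have [d0 d00 ud0] := eball_open ur.
have half (k l : 'I_m) : exists2 d, 0 < d & forall a, 0 < a -> a < d ->
    `|f (u + a *: dlt k + a *: dlt l) - f (u + a *: dlt k) - f (u + a *: dlt l) + f u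
      - a * (a * D l (D k f) u)| <= 3 * e * a ^+ 2.
  have C1 := Ck_on_C1 C2; have C1k := Ck_on_C1 (Ck_on_D k C2).
  have [d d0' H] := C1_on_grad C1k ur e0.
  exists (Num.min d d0 / 2); first by rewrite divr_gt0// lt_min d0'.
  move=> a a0; rewrite ltr_pdivlMr// lt_min => /andP[ad ad0].
  have n1 q : enorm (dlt q) = 1 by apply/eqP; rewrite -edot_enorm edot_delta mxE !eqxx.
  have b1 s : 0 <= s <= a -> enorm (s *: dlt k) <= a.
    by move=> /andP[s0 sa]; rewrite enormZ n1 mulr1 ger0_norm.
  have b2 s : 0 <= s <= a -> enorm (a *: dlt l + s *: dlt k) <= 2 * a.
    move=> /b1 sa; apply: le_trans (ler_enormD _ _) _.
    by rewrite enormZ n1 mulr1 gtr0_norm//; lra.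
  have [s s01|c c01] := @MVT_itv R (fun s => f ((u + a *: dlt l) + s *: dlt k) - f (u + s *: dlt k))
     (fun s => D k f ((u + a *: dlt l) + s *: dlt k) - D k f (u + s *: dlt k)) 0 a (ltW a0).
    apply: is_derive_subF; apply: is_derive_line; apply: (C1 _ _ k).1.
      by rewrite -addrA; apply: ud0; apply: le_lt_trans (b2 _ s01) _; rewrite mulrC.
    by apply: ud0; apply: le_lt_trans (b1 _ s01) _; lra.
  rewrite subr0 scale0r !addr0 => E.
  have H1 := H _ (le_lt_trans (b2 _ c01) (_ : 2 * a < d)).
  have H2 := H _ (le_lt_trans (b1 _ c01) (_ : a < d)).
  have {}H1 := H1 _; have {}H2 := H2 _.
  have sum1 : \sum_(q < m) (a *: dlt l + c *: dlt k) ord0 q * D q (D k f) u =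
     a * D l (D k f) u + \sum_(q < m) (c *: dlt k) ord0 q * D q (D k f) u.
    have -> : a * D l (D k f) u = \sum_(q < m) (a *: dlt l) ord0 q * D q (D k f) u.
      rewrite (bigD1 l)//= big1 ?addr0 => [|q /negbTE ql]; rewrite !mxE !eqxx/= ?ql ?mulr0 ?mul0r//.
      by rewrite mulr1.
    by rewrite -big_split/=; apply: eq_bigr => q _; rewrite [in LHS]mxE mulrDl.
  have {}H1 := H1 ltac:(by rewrite mulrC); have {}H2 := H2 ltac:(lra).
  move: H1 H2; rewrite sum1 addrA; set S := \sum_(q < m) _.
  move=> /le_trans/(_ (ler_wpM2l (ltW e0) (b2 _ c01))) H1.
  move=> /le_trans/(_ (ler_wpM2l (ltW e0) (b1 _ c01))) H2.
  have -> : f (u + a *: dlt k + a *: dlt l) - f (u + a *: dlt k) - f (u + a *: dlt l) + f u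
      - a * (a * D l (D k f) u) =
     a * ((D k f (u + a *: dlt l + c *: dlt k) - D k f u - (a * D l (D k f) u + S))
       - (D k f (u + c *: dlt k) - D k f u - S)).
    rewrite [u + a *: dlt k + _]addrAC.
    have -> : f (u + a *: dlt l + a *: dlt k) =
        (D k f (u + a *: dlt l + c *: dlt k) - D k f (u + c *: dlt k)) * a +
        (f (u + a *: dlt l) - f u) + f (u + a *: dlt k) by rewrite -E; ring.
    by ring.
  rewrite normrM (gtr0_norm a0) (_ : 3 * e * a ^+ 2 = a * (e * (2 * a) + e * a)); last by ring.
  rewrite ler_wpM2l ?(ltW a0)//; apply: le_trans (ler_normB _ _) _.
  exact: lerD.
have [d1 d10 H1] := half i j; have [d2 d20 H2] := half j i.
pose a := Num.min d1 d2 / 2.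
have mn0 : 0 < Num.min d1 d2 by rewrite lt_min d10.
have a0 : 0 < a by rewrite divr_gt0.
have [ad1 ad2] : a < d1 /\ a < d2.
  have : a < Num.min d1 d2 by rewrite /a; lra.
  by rewrite lt_min => /andP.
have {}H1 := H1 a a0 ad1; have {}H2 := H2 a a0 ad2.
rewrite (addrAC u) in H2.
have a20 : 0 < a ^+ 2 by rewrite exprn_gt0.
move: H1 H2; move: (D i (D j f) u) (D j (D i f) u) => p q.
move: (f (u + a *: dlt i + a *: dlt j)) (f (u + a *: dlt i)) (f (u + a *: dlt j)) (f u).
move=> z1 z2 z3 z4 H1 H2.
rewrite -(ler_pM2l a20) -{1}(gtr0_norm a20) -normrM.
have -> : a ^+ 2 * (6 * e) = 3 * e * a ^+ 2 + 3 * e * a ^+ 2 by ring.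
apply: le_trans (lerD H1 H2); apply: le_trans (ler_normB _ _).
by apply: le_of_eq; congr (`|_|); ring.
Qed.

End dirpoly.
End taylor.

(** * Diagonalization of symmetric matrices *)

Section spectral.
Variable R : realType.

(** The reflection exchanging e and f. *)
Lemma householder n (e f : 'rV[R]_n) : edot e e = 1 -> edot f f = 1 ->
  exists2 H : 'M[R]_n, H *m H^T = 1%:M & f *m H = e.
Proof.
move=> e1 f1; have [<-|ef] := eqVneq f e.
  by exists 1%:M; rewrite ?trmx1 mulmx1.
pose w := f - e; have w0 : edot w w != 0.
  by rewrite -sqr_enorm expf_eq0/= enorm_eq0 subr_eq0.
pose a := 2 / edot w w.
pose P := w^T *m w.
have PP : P *m P = edot w w *: P.
  by rewrite /P mulmxA -(mulmxA w^T w) mulmx_trE mul_mx_scalar -scalemxAl.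
have PT : P^T = P by rewrite /P trmx_mul trmxK.
exists (1%:M - a *: P).
  have QT : (1%:M - a *: P)^T = 1%:M - a *: P.
    by apply/matrixP => i j; rewrite -[in RHS]PT !mxE eq_sym.
  rewrite QT mulmxBl mul1mx mulmxBr mulmx1.
  rewrite -scalemxAl -scalemxAr PP !scalerA.
  rewrite (_ : a * a * edot w w = a + a); last by rewrite /a; field.
  by rewrite scalerDl opprB addrK subrK.
rewrite mulmxBr mulmx1 -scalemxAr mulmxA mulmx_trE mul_scalar_mx scalerA.
suff -> : a * edot f w = 1 by rewrite scale1r /w opprB addrC subrK.
have wE : edot w w = 2 * edot f w.
  by rewrite /w !(edotBl, edotBr) e1 f1 (edotC e f); ring.
rewrite /a wE; field; apply: contra_neq w0 => fw; rewrite wE fw mulr0//.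
Qed.

Lemma continuous_quad_form n (B : 'M[R]_n.+1) :
  continuous (fun x : 'rV[R]_n.+1 => edot (x *m B) x).
Proof.
have co i : continuous (fun x : 'rV[R]_n.+1 => x ord0 i) by exact: coord_continuous.
have sum (f : 'I_n.+1 -> 'rV[R]_n.+1 -> R) : (forall i, continuous (f i)) ->
    continuous (fun x => \sum_i f i x).
  by move=> cf; apply: continuous_big => //; exact: add_continuous.
have mul (f g : 'rV[R]_n.+1 -> R) : continuous f -> continuous g ->
    continuous (fun x => f x * g x).
  by move=> cf cg x; exact: continuousM (cf x) (cg x).
have lin i : continuous (fun x : 'rV[R]_n.+1 => (x *m B) ord0 i).
  rewrite (_ : (fun _ => _) = fun x : 'rV[R]_n.+1 => \sum_j x ord0 j * B j i).
    by apply: sum => j; apply: mul; [exact: co|exact: cst_continuous].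
  by apply/funext => x; rewrite mxE.
by apply: sum => i; exact: mul.
Qed.

Lemma rayleigh_max n (A : 'M[R]_n.+1) :
  exists2 e : 'rV[R]_n.+1, edot e e = 1 &
    forall x, edot (x *m A) x <= edot (e *m A) e * edot x x.
Proof.
pose S := [set x : 'rV[R]_n.+1 | edot x x = 1].
have SE : S = (fun x : 'rV[R]_n.+1 => edot (x *m 1%:M) x) @^-1` [set 1].
  by apply/seteqP; split => x /=; rewrite mulmx1.
have cS : compact S.
  apply: bounded_closed_compact.
    by apply/bounded_enormP; exists 1 => x /eqP; rewrite edot_enorm => /eqP ->.
  rewrite SE; apply: closed_comp; last exact: closed_eq.
  by move=> x _; exact: continuous_quad_form.
have S0 : S !=set0.
  by exists (delta_mx ord0 ord0); rewrite /S/= edot_delta mxE !eqxx.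
have [e /set_mem e1 emax] := EVT_max_rV S0 cS (continuous_subspaceT (@continuous_quad_form n A)).
exists e => // x; have [->|x0] := eqVneq x 0.
  by rewrite mul0mx !edot0l mulr0.
have nx : 0 < enorm x by rewrite enorm_gt0.
have : edot ((enorm x)^-1 *: x *m A) ((enorm x)^-1 *: x) <= edot (e *m A) e.
  apply: emax; apply/mem_set; rewrite /S/= edotZl edotZr -sqr_enorm.
  by field; rewrite gt_eqF.
rewrite -scalemxAl edotZl edotZr mulrA -expr2 -sqr_enorm exprVn.
by rewrite ler_pdivrMl ?exprn_gt0// mulrC.
Qed.

(** A maximizer of the Rayleigh quotient on the unit sphere is an eigenvector. *)
Lemma symmetric_eigenvector n (A : 'M[R]_n.+1) : A^T = A ->
  exists2 e : 'rV[R]_n.+1, edot e e = 1 & exists l, e *m A = l *: e.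
Proof.
move=> AT; have [e e1 emax] := rayleigh_max A; exists e => //.
set l := edot (e *m A) e in emax; exists l.
apply/eqP; rewrite -subr_eq0 -enorm_eq0 -sqrf_eq0 sqr_enorm; apply/eqP.
set y := e *m A - l *: e.
have sym : edot (y *m A) e = edot (e *m A) y by rewrite edot_mulmx AT edotC.
have ye : edot e y = 0.
  by rewrite /y edotBr edotZr e1 mulr1 edotC subrr.
have Ay : edot (e *m A) y = edot y y.
  by rewrite -[X in edot X y](subrK (l *: e)) edotDl edotZl ye mulr0 addr0.
clearbody y.
(* the first variation of the Rayleigh quotient in direction y vanishes *)
have var t : 2 * t * edot y y + t ^+ 2 * edot (y *m A) y <= l * t ^+ 2 * edot y y.
  have := emax (e + t *: y).
  rewrite mulmxDl -scalemxAl !(edotDl, edotDr, edotZl, edotZr) sym Ay ye (edotC y e) ye e1.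
  by rewrite -/l; lra.
set Y := edot y y in var *; set q := edot (y *m A) y in var.
have Y0 : 0 <= Y by exact: edot_ge0.
have K0 : 0 < `|l * Y - q| + 1 by rewrite ltr_wpDl.
have := var (Y / (`|l * Y - q| + 1)).
set t := Y / _ => H.
have t0 : 0 <= t by rewrite divr_ge0// ltW.
have tY : Y = t * (`|l * Y - q| + 1) by rewrite divfK// gt_eqF.
have : t * (2 * Y) <= t * (t * (l * Y - q)) by lra.
have [t00 _|tn0] := eqVneq t 0; first by rewrite tY t00 mul0r.
rewrite ler_pM2l ?lt_def ?tn0//.
have : t * (l * Y - q) <= Y by rewrite {2}tY ler_wpM2l//; have := ler_norm (l * Y - q); lra.
lra.
Qed.

(** A reflection moves a unit eigenvector to the first basis vector; the matrix
    then splits into a scalar and a symmetric block of smaller size. *)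
Lemma spectral_theorem n (A : 'M[R]_n) : A^T = A ->
  exists (O : 'M[R]_n) (k : 'rV[R]_n), O *m O^T = 1%:M /\ O *m A = diag_mx k *m O.
Proof.
elim: n A => [|n IH] A AT; first by exists 1%:M, 0; split; apply/matrixP => -[].
have [e e1 [l el]] := symmetric_eigenvector AT.
have d1 : edot (delta_mx ord0 ord0 : 'rV[R]_n.+1) (delta_mx ord0 ord0) = 1.
  by rewrite edot_delta mxE !eqxx.
have [H HH He] := householder e1 d1.
have HH' := mulmx1C HH.
pose A' := H *m A *m H^T.
have A'T : A'^T = A' by rewrite /A' !trmx_mul trmxK AT mulmxA.
have A'0 : delta_mx ord0 ord0 *m A' = l *: (delta_mx ord0 ord0 : 'rV[R]_n.+1).
  by rewrite /A' !mulmxA He el -scalemxAl -He -mulmxA HH mulmx1.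
have A'def : A' = H *m A *m H^T by [].
clearbody A'.
pose B : 'M[R]_n := @drsubmx R 1 n 1 n A'.
have BT : B^T = B by rewrite /B trmx_drsub A'T.
have [ O [k [OO OB]]] := IH B BT.
have A'row j : A' ord0 j = l * (ord0 == j)%:R.
  have := congr1 (fun M : 'rV_n.+1 => M ord0 j) A'0.
  by rewrite -rowE !mxE eqxx/= eq_sym.
have l0 : @lshift 1 n ord0 = (ord0 : 'I_n.+1) by exact/val_inj.
have A'E : A' = @block_mx R 1 n 1 n l%:M 0 0 B.
  apply: (etrans (esym (@submxK R 1 n 1 n A'))).
  congr (@block_mx R 1 n 1 n _ _ _ _).
  - apply/matrixP => i j; rewrite !mxE !(ord1 i) !(ord1 j).
    by rewrite l0 A'row eqxx mulr1.
  - apply/matrixP => i j; rewrite !mxE !(ord1 i).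
    by rewrite l0 A'row mulr0.
  - apply/matrixP => i j; rewrite !mxE !(ord1 j) -A'T mxE.
    by rewrite l0 A'row mulr0.
pose P : 'M[R]_n.+1 := @block_mx R 1 n 1 n 1%:M 0 0 O.
exists (P *m H), (row_mx (l%:M : 'M[R]_1) k : 'rV[R]_(1 + n)); split.
  rewrite trmx_mul mulmxA -(mulmxA P) HH mulmx1 /P.
  rewrite (@tr_block_mx R 1 n 1 n) trmx1 !trmx0.
  apply: (etrans (@mulmx_block R 1 n 1 n 1 n _ _ _ _ _ _ _ _)).
  by rewrite !mul0mx !mulmx0 !mulmx1 !addr0 add0r OO -scalar_mx_block.
have PA : P *m A' = diag_mx (row_mx (l%:M : 'M[R]_1) k : 'rV[R]_(1 + n)) *m P.
  rewrite A'E /P diag_mx_row.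
  apply: (etrans (@mulmx_block R 1 n 1 n 1 n _ _ _ _ _ _ _ _)).
  apply/esym/(etrans (@mulmx_block R 1 n 1 n 1 n _ _ _ _ _ _ _ _)).
  rewrite !mul0mx !mulmx0 !mulmx1 !mul1mx !addr0 !add0r OB; congr block_mx.
  by apply/matrixP => i j; rewrite !mxE !ord1.
rewrite mulmxA -PA A'def -!mulmxA; congr (_ *m (_ *m _)).
by rewrite HH' mulmx1.
Qed.

End spectral.

(** * Boundary and outer normal of a set with a defining function *)

Section defining_function.
Variables (R : realType) (d : nat).
Local Notation V := 'rV[R]_d.

(** N is the gradient of phi.  It enters through a first-order expansion with
    quadratic error, so that one constant serves the whole ball. *)
Definition defining_function (E : set V) (p : V) (r K : R) (phi : V -> R)
    (N : V -> V) : Prop :=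
  [/\ 0 <= K,
      forall y, enorm (y - p) < r -> (phi y < 0 -> E y) /\ (0 < phi y -> ~ E y),
      forall y, enorm (y - p) < r -> 1 <= enorm (N y) &
      forall x y, enorm (x - p) < r -> enorm (y - p) < r ->
        `|phi y - phi x - edot (N x) (y - x)| <= K * enorm (y - x) ^+ 2].

Variables (E : set V) (p : V) (r K : R) (phi : V -> R) (N : V -> V).
Hypothesis def_phi : defining_function E p r K phi N.

Let K0 : 0 <= K. Proof. by case: def_phi. Qed.

Definition unit_gradient x := (enorm (N x))^-1 *: N x.

Lemma enorm_unit_gradient x : enorm (x - p) < r -> enorm (unit_gradient x) = 1.
Proof.
case: def_phi => _ _ N1 _ /N1 Nx; have N0 := lt_le_trans ltr01 Nx.
by rewrite /unit_gradient enormZ gtr0_norm ?invr_gt0// mulVf// gt_eqF.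
Qed.

Lemma gradientE x : enorm (x - p) < r -> N x = enorm (N x) *: unit_gradient x.
Proof.
case: def_phi => _ _ N1 _ /N1 Nx; have N0 := lt_le_trans ltr01 Nx.
by rewrite /unit_gradient scalerA mulfV ?scale1r// gt_eqF.
Qed.

Lemma chart_room x : enorm (x - p) < r ->
  exists2 d0, 0 < d0 & forall y, enorm (y - x) < d0 -> enorm (y - p) < r.
Proof.
move=> xr; exists (r - enorm (x - p)); first by rewrite subr_gt0.
move=> y yx; rewrite -(subrK x y) -addrA.
apply: le_lt_trans (ler_enormD _ _) _; lra.
Qed.

Lemma defining_function_continuous x : enorm (x - p) < r -> forall e, 0 < e ->
  exists2 d0, 0 < d0 & forall y, enorm (y - x) < d0 -> `|phi y - phi x| < e.
Proof.
move=> xr e e0; have [d1 d10 d1r] := chart_room xr.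
case: def_phi => _ _ _ tay.
set C := enorm (N x) + K + 1.
have C0 : 0 < C by rewrite ltr_wpDl// addr_ge0// enorm_ge0.
exists (Num.min (Num.min d1 1) (e / C)); first by rewrite !lt_min d10 ltr01 divr_gt0.
move=> y; rewrite !lt_min => /andP[/andP[yd1 y1] ye].
have T := tay _ _ xr (d1r _ yd1).
have CS := cauchy_schwarz (N x) (y - x).
rewrite (_ : phi y - phi x = (phi y - phi x - edot (N x) (y - x)) + edot (N x) (y - x));
  last by rewrite subrK.
apply: le_lt_trans (ler_normD _ _) _; apply: le_lt_trans (lerD T CS) _.
move: ye; rewrite ltr_pdivlMr// => ye; apply: le_lt_trans ye.
have w0 := enorm_ge0 (y - x); rewrite /C.
have : K * (enorm (y - x) ^+ 2) <= K * enorm (y - x).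
  by rewrite ler_wpM2l// expr2 ler_piMl// ltW.
lra.
Qed.

Lemma edot_gradient_unit x : enorm (x - p) < r ->
  edot (N x) (unit_gradient x) = enorm (N x).
Proof.
move=> xr; rewrite {1}gradientE// edotZl -sqr_enorm enorm_unit_gradient//.
by rewrite expr1n mulr1.
Qed.

Lemma phi_normal_sign x : enorm (x - p) < r -> phi x = 0 ->
  exists2 d0, 0 < d0 & forall t, 0 < t -> t < d0 ->
    E (x - t *: unit_gradient x) /\ ~ E (x + t *: unit_gradient x).
Proof.
move=> xr x0; have [d1 d10 d1r] := chart_room xr.
have nu1 := enorm_unit_gradient xr; have eN := edot_gradient_unit xr.
case: def_phi => _ Ephi N1 tay.
exists (Num.min d1 (K + 1)^-1); first by rewrite lt_min d10 invr_gt0 ltr_wpDl.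
move=> t t0; rewrite lt_min => /andP[td1 tK].
have Kt : K * t < 1.
  by move: tK; rewrite -[_^-1]mul1r ltr_pdivlMr ?ltr_wpDl//; lra.
have H (s : R) : `|s| = t -> enorm (x + s *: unit_gradient x - p) < r /\
    `|phi (x + s *: unit_gradient x) - s * enorm (N x)| <= K * t ^+ 2.
  move=> st; set y := x + _.
  have yx : y - x = s *: unit_gradient x by rewrite /y addrAC subrr add0r.
  have yt : enorm (y - x) = t by rewrite yx enormZ nu1 mulr1.
  have yr : enorm (y - p) < r by apply: d1r; rewrite yt.
  by split=> //; have := tay _ _ xr yr; rewrite yt x0 subr0 yx edotZr eN.
have big : K * t ^+ 2 < t * enorm (N x).
  rewrite expr2 mulrA mulrC ltr_pM2l//; apply: lt_le_trans Kt _; exact: N1.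
split.
- have [|] := H (- t); first by rewrite normrN gtr0_norm.
  rewrite scaleNr => yr; rewrite ler_distl => /andP[_ up].
  by apply: (Ephi _ yr).1; lra.
- have [|yr] := H t; first by rewrite gtr0_norm.
  rewrite ler_distl => /andP[lo _].
  by apply: (Ephi _ yr).2; lra.
Qed.

(** Near a zero of phi the normal line meets both sides, and where phi is not
    zero its sign is locally constant. *)
Lemma boundary_defining x : enorm (x - p) < r -> boundary E x <-> phi x = 0.
Proof.
move=> xr; have [d1 d10 d1r] := chart_room xr.
case: (def_phi) => _ Ephi _ _; split.
- move=> [clx nintx]; apply/eqP; have [neg|pos|//] := ltgtP (phi x) 0; exfalso.
  + apply: nintx; apply/near_enormP.
    have [|d2 d20 H] := @defining_function_continuous x xr (- phi x).
      by rewrite oppr_gt0.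
    exists (Num.min d1 d2); first by rewrite lt_min d10.
    move=> y; rewrite lt_min => /andP[/d1r yr /H].
    by rewrite ltr_distl => /andP[_ up]; apply: (Ephi _ yr).1; lra.
  + have [d2 d20 H] := @defining_function_continuous x xr _ pos.
    have /clx[y [Ey /=]] : nbhs x [set y | enorm (y - x) < Num.min d1 d2].
      by apply/near_enormP; exists (Num.min d1 d2) => //; rewrite lt_min d10.
    rewrite lt_min => /andP[/d1r yr /H].
    by rewrite ltr_distl => /andP[lo _]; apply: (Ephi _ yr).2 Ey; lra.
- move=> x0; have [d2 d20 H] := phi_normal_sign xr x0.
  have nu1 := enorm_unit_gradient xr.
  have small e : 0 < e -> let t := Num.min d2 e / 2 in [/\ 0 < t, t < d2 & t < e].
    move=> e0; have m0 : 0 < Num.min d2 e by rewrite lt_min d20.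
    have : Num.min d2 e / 2 < Num.min d2 e by lra.
    by rewrite lt_min => /andP[? ?]; split=> //; rewrite divr_gt0.
  split.
  + move=> B /near_enormP[e e0 HB]; have [t0 td te] := small e e0.
    have [Et _] := H _ t0 td; exists (x - (Num.min d2 e / 2) *: unit_gradient x).
    split=> //; apply: HB; rewrite addrAC subrr add0r enormN enormZ nu1 mulr1.
    by rewrite gtr0_norm.
  + move=> /near_enormP[e e0 HB]; have [t0 td te] := small e e0.
    have [_ nEt] := H _ t0 td; apply: nEt; apply: HB.
    by rewrite addrAC subrr add0r enormZ nu1 mulr1 gtr0_norm.
Qed.

(** On the normal line through x + t v the function phi changes sign within
    distance O(t^2), by the intermediate value theorem. *)
Lemma tangent_curve x v : enorm (x - p) < r -> phi x = 0 ->
  enorm v = 1 -> edot (N x) v = 0 ->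
  exists2 d0, 0 < d0 & forall t, 0 < t -> t < d0 ->
    exists s, `|s| <= (2 * K + 1) * t ^+ 2 /\
      boundary E (x + t *: v + s *: unit_gradient x).
Proof.
move=> xr x0 v1 Nv; have [d1 d10 d1r] := chart_room xr.
have nu1 := enorm_unit_gradient xr; have eN := edot_gradient_unit xr.
case: (def_phi) => _ Ephi N1 tay.
set M := 2 * K + 1; have M0 : 0 < M by rewrite ltr_wpDl// mulr_ge0.
exists (Num.min (d1 / 2) M^-1); first by rewrite lt_min divr_gt0// invr_gt0.
move=> t t0; rewrite lt_min => /andP[td1 tM].
have Mt : M * t < 1 by move: tM; rewrite -[_^-1]mul1r ltr_pdivlMr// mulrC.
have vu : edot v (unit_gradient x) = 0.
  by rewrite edotC /unit_gradient edotZl Nv mulr0.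
pose y s := x + t *: v + s *: unit_gradient x.
have yx s : y s - x = t *: v + s *: unit_gradient x.
  by rewrite /y addrC !addrA addNr add0r.
have yn s : `|s| <= M * t ^+ 2 -> enorm (y s - x) ^+ 2 <= 2 * t ^+ 2.
  move=> sM; rewrite yx pythagoras; last by rewrite edotZl edotZr vu !mulr0.
  rewrite (enormZ t) (enormZ s) v1 nu1 !mulr1 !real_normK ?num_real//.
  have : `|s| <= t.
    by apply: le_trans sM _; rewrite expr2 mulrA ler_piMl ?(ltW t0)// ltW.
  rewrite -(ler_pXn2r (n := 2)) ?nnegrE ?(ltW t0)// real_normK ?num_real//; lra.
have yr s : `|s| <= M * t ^+ 2 -> enorm (y s - p) < r.
  move=> /yn sM; apply: d1r; rewrite -(ltr_pXn2r (n := 2)) ?nnegrE ?enorm_ge0 ?(ltW d10)//.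
  apply: le_lt_trans sM _.
  have : t ^+ 2 < (d1 / 2) ^+ 2 by rewrite ltr_pXn2r ?nnegrE ?(ltW t0)// ltW// divr_gt0.
  have := exprn_gt0 2 d10; lra.
have phiy s : `|s| <= M * t ^+ 2 -> `|phi (y s) - s * enorm (N x)| <= 2 * K * t ^+ 2.
  move=> sM; have := tay _ _ xr (yr _ sM).
  rewrite x0 subr0 {1}yx edotDr (edotZr t) (edotZr s) Nv mulr0 add0r eN => /le_trans; apply.
  by rewrite (mulrC 2) -mulrA ler_wpM2l// yn.
have t2 : 0 < t ^+ 2 by rewrite exprn_gt0.
have b0 : 0 < M * t ^+ 2 by rewrite mulr_gt0.
have Nx := N1 _ xr.
have MN : M * t ^+ 2 <= M * t ^+ 2 * enorm (N x) by rewrite ler_peMr// ltW.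
have ME : M * t ^+ 2 = 2 * K * t ^+ 2 + t ^+ 2 by rewrite /M; ring.
have bb : - (M * t ^+ 2) <= M * t ^+ 2 by rewrite -subr_ge0 opprK ltW// addr_gt0.
have cont : {within `[- (M * t ^+ 2), M * t ^+ 2], continuous (phi \o y)}.
  apply: continuous_in_subspaceT => s; rewrite inE/= in_itv/= -ler_norml => sM.
  apply/cvgrPdist_lt => e e0.
  have [d2 d20 H] := defining_function_continuous (yr s sM) e0.
  apply: filterS (nbhsx_ballx s d2 d20) => z sz; rewrite distrC; apply: H.
  rewrite /y opprD addrACA subrr add0r -scalerBl enormZ nu1 mulr1 distrC.
  exact: sz.
have [|s] := @IVT R (phi \o y) _ _ 0 bb cont.
  have lo : phi (y (- (M * t ^+ 2))) <= 0.
    have := phiy (- (M * t ^+ 2)); rewrite normrN gtr0_norm// => /(_ (lexx _)).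
    rewrite ler_distl => /andP[_]; lra.
  have hi : 0 <= phi (y (M * t ^+ 2)).
    have := phiy (M * t ^+ 2); rewrite gtr0_norm// => /(_ (lexx _)).
    rewrite ler_distl => /andP[+ _]; lra.
  by rewrite /= ge_min le_max lo hi orbT.
rewrite in_itv/= -ler_norml => sM s0; exists s; split=> //.
exact/(boundary_defining (yr s sM)).
Qed.

(** The form in which tangency is used: a displacement along the boundary that
    is t v up to the fraction e. *)
Lemma tangent_approx x v e d0 : enorm (x - p) < r -> phi x = 0 ->
  enorm v = 1 -> edot (N x) v = 0 -> 0 < e -> e <= 1 -> 0 < d0 ->
  exists t s, let w := t *: v + s *: unit_gradient x in
    [/\ 0 < t, `|s| <= t * e, enorm w <= 2 * t, enorm w < d0 & boundary E (x + w)].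
Proof.
move=> xr x0 v1 Nv e0 e1 d00; have nu1 := enorm_unit_gradient xr.
have [d1 d10 H] := tangent_curve xr x0 v1 Nv.
set M := 2 * K + 1 in H; have M0 : 0 < M by rewrite ltr_wpDl// mulr_ge0.
pose m := Num.min (Num.min d1 (d0 / 2)) (e / M).
have m0 : 0 < m by rewrite !lt_min d10 !divr_gt0.
have : m / 2 < m by lra.
have t0 : 0 < m / 2 by rewrite divr_gt0.
move: (m / 2) t0 => t t0; rewrite !lt_min => /andP[/andP[td1 td2] te].
have [s [sM Bs]] := H t t0 td1; exists t, s => w.
have Mt : M * t < e by move: te; rewrite ltr_pdivlMr// mulrC.
have st : `|s| <= t * e.
  by apply: le_trans sM _; rewrite expr2 mulrA mulrC ler_wpM2l ?(ltW t0)// ltW.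
have wn : enorm w <= 2 * t.
  apply: le_trans (ler_enormD _ _) _.
  rewrite (enormZ t) (enormZ s) v1 nu1 !mulr1 (gtr0_norm t0).
  have : t * e <= t by rewrite ler_piMr// ltW.
  lra.
split=> //; first by apply: le_lt_trans wn _; lra.
by rewrite /w addrA.
Qed.

Lemma is_outer_normal_unit_gradient x : enorm (x - p) < r -> phi x = 0 ->
  is_outer_normal E x (unit_gradient x).
Proof.
move=> xr x0; have [d1 d10 d1r] := chart_room xr.
have nu1 := enorm_unit_gradient xr.
case: (def_phi) => _ Ephi N1 tay.
split=> //.
- have [d2 d20 H] := phi_normal_sign xr x0.
  near=> t; apply: H; first by near: t; exact: nbhs_right_gt.
  by near: t; exact: nbhs_right_lt.
- move=> e e0; apply/near_enormP.
  exists (Num.min d1 (e / (K + 1))); first by rewrite lt_min d10 divr_gt0// ltr_wpDl.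
  move=> y; rewrite lt_min => /andP[/d1r yr ye] By.
  have y0 := (boundary_defining yr).1 By.
  have := tay _ _ xr yr; rewrite y0 x0 subr0 sub0r normrN => T.
  rewrite /unit_gradient edotC edotZl normrM.
  have N0 := lt_le_trans ltr01 (N1 _ xr).
  rewrite normfV (gtr0_norm N0).
  apply: (@le_trans _ _ (`|edot (N x) (y - x)|)).
    by rewrite ler_piMl// invf_le1// N1.
  apply: le_trans T _; rewrite expr2 mulrA ler_wpM2r ?enorm_ge0//.
  move: ye; rewrite ltr_pdivlMr ?ltr_wpDl// => ye.
  by have := enorm_ge0 (y - x); lra.
Unshelve. all: by end_near. Qed.

(** A vector satisfying is_outer_normal is orthogonal to all tangent directions,
    as these are realized by boundary points (tangent_curve); hence it is one of
    the two unit multiples of N, and the side condition selects the sign. *)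
Lemma outer_normal_defining x : enorm (x - p) < r -> phi x = 0 ->
  outer_normal E x = unit_gradient x.
Proof.
move=> xr x0; have nu1 := enorm_unit_gradient xr.
case: (def_phi) => _ Ephi N1 tay.
have Nx := lt_le_trans ltr01 (N1 _ xr).
have Hn := is_outer_normal_unit_gradient xr x0.
apply: xget_unique => // n' [n1 side flat].
set nu := unit_gradient x in nu1 Hn *.
have orth v : enorm v = 1 -> edot (N x) v = 0 -> edot v n' = 0.
  move=> v1 Nv; apply/eqP; rewrite -normr_le0.
  apply: (@le0_of_le_small _ _ 3) => // e e0 e1.
  have /near_enormP[d2 d20 F] := flat e e0.
  have [t [s [t0 st wn wd Bs]]] := tangent_approx xr x0 v1 Nv e0 e1 d20.
  have := F _ _ Bs; rewrite -/nu in st wn wd *.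
  rewrite [x + _]addrC addrK => /(_ wd); rewrite edotDl (edotZl t) (edotZl s) => G.
  have A : `|t * edot v n'| <= t * (3 * e).
    rewrite (_ : t * edot v n' = (t * edot v n' + s * edot nu n') - s * edot nu n'); last by rewrite addrK.
    apply: le_trans (ler_normB _ _) _.
    have B1 : `|s * edot nu n'| <= t * e.
      rewrite normrM; apply: le_trans st; rewrite ler_piMr//.
      by apply: le_trans (cauchy_schwarz _ _) _; rewrite nu1 n1 mulr1.
    have B2 := ler_wpM2l (ltW e0) wn.
    lra.
  by move: A; rewrite normrM (gtr0_norm t0) ler_pM2l.
pose w := n' - edot n' nu *: nu.
have nunu : edot nu nu = 1 by rewrite -sqr_enorm nu1 expr1n.
have wnu : edot w nu = 0 by rewrite /w edotBl edotZl nunu mulr1 subrr.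
have w0 : w = 0.
  apply/eqP; rewrite -enorm_eq0 -sqrf_eq0 sqr_enorm.
  have [->|wn0] := eqVneq w 0; first by rewrite edot0l.
  have wn : 0 < enorm w by rewrite enorm_gt0.
  have : edot ((enorm w)^-1 *: w) n' = 0.
    apply: orth; first by rewrite enormZ gtr0_norm ?invr_gt0// mulVf// gt_eqF.
    by rewrite gradientE// edotZl edotZr (edotC nu) wnu !mulr0.
  rewrite edotZl => /eqP; rewrite mulf_eq0 invr_eq0 gt_eqF//= => /eqP wn'.
  by rewrite {2}/w edotBr edotZr wnu mulr0 subr0 wn'.
have n'E : n' = edot n' nu *: nu by apply/eqP; rewrite -subr_eq0 -/w w0.
have /eqP : edot n' nu ^+ 2 = 1.
  by have := n1; rewrite {1}n'E enormZ nu1 mulr1 => H; rewrite -real_normK ?num_real// H expr1n.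
rewrite sqrf_eq1 => /orP[/eqP a1|/eqP a1]; first by rewrite n'E a1 scale1r.
(* the opposite unit normal points into E *)
have [d1 d10 H] := phi_normal_sign xr x0.
have [t [t0 td [Et _]]] : exists t, [/\ 0 < t, t < d1 & E (x - t *: n') /\ ~ E (x + t *: n')].
  near (0 : R)^'+ => t; exists t; split.
  - by near: t; exact: nbhs_right_gt.
  - by near: t; exact: nbhs_right_lt.
  - by near: t.
exfalso; apply: (H t t0 td).2; move: Et.
by rewrite n'E a1 scaleN1r scalerN opprK.
Unshelve. all: by end_near. Qed.

End defining_function.

(** * Principal curvatures from the Hessian of a defining function *)

Section normal_map.
Variables (R : realType) (d : nat).
Local Notation V := 'rV[R]_d.

Definition orth_proj (nu : V) : 'M[R]_d := 1%:M - nu^T *m nu.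

Lemma mul_orth_proj (nu u : V) : u *m orth_proj nu = u - edot u nu *: nu.
Proof. by rewrite mulmxBr mulmx1 mulmxA mulmx_trE mul_scalar_mx. Qed.

Lemma tr_orth_proj (nu : V) : (orth_proj nu)^T = orth_proj nu.
Proof. by rewrite linearB/= trmx1 trmx_mul trmxK. Qed.

Lemma enorm_orth_proj (nu u : V) : edot nu nu = 1 -> enorm (u *m orth_proj nu) <= enorm u.
Proof.
move=> nn; rewrite mul_orth_proj -(ler_pXn2r (n := 2)) ?nnegrE ?enorm_ge0// !sqr_enorm.
rewrite !(edotBl, edotBr, edotZl, edotZr) nn (edotC nu u).
by have := sqr_ge0 (edot u nu); lra.
Qed.

(** The derivative of x |-> x / |x| at x is the projection orthogonal to x,
    divided by |x|; the remainder is quadratic. *)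
Lemma normalize_expansion (x y : V) : 1 <= enorm x -> 0 < enorm y ->
  enorm ((enorm y)^-1 *: y - (enorm x)^-1 *: x -
     (enorm x)^-1 *: ((y - x) *m orth_proj ((enorm x)^-1 *: x))) <=
  4 * enorm (y - x) ^+ 2.
Proof.
move=> x1 y0; have x0 := lt_le_trans ltr01 x1.
set a := enorm x in x1 x0 *; set b := enorm y in y0 *.
set nu := a^-1 *: x; set nu' := b^-1 *: y.
have nu1 : enorm nu = 1 by rewrite enormZ gtr0_norm ?invr_gt0// mulVf// gt_eqF.
have nu'1 : enorm nu' = 1 by rewrite enormZ gtr0_norm ?invr_gt0// mulVf// gt_eqF.
have nn : edot nu nu = 1 by rewrite -sqr_enorm nu1 expr1n.
have nn' : edot nu' nu' = 1 by rewrite -sqr_enorm nu'1 expr1n.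
have xE : x = a *: nu by rewrite scalerA mulfV ?scale1r// gt_eqF.
have yE : y = b *: nu' by rewrite scalerA mulfV ?scale1r// gt_eqF.
have yx : y - x = b *: nu' - a *: nu by rewrite -xE -yE.
clearbody nu nu'.
set e := enorm (y - x).
have e0 : 0 <= e by exact: enorm_ge0.
have ab : `|1 - b / a| <= e.
  have -> : 1 - b / a = (a - b) / a by rewrite mulrBl mulfV// gt_eqF.
  rewrite normrM normfV (gtr0_norm x0) ler_pdivrMr//.
  apply: le_trans (_ : e <= _); last by rewrite ler_peMr.
  by rewrite distrC; exact: ler_dist_enorm.
have dn : enorm (nu' - nu) <= 2 * e.
  have -> : nu' - nu = a^-1 *: (y - x) + (1 - b / a) *: nu'.
    by rewrite yx; apply/rowP => i; rewrite !mxE; field; rewrite gt_eqF.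
  apply: le_trans (ler_enormD _ _) _; rewrite (enormZ _ nu') nu'1 mulr1 enormZ.
  rewrite gtr0_norm ?invr_gt0// -/e.
  have : a^-1 * e <= e by rewrite ler_piMl// invf_le1.
  by move: ab; lra.
have -> : nu' - nu - a^-1 *: ((y - x) *m orth_proj nu) =
    (1 - b / a) *: ((nu' - nu) *m orth_proj nu) + (edot nu' nu - 1) *: nu.
  rewrite yx !mul_orth_proj !(edotBl, edotZl) nn mulr1.
  apply/rowP => i; rewrite !mxE; field; by rewrite gt_eqF.
have cosE : `|edot nu' nu - 1| <= 2 * e ^+ 2.
  have : enorm (nu' - nu) ^+ 2 = 2 * (1 - edot nu' nu).
    by rewrite sqr_enorm !(edotBl, edotBr) nn nn' (edotC nu nu'); ring.
  have : enorm (nu' - nu) ^+ 2 <= (2 * e) ^+ 2.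
    by rewrite lerXn2r ?nnegrE ?enorm_ge0// mulr_ge0.
  move=> H1 H2; rewrite ler0_norm; first by move: H1; rewrite H2; lra.
  by have := sqr_ge0 (enorm (nu' - nu)); rewrite H2; lra.
apply: le_trans (ler_enormD _ _) _; rewrite (enormZ _ nu) nu1 mulr1 enormZ.
have := ler_pM (normr_ge0 _) (enorm_ge0 _) ab (le_trans (enorm_orth_proj (nu' - nu) nn) dn).
by move: cosE; lra.
Qed.

End normal_map.

Section curvature.
Variables (R : realType) (n : nat).
Local Notation V := 'rV[R]_n.+1.
Variables (E : set V) (p : V) (r K : R) (phi : V -> R) (N : V -> V).
Hypothesis def_phi : defining_function E p r K phi N.
Local Notation nu := (unit_gradient N).
Variables (x : V) (Q : 'M[R]_n.+1).
Hypotheses (xr : enorm (x - p) < r) (x0 : phi x = 0).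
Hypothesis gradQ : forall e, 0 < e -> exists2 d0, 0 < d0 &
  forall y, enorm (y - x) < d0 -> enorm (N y - N x - (y - x) *m Q) <= e * enorm (y - x).

Let N1 y : enorm (y - p) < r -> 1 <= enorm (N y).
Proof. by case: def_phi => _ _ + _; apply. Qed.

(** Differential of N / |N| when Q is the differential of N. *)
Definition shape_mx : 'M[R]_n.+1 := (enorm (N x))^-1 *: (Q *m orth_proj (nu x)).

Let nu1 : edot (nu x) (nu x) = 1.
Proof. by rewrite -sqr_enorm (enorm_unit_gradient def_phi xr) expr1n. Qed.

Lemma shape_mx_normal_differential : is_normal_differential E x shape_mx.
Proof.
move=> e e0; apply/near_enormP.
have [d1 d10 d1r] := chart_room xr.
have [C C0 HC] := enorm_mulmx_le Q.
pose B := C + 1; have B0 : 0 < B by rewrite ltr_wpDl.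
have e20 : 0 < Num.min 1 (e / 2) by rewrite lt_min ltr01 divr_gt0.
have [d2 d20 HQ] := gradQ e20.
pose q := e / (8 * B ^+ 2).
have q0 : 0 < q by rewrite divr_gt0// mulr_gt0// exprn_gt0.
exists (Num.min (Num.min d1 d2) q); first by rewrite !lt_min d10 d20.
move=> y; rewrite !lt_min => /andP[/andP[/d1r yr yd2] yq] By.
have y0 := (boundary_defining def_phi yr).1 By.
rewrite (outer_normal_defining def_phi yr y0) (outer_normal_defining def_phi xr x0).
set w := y - x in yd2 yq *; have w0 := enorm_ge0 w.
have HQw := HQ y yd2; rewrite -/w in HQw.
have Qw1 : enorm (N y - N x - w *m Q) <= enorm w.
  by apply: le_trans HQw _; rewrite ler_piMl// ge_min lexx.
have Qw2 : enorm (N y - N x - w *m Q) <= e / 2 * enorm w.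
  by apply: le_trans HQw _; rewrite ler_wpM2r// ge_min lexx orbT.
have dN : enorm (N y - N x) <= B * enorm w.
  rewrite -(subrK (w *m Q) (N y - N x)); apply: le_trans (ler_enormD _ _) _.
  by have := HC w; rewrite /B; lra.
have H1 := normalize_expansion (N1 xr) (lt_le_trans ltr01 (N1 yr)).
have Nx := lt_le_trans ltr01 (N1 xr).
pose a := (enorm (N x))^-1.
have a1 : 0 < a <= 1 by rewrite invr_gt0 Nx invf_le1// N1.
have -> : nu y - nu x - w *m shape_mx =
    (nu y - nu x - a *: ((N y - N x) *m orth_proj (nu x))) +
    a *: ((N y - N x - w *m Q) *m orth_proj (nu x)).
  rewrite /shape_mx -/a -scalemxAr mulmxA.
  by rewrite (mulmxBl (N y - N x)) scalerBr addrA subrK.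
apply: le_trans (ler_enormD _ _) _; apply: le_trans (lerD H1 (lexx _)) _.
have H2 : enorm (a *: ((N y - N x - w *m Q) *m orth_proj (nu x))) <= e / 2 * enorm w.
  rewrite enormZ; case/andP: a1 => a0 a1; rewrite gtr0_norm//.
  apply: le_trans (_ : enorm ((N y - N x - w *m Q) *m orth_proj (nu x)) <= _).
    by rewrite ler_piMl ?enorm_ge0.
  by apply: le_trans Qw2; exact: enorm_orth_proj.
have H3 : 4 * enorm (N y - N x) ^+ 2 <= e / 2 * enorm w.
  apply: (@le_trans _ _ (4 * (B * enorm w) ^+ 2)).
    rewrite ler_pM2l// lerXn2r ?nnegrE ?enorm_ge0// mulr_ge0// ltW//.
  rewrite (_ : 4 * _ ^+ 2 = (4 * B ^+ 2 * enorm w) * enorm w); last by ring.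
  rewrite ler_wpM2r//.
  move: yq; rewrite /q ltr_pdivlMr ?mulr_gt0 ?exprn_gt0//; lra.
by lra.
Qed.

(** A tangent vector is approximated by differences of boundary points, along
    which both differentials describe the same increment of the normal. *)
Lemma normal_differential_unique (S1 S2 : 'M[R]_n.+1) (v : V) :
  is_normal_differential E x S1 -> is_normal_differential E x S2 ->
  edot (nu x) v = 0 -> v *m S1 = v *m S2.
Proof.
move=> D1 D2 nuv; apply/eqP; rewrite -subr_eq0 -mulmxBr; apply/eqP.
have [->|v0] := eqVneq v 0; first by rewrite mul0mx.
wlog v1 : v nuv v0 / enorm v = 1.
  move=> H; have vn : 0 < enorm v by rewrite enorm_gt0.
  have : ((enorm v)^-1 *: v) *m (S1 - S2) = 0.
    apply: H; first by rewrite edotZr nuv mulr0.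
      by rewrite scaler_eq0 invr_eq0 gt_eqF.
    by rewrite enormZ gtr0_norm ?invr_gt0// mulVf// gt_eqF.
  by rewrite -scalemxAl => /eqP; rewrite scaler_eq0 invr_eq0 gt_eqF//= => /eqP.
have Nv : edot (N x) v = 0 by rewrite (gradientE def_phi xr) edotZl nuv mulr0.
set D := S1 - S2; set c := enorm (nu x *m D); have c0 : 0 <= c by exact: enorm_ge0.
apply/eqP; rewrite -enorm_eq0 eq_le enorm_ge0 andbT.
apply: (@le0_of_le_small _ _ (4 + c)) => [|e e0 e1]; first by rewrite ltr_wpDr.
have /near_enormP[d2 d20 F1] := D1 e e0; have /near_enormP[d3 d30 F2] := D2 e e0.
have d230 : 0 < Num.min d2 d3 by rewrite lt_min d20.
have [t [s [t0 st wn wd Bs]]] := tangent_approx def_phi xr x0 v1 Nv e0 e1 d230.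
set w := t *: v + s *: nu x in wn wd Bs.
move: wd; rewrite lt_min => /andP[wd2 wd3].
have xw : x + w - x = w by rewrite [x + _]addrC addrK.
have := F1 (x + w); rewrite xw => /(_ wd2 Bs) G1.
have := F2 (x + w); rewrite xw => /(_ wd3 Bs) G2.
have G : enorm (w *m D) <= 2 * e * enorm w.
  set z := outer_normal _ _ - outer_normal _ _ in G1 G2.
  have -> : w *m D = (z - w *m S2) - (z - w *m S1).
    by rewrite mulmxBr opprB [RHS]addrC addrA subrK.
  by apply: le_trans (ler_enormB _ _) _; lra.
have tv : t *: (v *m D) = w *m D - s *: (nu x *m D).
  by rewrite /w mulmxDl -(scalemxAl t) -(scalemxAl s) addrK.
have : t * enorm (v *m D) <= t * ((4 + c) * e).
  rewrite -{1}(gtr0_norm t0) -enormZ tv; apply: le_trans (ler_enormB _ _) _.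
  rewrite (enormZ s) -/c.
  have Q1 : `|s| * c <= t * e * c by rewrite ler_wpM2r.
  have Q2 : 2 * e * enorm w <= 2 * e * (2 * t) by rewrite ler_wpM2l// mulr_ge0// ltW.
  lra.
by rewrite ler_pM2l.
Qed.

Lemma frame_through (n0 : V) (T0 : 'M[R]_(n, n.+1)) : orthonormal_frame n0 T0 ->
  exists T : 'M[R]_(n, n.+1), orthonormal_frame (nu x) T.
Proof.
move=> [TT Tn nn]; have [H HH Hn] := householder nu1 nn.
exists (T0 *m H); split => //.
  by rewrite trmx_mul mulmxA -(mulmxA T0) HH mulmx1.
by rewrite -Hn trmx_mul mulmxA -(mulmxA T0) HH mulmx1.
Qed.

Hypothesis QT : Q^T = Q.

Lemma frame_orth_proj (T : 'M[R]_(n, n.+1)) : orthonormal_frame (nu x) T ->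
  T *m orth_proj (nu x) = T.
Proof.
by move=> [_ Tn _]; rewrite /orth_proj mulmxBr mulmx1 mulmxA Tn mul0mx subr0.
Qed.

(** Principal curvatures exist by the spectral theorem for the shape operator
    in one tangent frame.  Those selected by principal_curvatures may come with
    another differential, but on the tangent space it is the same operator. *)
Lemma principal_curvatures_frame (n0 : V) (T0 : 'M[R]_(n, n.+1)) :
  orthonormal_frame n0 T0 ->
  exists T : 'M[R]_(n, n.+1), orthonormal_frame (outer_normal E x) T /\
    T *m Q *m T^T = enorm (N x) *: diag_mx (principal_curvatures E x).
Proof.
move=> fr0; have onu := outer_normal_defining def_phi xr x0.
have Nx := lt_le_trans ltr01 (N1 xr); have Nx0 : enorm (N x) != 0 by rewrite gt_eqF.
have ex : exists k, are_principal_curvatures E x k.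
  have [T1 fr1] := frame_through fr0; have [TT Tn _] := fr1.
  pose B := (enorm (N x))^-1 *: (T1 *m Q *m T1^T).
  have BT : B^T = B by rewrite /B linearZ/= !trmx_mul trmxK QT mulmxA.
  have [ O [k [OO OB]]] := spectral_theorem BT.
  exists k, shape_mx, (O *m T1).
  have TTO : (O *m T1) *m (O *m T1)^T = 1%:M.
    by rewrite trmx_mul mulmxA -(mulmxA O) TT mulmx1.
  have TnO : (O *m T1) *m (nu x)^T = 0 by rewrite -mulmxA Tn mulmx0.
  split; rewrite ?onu//; first exact: shape_mx_normal_differential.
  have frO : orthonormal_frame (nu x) (O *m T1) by split.
  (* the frame together with the normal is a basis *)
  have basis : (O *m T1)^T *m (O *m T1) = orth_proj (nu x).
    rewrite /orth_proj; have := mulmx1C (frame_mx_orth frO); rewrite /frame_mx (tr_col_mx (nu x) (O *m T1)).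
    move=> /(etrans (esym (mul_row_col (nu x)^T (O *m T1)^T (nu x) (O *m T1)))) <-.
    by rewrite addrAC subrr add0r.
  have E1 : (O *m T1) *m shape_mx = diag_mx k *m (O *m T1).
    have QB : (O *m T1) *m Q *m (O *m T1)^T = enorm (N x) *: diag_mx k.
      have -> : (O *m T1) *m Q *m (O *m T1)^T = O *m (T1 *m Q *m T1^T) *m O^T.
        by rewrite trmx_mul !mulmxA.
      have -> : T1 *m Q *m T1^T = enorm (N x) *: B.
        by rewrite /B scalerA mulfV// scale1r.
      by rewrite -scalemxAr -scalemxAl OB -mulmxA OO mulmx1.
    rewrite /shape_mx -basis -scalemxAr.
    have -> : (O *m T1) *m (Q *m ((O *m T1)^T *m (O *m T1))) =
        (O *m T1) *m Q *m (O *m T1)^T *m (O *m T1) by rewrite !mulmxA.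
    by rewrite QB -scalemxAl scalerA mulVf// scale1r.
  by move=> i; rewrite -row_mul E1 row_mul row_diag_mx -scalemxAl -rowE.
have [S' [T [DS TT Tn TS]]] : are_principal_curvatures E x (principal_curvatures E x).
  exact: (xgetPex 0 ex).
rewrite onu in Tn.
exists T; split; first by split; rewrite ?onu.
set k := principal_curvatures E x in TS *.
have TS' : T *m S' = diag_mx k *m T.
  by apply/row_matrixP => i; rewrite row_mul TS row_mul row_diag_mx -scalemxAl -rowE.
have TSE : T *m shape_mx = T *m S'.
  apply/row_matrixP => i; rewrite !row_mul.
  apply: normal_differential_unique => //; first exact: shape_mx_normal_differential.
  have := congr1 (fun A : 'M[R]_(n, 1) => A i ord0) Tn; rewrite !mxE => H.
  rewrite /edot -[RHS]H; apply: eq_bigr => j _; rewrite !mxE mulrC//.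
have PTt : orth_proj (nu x) *m T^T = T^T.
  apply: trmx_inj; rewrite trmx_mul !trmxK tr_orth_proj.
  by apply: frame_orth_proj; split.
have := congr1 (fun A => enorm (N x) *: (A *m T^T)) (etrans TSE TS').
rewrite -(mulmxA (diag_mx _)) TT mulmx1 => <-.
rewrite /shape_mx -scalemxAr -scalemxAl scalerA mulfV// scale1r.
by rewrite -!mulmxA PTt.
Qed.

End curvature.

(** * From a Taylor expansion to a graph over the tangent space *)

Section taylor_to_graph.
Variable R : realType.
Local Notation RT := (measurableTypeR R).
Local Notation RTn n := (n.-tuple RT).

Lemma sqr_le_powR (x b : R) : 0 <= x <= 1 -> 0 <= b <= 2 -> x ^+ 2 <= x `^ b.
Proof.
move=> /andP[x0 x1] /andP[b0 b2]; have [->|xn0] := eqVneq x 0.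
  by rewrite expr0n/= powR_ge0.
have xgt0 : 0 < x by rewrite lt_def xn0.
by rewrite -powR_mulrn// ger_powR// xgt0.
Qed.

Lemma pow_sum_le (x s w b : R) : 0 <= x <= 1 -> 0 <= s <= 1 -> 0 <= w -> w <= x + s ->
  0 <= b <= 2 -> w ^+ 2 * w `^ b <= 16 * (x ^+ 2 * x `^ b + s ^+ 2).
Proof.
move=> /andP[x0 x1] /andP[s0 s1] w0 wxs /andP[b0 b2].
have key z : 0 <= z -> w <= 2 * z -> w ^+ 2 * w `^ b <= 16 * (z ^+ 2 * z `^ b).
  move=> z0 wz; rewrite (_ : 16 * _ = (2 * z) ^+ 2 * (4 * z `^ b)); last by ring.
  apply: ler_pM; rewrite ?sqr_ge0 ?powR_ge0//.
    by rewrite lerXn2r ?nnegrE// mulr_ge0.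
  apply: (@le_trans _ _ ((2 * z) `^ b)).
    by rewrite ge0_ler_powR ?nnegrE ?mulr_ge0.
  rewrite powRM// ler_wpM2r ?powR_ge0//.
  apply: (@le_trans _ _ (2 `^ 2)); first by rewrite ler_powR// ler1n.
  by rewrite powR_mulrn// expr2; lra.
have [sx|/ltW xs] := leP s x.
  apply: (le_trans (key x x0 _)); first lra.
  by rewrite ler_pM2l// lerDl sqr_ge0.
apply: (le_trans (key s s0 _)); first lra.
rewrite ler_pM2l// -[leLHS]add0r lerD// ?mulr_ge0 ?sqr_ge0 ?powR_ge0//.
rewrite ler_piMr ?sqr_ge0//; apply: (@le_trans _ _ (1 `^ b)); last by rewrite powR1.
by rewrite ge0_ler_powR ?nnegrE.
Qed.

(** With w = s nu + v T the expansion of phi reads a (s + q(v)/2) + s Q_n(v)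
    + c(v T) up to small terms, where Q_n couples normal and tangent
    directions.  To leading order s = - q(v)/2 on the zero set, so the coupling
    contributes the odd cubic - q(v) Q_n(v) / 2 and
    c' = a^(-1) (Q_n q / 2 - c).  With sg the height above g0 = - q/2 + c', the
    claim becomes |phi - a sg| <= A1 |v|^(2+b) + |sg| / 2, so phi has the sign
    of sg as soon as |sg| > 2 A1 |v|^(2+b). *)
Lemma graph_sandwich_of_taylor n (K b rho : R) : 0 <= K -> 0 <= b <= 2 -> 0 < rho ->
  exists M r : R, [/\ 0 <= M, 0 < r &
  forall (E : set 'rV[R]_n.+1) (x nu : 'rV[R]_n.+1) (T : 'M[R]_(n, n.+1)) (k : 'rV[R]_n)
    (phi : 'rV[R]_n.+1 -> R) (a : R) (Q : 'M[R]_n.+1) (c : 'rV[R]_n.+1 -> R),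
    orthonormal_frame nu T -> 1 <= a -> Q^T = Q ->
    T *m Q *m T^T = a *: diag_mx k ->
    (forall u v, `|edot (u *m Q) v| <= K * (enorm u * enorm v)) ->
    (forall w, c (- w) = - c w) -> (forall w, `|c w| <= K * enorm w ^+ 3) ->
    (forall w w', `|c (w + w') - c w| <= K * ((enorm w + enorm w') ^+ 2 * enorm w')) ->
    measurable_fun [set: RTn n] (fun t => c (rV_of_tuple t *m T)) ->
    (forall w, enorm w < rho ->
       (phi (x + w) < 0 -> E (x + w)) /\ (0 < phi (x + w) -> ~ E (x + w))) ->
    (forall w, enorm w < rho ->
      `|phi (x + w) - (a * edot nu w + 2^-1 * edot (w *m Q) w + c w)| <=
        K * (enorm w ^+ 2 * enorm w `^ b)) ->
    exists c' : 'rV[R]_n -> R,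
      [/\ (forall i, `|k ord0 i| <= M),
          (forall v, c' (- v) = - c' v) /\ (forall v, `|c' v| <= M * enorm v ^+ 3),
          measurable_fun [set: RTn n] (fun t => c' (rV_of_tuple t)) &
          graph_sandwich E x nu T k c' M b r]].
Proof.
move=> K0 b02 rho0.
pose K' := K ^+ 2 + K; pose G := K ^+ 2 + 2 * K.
pose A1 := K * K' + K * G ^+ 2 + 2 * K * G + 4 * K * G ^+ 3 + 16 * K + 32 * K * G ^+ 2.
pose A2 := K + K * (1 + G) + 4 * K * G * (1 + G) + 4 * K + 32 * K * (1 + G).
have K'0 : 0 <= K' by rewrite addr_ge0 ?sqr_ge0.
have G0 : 0 <= G by rewrite addr_ge0 ?sqr_ge0 ?mulr_ge0.
have G10 : 0 <= 1 + G by rewrite addr_ge0.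
have A10 : 0 <= A1 by rewrite !addr_ge0// !mulr_ge0// ?sqr_ge0 ?exprn_ge0.
have A20 : 0 <= A2 by rewrite !addr_ge0// !mulr_ge0.
pose r := Num.min (Num.min 1 (rho / 2)) (2 * A2 + 1)^-1.
have r0 : 0 < r by rewrite !lt_min ltr01 divr_gt0// invr_gt0 ltr_wpDl// mulr_ge0.
have r1 : r <= 1 by rewrite !ge_min lexx.
have rrho : r <= rho / 2 by rewrite !ge_min lexx orbT.
have rA2 : A2 * r <= 2^-1.
  have : r <= (2 * A2 + 1)^-1 by rewrite !ge_min lexx orbT.
  have A3 : 0 < 2 * A2 + 1 by rewrite ltr_wpDl// mulr_ge0.
  rewrite -[_^-1]mul1r ler_pdivlMr//; lra.
exists (2 * A1 + K' + K), r; split=> //; first by rewrite !addr_ge0// mulr_ge0.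
move=> E x nu T k phi a Q c fr a1 QT TQ QK codd cK clip mc Ephi tay.
have a0 : 0 < a by exact: lt_le_trans a1.
have [TT Tn nn] := fr.
have nu1 : enorm nu = 1 by apply/eqP; rewrite -edot_enorm nn.
pose q (v : 'rV[R]_n) := \sum_(i < n) k ord0 i * v ord0 i ^+ 2.
pose Qn (v : 'rV[R]_n) := edot (v *m T *m Q) nu.
pose c' (v : 'rV[R]_n) := a^-1 * (2^-1 * Qn v * q v - c (v *m T)).
have vT v : enorm (v *m T) = enorm v by exact: enorm_isometry.
have ia1 : a^-1 <= 1 by rewrite invf_le1.
have ia0 : 0 <= a^-1 by rewrite invr_ge0 ltW.
have qE v : edot (v *m T *m Q) (v *m T) = a * q v.
  rewrite edotE trmx_mul mulmxA -(mulmxA v T Q) -(mulmxA v (T *m Q)) TQ.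
  rewrite -scalemxAr -scalemxAl mxE; congr (_ * _).
  rewrite mul_mx_diag mxE; apply: eq_bigr => i _; rewrite !mxE; ring.
have qK v : `|q v| <= K * enorm v ^+ 2.
  have := QK (v *m T) (v *m T); rewrite qE vT normrM (gtr0_norm a0) -expr2.
  by apply: le_trans; rewrite ler_peMl.
have QnK v : `|Qn v| <= K * enorm v.
  by have := QK (v *m T) nu; rewrite vT nu1 mulr1.
have c'K v : `|c' v| <= K' * enorm v ^+ 3.
  rewrite /c' normrM ger0_norm//.
  apply: (@le_trans _ _ (`|2^-1 * Qn v * q v - c (v *m T)|)); first by rewrite ler_piMl.
  apply: le_trans (ler_normB _ _) _; rewrite !normrM ger0_norm ?invr_ge0//.
  have := cK (v *m T); rewrite vT => H1.
  have H2 := ler_pM (normr_ge0 _) (normr_ge0 _) (QnK v) (qK v).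
  have H3 : 0 <= K ^+ 2 * enorm v ^+ 3 by rewrite mulr_ge0 ?sqr_ge0 ?exprn_ge0 ?enorm_ge0.
  rewrite /K' mulrDl; apply: lerD H1.
  rewrite -mulrA; move: H2; rewrite (_ : K * enorm v * _ = K ^+ 2 * enorm v ^+ 3); last by ring.
  by have : 0 <= `|Qn v| * `|q v| by []; lra.
exists c'; split.
- move=> i; have := qK (delta_mx ord0 i).
  have -> : q (delta_mx ord0 i) = k ord0 i.
    rewrite /q (bigD1 i)//= mxE !eqxx expr1n mulr1 big1 ?addr0// => j /negbTE ji.
    by rewrite mxE ji andbF expr0n mulr0.
  rewrite sqr_enorm edot_delta mxE !eqxx mulr1 => /le_trans; apply.
  by rewrite lerDr addr_ge0// mulr_ge0.
- split=> v.
    rewrite /c' /Qn !mulNmx edotNl codd.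
    have -> : q (- v) = q v by apply: eq_bigr => i _; rewrite mxE sqrrN.
    by ring.
  apply: le_trans (c'K v) _; rewrite ler_wpM2r ?exprn_ge0 ?enorm_ge0//.
  by move: A10 K'0; lra.
- have mv : measurable_rV (fun t : RTn n => rV_of_tuple t) by exact: measurable_rV_id.
  apply: measurable_funM; first exact: measurable_cst.
  apply: measurable_funB => //; apply: measurable_funM.
    apply: measurable_funM; first exact: measurable_cst.
    apply: measurable_edot; last exact: measurable_rV_cst.
    by do 2 apply: measurable_rV_mulmx.
  apply: measurable_sum => i; apply: measurable_funM; first exact: measurable_cst.
  by apply: measurable_funX; exact: mv.
- move=> v s vr sr; set M := 2 * A1 + K' + K.
  pose g0 := - (2^-1 * q v) + c' v; pose sg := s - g0.
  pose X := enorm v ^+ 2 * enorm v `^ b.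
  have X0 : 0 <= X by rewrite mulr_ge0 ?sqr_ge0 ?powR_ge0.
  have v0 := enorm_ge0 v.
  have v1 : enorm v <= 1 by rewrite (le_trans (ltW vr)).
  have s1 : `|s| <= 1 by rewrite (le_trans (ltW sr)).
  have nuT : nu *m T^T = 0 by apply: trmx_inj; rewrite trmx_mul trmxK Tn trmx0.
  have nuv : edot nu (v *m T) = 0 by rewrite edotC edot_mulmx nuT edot0r.
  have wle : enorm (s *: nu + v *m T) <= enorm v + `|s|.
    by apply: le_trans (ler_enormD _ _) _; rewrite enormZ nu1 mulr1 vT addrC.
  have wrho : enorm (s *: nu + v *m T) < rho.
    by apply: le_lt_trans wle _; move: vr sr rrho; lra.
  have key : `|phi (x + (s *: nu + v *m T)) - a * sg| <= A1 * X + 2^-1 * `|sg|.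
    set w := s *: nu + v *m T in wrho wle *; have w0 := enorm_ge0 w.
    pose P := edot (nu *m Q) nu; pose D := c (v *m T + s *: nu) - c (v *m T).
    have E1 : edot nu w = s by rewrite /w edotDr edotZr nn nuv addr0 mulr1.
    have E2 : edot (w *m Q) w = s ^+ 2 * P + 2 * s * Qn v + a * q v.
      rewrite /w mulmxDl -scalemxAl !(edotDl, edotDr, edotZl, edotZr) qE.
      rewrite (_ : edot (nu *m Q) (v *m T) = Qn v); last by rewrite edot_mulmx QT edotC.
      by rewrite -/P -/(Qn v); ring.
    have E3 : c w = c (v *m T) + D by rewrite /D /w [s *: nu + _]addrC [RHS]addrC subrK.
    have ac' : a * c' v = 2^-1 * Qn v * q v - c (v *m T).
      by rewrite /c' mulrA mulfV ?mul1r// gt_eqF.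
    have T1 := tay w wrho; rewrite E1 E2 E3 in T1.
    have id : phi (x + w) - a * sg =
       (phi (x + w) - (a * s + 2^-1 * (s ^+ 2 * P + 2 * s * Qn v + a * q v) + (c (v *m T) + D)))
       + 2^-1 * (s ^+ 2 * P) + Qn v * (c' v + sg) + D.
      have -> : a * sg = a * s + 2^-1 * (a * q v) - a * c' v by rewrite /sg /g0; ring.
      by rewrite ac' /sg /g0; field.
    have P1 : `|P| <= K by have := QK nu nu; rewrite nu1 !mulr1.
    have D1 : `|D| <= K * ((enorm v + `|s|) ^+ 2 * `|s|).
      by have := clip (v *m T) (s *: nu); rewrite vT enormZ nu1 mulr1.
    have R1 : K * (enorm w ^+ 2 * enorm w `^ b) <= K * (16 * (X + `|s| ^+ 2)).
      by rewrite ler_wpM2l// pow_sum_le// ?v0 ?v1 ?normr_ge0 ?s1.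
    have x4 : enorm v ^+ 4 <= X.
      rewrite /X (_ : enorm v ^+ 4 = enorm v ^+ 2 * enorm v ^+ 2); last by ring.
      by rewrite ler_wpM2l ?sqr_ge0// sqr_le_powR ?v0.
    have g0G : `|g0| <= G * enorm v ^+ 2.
      apply: le_trans (ler_normD _ _) _; rewrite normrN normrM ger0_norm ?invr_ge0//.
      have : K' * enorm v ^+ 3 <= K' * enorm v ^+ 2.
        by rewrite ler_wpM2l// exprS ler_piMl// sqr_ge0.
      have := c'K v; have := qK v; rewrite /G /K' => H1 H2 H3.
      have H4 : 0 <= K * enorm v ^+ 2 by rewrite mulr_ge0 ?sqr_ge0.
      by lra.
    have x2r : enorm v ^+ 2 <= r.
      by rewrite expr2 (le_trans (ler_piMl _ v1))// ltW.
    have s2r : `|s| ^+ 2 <= r.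
      by rewrite expr2 (le_trans (ler_piMl _ s1))// ltW.
    have sgs : `|s| <= G * enorm v ^+ 2 + `|sg|.
      by rewrite -(subrK g0 s) addrC; apply: le_trans (ler_normD _ _) _; rewrite lerD2r.
    have Sr : `|sg| <= (1 + G) * r.
      apply: le_trans (ler_normB _ _) _; rewrite mulrDl mul1r; apply: lerD; first exact: ltW.
      by apply: le_trans g0G _; rewrite ler_wpM2l.
    have Qn1 : `|Qn v * (c' v + sg)| <= K * enorm v * (K' * enorm v ^+ 3 + `|sg|).
      rewrite normrM; apply: ler_pM => //; apply: le_trans (ler_normD _ _) _.
      by rewrite lerD2r c'K.
    have sP : `|2^-1 * (s ^+ 2 * P)| <= 2^-1 * (`|s| ^+ 2 * K).
      rewrite normrM ger0_norm ?invr_ge0// ler_pM2l ?invr_gt0//.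
      by rewrite normrM normrX ler_wpM2l ?sqr_ge0.
    rewrite id; apply: le_trans (ler_normD _ _) _.
    apply: le_trans (lerD (le_trans (ler_normD _ _) (lerD (le_trans (ler_normD _ _)
      (lerD (le_trans T1 R1) sP)) Qn1)) D1) _.
    move: (normr_ge0 s) (normr_ge0 sg) v0 v1 s1 vr sr X0 x4 x2r s2r sgs Sr.
    move: (enorm v) (X) (`|s|) (`|sg|) => y Z t S.
    move=> t0 S0 y0 y1 t1 yr tr Z0 y4 y2r t2r tS Sr.
    have t2 : t ^+ 2 <= 2 * G ^+ 2 * Z + 2 * (1 + G) * r * S.
      apply: (@le_trans _ _ ((G * y ^+ 2 + S) ^+ 2)).
        by rewrite lerXn2r ?nnegrE// addr_ge0// mulr_ge0 ?sqr_ge0.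
      apply: (@le_trans _ _ (2 * G ^+ 2 * y ^+ 4 + 2 * S * S)).
        have := sqr_ge0 (G * y ^+ 2 - S).
        rewrite (_ : y ^+ 4 = (y ^+ 2) ^+ 2); last by ring.
        by move: (y ^+ 2) => z; nra.
      apply: lerD; first by rewrite ler_wpM2l// mulr_ge0 ?sqr_ge0.
      rewrite -!mulrA ler_pM2l// mulrC mulrCA mulrC; have := ler_wpM2r S0 Sr; lra.
    have B1 : K * y * (K' * y ^+ 3 + S) <= K * K' * Z + K * r * S.
      have -> : K * y * (K' * y ^+ 3 + S) = K * K' * y ^+ 4 + K * y * S by ring.
      apply: lerD; first by rewrite ler_wpM2l// mulr_ge0.
      by rewrite ler_wpM2r// ler_wpM2l// ltW.
    have B2 : (y + t) ^+ 2 * t <= 2 * G * Z + 2 * G * t ^+ 2 + 4 * r * S.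
      apply: (@le_trans _ _ ((2 * y ^+ 2 + 2 * t ^+ 2) * (G * y ^+ 2 + S))).
        apply: ler_pM => //; first exact: sqr_ge0.
        by have := sqr_ge0 (y - t); nra.
      have -> : (2 * y ^+ 2 + 2 * t ^+ 2) * (G * y ^+ 2 + S) =
        2 * G * y ^+ 4 + 2 * G * (y ^+ 2 * t ^+ 2) + (2 * y ^+ 2 + 2 * t ^+ 2) * S by ring.
      apply: lerD; first apply: lerD.
      - by rewrite ler_wpM2l// mulr_ge0.
      - rewrite ler_wpM2l ?mulr_ge0// ler_piMl ?sqr_ge0//.
        by rewrite expr_le1.
      - by rewrite ler_wpM2r//; lra.
    have B3 := ler_wpM2l K0 B2.
    have B4 : 0 <= 2^-1 * K + 2 * K * G + 16 * K.
      by rewrite !addr_ge0 ?mulr_ge0 ?invr_ge0.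
    have B5 := ler_wpM2l B4 t2.
    have B6 : A2 * r * S <= 2^-1 * S by rewrite ler_wpM2r.
    apply: (@le_trans _ _ (A1 * Z + A2 * r * S)); last by rewrite lerD2l.
    rewrite /A1 /A2; move: B1 B3 B5.
    lra.
  have graphE e : local_graph k c' M b e v = g0 + e * (M * X) by [].
  have A1M : 2 * A1 * X <= M * X by rewrite ler_wpM2r// /M -addrA lerDl addr_ge0.
  have [E1 E2] := Ephi _ wrho.
  split; rewrite graphE => sG.
  + apply: E1; have s0 : sg < - (M * X) by rewrite /sg; lra.
    have sn : sg < 0 by apply: lt_le_trans s0 _; rewrite oppr_le0 mulr_ge0// /M !addr_ge0// mulr_ge0.
    move: key; rewrite ler_distl (ltr0_norm sn) => /andP[_ up].
    have : a * sg <= sg by rewrite ger_nMl.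
    lra.
  + apply: E2; have s0 : M * X < sg by rewrite /sg; lra.
    have sp : 0 < sg by apply: le_lt_trans s0; rewrite mulr_ge0// /M !addr_ge0// mulr_ge0.
    move: key; rewrite ler_distl (gtr0_norm sp) => /andP[lo _].
    have : sg <= a * sg by rewrite ler_pMl.
    lra.
Qed.

End taylor_to_graph.

(** * Uniform expansions of chart functions *)

Lemma sum3_factorial (R : realType) (f : nat -> R) :
  \sum_(k < 3) f k / k`!%:R = f 0%N + f 1%N + 2^-1 * f 2%N.
Proof.
rewrite -(big_mkord xpredT (fun k => f k / k`!%:R)) !big_nat_recr//= big_geq// add0r.
have [f0 f1 f2] : [/\ 0`! = 1, 1`! = 1 & 2`! = 2]%N by [].
by rewrite f0 f1 f2 !divr1 [2^-1 * _]mulrC.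
Qed.

Lemma sum5_factorial (R : realType) (f : nat -> R) :
  \sum_(k < 5) f k / k`!%:R = f 0%N + f 1%N + 2^-1 * f 2%N + f 3%N / 6 + f 4%N / 24.
Proof.
rewrite -(big_mkord xpredT (fun k => f k / k`!%:R)) !big_nat_recr//= big_geq// add0r.
have [f0 f1 f2 f3 f4] : [/\ 0`! = 1, 1`! = 1, 2`! = 2, 3`! = 6 & 4`! = 24]%N by [].
by rewrite f0 f1 f2 f3 f4 !divr1 [2^-1 * _]mulrC.
Qed.

Lemma tail_abs (R : realType) (x d4 A B : R) : 0 <= A -> `|d4| <= A -> 3 * A <= B ->
  `|x - d4 / 24| <= 2 * A -> `|x| <= B.
Proof.
move=> A0 dA AB; have := ler_normD (x - d4 / 24) (d4 / 24).
rewrite subrK => /le_trans H T; apply: H.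
rewrite [`|d4 / 24|]normrM [`|24^-1|]ger0_norm ?invr_ge0//; lra.
Qed.

Section chart_expansion.
Variables (R : realType) (m : nat).
Local Notation V := 'rV[R]_m.
Local Notation RTn n := (n.-tuple (measurableTypeR R)).
Local Notation D i f := ('D_(delta_mx ord0 i : V) f).
Implicit Types (g : V -> R) (u w : V).

(** The Lipschitz bound controls the cubic part under the change of height in
    graph_sandwich_of_taylor.  Measurability is required along every measurable
    map because the tangent frame depends on the point of the hypersurface. *)
Definition chart_expansion g (b K rho : R) : Prop :=
  forall u, enorm u < rho ->
    (forall s, size s = 2%N -> `|partial s g u| <= K) /\
    exists c : V -> R,
      [/\ forall w, c (- w) = - c w,
          forall w, `|c w| <= K * enorm w ^+ 3,
          forall w w', `|c (w + w') - c w| <= K * ((enorm w + enorm w') ^+ 2 * enorm w'),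
          forall n (F : RTn n -> V), measurable_rV F ->
            measurable_fun [set: RTn n] (fun t => c (F t)) &
          forall w, enorm (u + w) < rho ->
            `|g (u + w) - (g u + dirpoly 1 w g u + 2^-1 * dirpoly 2 w g u + c w)| <=
              K * (enorm w ^+ 2 * enorm w `^ b)].

Lemma measurable_dirpoly n k (F : RTn n -> V) f x : measurable_rV F ->
  measurable_fun [set: RTn n] (fun t => dirpoly k (F t) f x).
Proof.
move=> mF; elim: k f => [|k IH] f; first exact: measurable_cst.
by apply: measurable_sum => i; apply: measurable_funM.
Qed.

Lemma sum_abs_le w : \sum_(i < m) `|w ord0 i| <= m%:R * enorm w.
Proof.
rewrite (_ : m%:R * _ = \sum_(i < m) enorm w); last by rewrite sumr_const card_ord mulr_natl.
by apply: ler_sum => i _; exact: ler_coord_enorm.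
Qed.

Lemma sum_absX_le w k : (\sum_(i < m) `|w ord0 i|) ^+ k <= m%:R ^+ k * enorm w ^+ k.
Proof.
rewrite -exprMn lerXn2r ?nnegrE ?sum_abs_le//; first exact: sumr_ge0.
by rewrite mulr_ge0// enorm_ge0.
Qed.

(** Continuity at the centre, for finitely many partial derivatives. *)
Lemma partial_bound_near0 k j r g : (j <= k)%N -> 0 < r -> Ck_on k (eball r) g ->
  exists rho B, [/\ 0 < rho, rho <= r, 0 <= B &
    forall u s, enorm u < rho -> size s = j -> `|partial s g u| <= B].
Proof.
move=> jk r0 Ck.
pose B := \sum_(s : j.-tuple 'I_m) (`|partial s g 0| + 1).
have [d d0 H] : exists2 d, 0 < d & forall u, enorm (u - 0) < d ->
    forall s : j.-tuple 'I_m, `|partial s g u - partial s g 0| < 1.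
  apply/near_enormP.
  apply: (@filter_forall _ _ (fun (s : j.-tuple 'I_m) u => `|partial s g u - partial s g 0| < 1)
     (nbhs (0 : V)) (@nbhs_filter V 0)) => s.
  have sk : (size s <= k)%N by rewrite size_tuple.
  have [c _] := Ck s sk; have c0 : eball r (0 : V) by rewrite /eball/= enorm0.
  have /continuous_enormP/(_ 1 ltr01)[d d0 H] := c 0 c0.
  by apply/near_enormP; exists d.
exists (Num.min d r), B; split.
- by rewrite lt_min d0.
- by rewrite ge_min lexx orbT.
- by apply: sumr_ge0 => s _; rewrite addr_ge0.
- move=> u s; rewrite lt_min => /andP[ud _] sj.
  have := H u; rewrite subr0 => /(_ ud (tcast sj (in_tuple s))).
  rewrite val_tcast/= => H1.
  apply: (@le_trans _ _ (`|partial s g 0| + 1)).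
    have := ler_distD 0 (partial s g u) (partial s g 0).
    have := ler_normD (partial s g u - partial s g 0) (partial s g 0).
    by rewrite subrK => ? _; lra.
  rewrite /B (bigD1 (tcast sj (in_tuple s)))//= val_tcast/= lerDl.
  by apply: sumr_ge0 => t _; rewrite addr_ge0.
Qed.

(** Second-order Taylor with the Hoelder condition on the second derivatives; no
    cubic part is separated. *)
Lemma chart_expansion_holder r (a : R) g : 0 < r -> 0 < a ->
  Ck_holder_on 2 a (eball r) g ->
  exists K rho, [/\ 0 <= K, 0 < rho, rho <= r & chart_expansion g a K rho].
Proof.
move=> r0 a0 [C2 hold].
have [rho [B [rho0 rhor B0 HB]]] := partial_bound_near0 (leqnn 2) r0 C2.
have [C C0 HC] : exists2 C, 0 <= C & forall s, size s = 2%N -> forall x y,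
    eball r x -> eball r y -> `|partial s g x - partial s g y| <= C * enorm (x - y) `^ a.
  have /boolp.choice[f Hf] : forall s : 2.-tuple 'I_m, exists C, forall x y,
      eball r x -> eball r y -> `|partial s g x - partial s g y| <= C * enorm (x - y) `^ a.
    by move=> s; exact: (hold s (size_tuple s)).
  exists (\sum_(s : 2.-tuple 'I_m) `|f s|); first exact: sumr_ge0.
  move=> s s2 x y xr yr; have := Hf (tcast s2 (in_tuple s)) x y xr yr.
  rewrite val_tcast/= => /le_trans; apply; rewrite ler_wpM2r ?powR_ge0//.
  apply: (le_trans (ler_norm _)).
  by rewrite (bigD1 (tcast s2 (in_tuple s)))//= lerDl; exact: sumr_ge0.
exists (B + C * m%:R ^+ 2), rho; split=> //; first by rewrite addr_ge0// mulr_ge0// exprn_ge0.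
move=> u ur; split=> [s s2|].
  by apply: le_trans (HB u s ur s2) _; rewrite lerDl mulr_ge0// exprn_ge0.
have K0 : 0 <= B + C * m%:R ^+ 2 by rewrite addr_ge0// mulr_ge0// exprn_ge0.
exists (fun=> 0); split.
- by move=> w; rewrite oppr0.
- by move=> w; rewrite normr0 mulr_ge0// exprn_ge0// enorm_ge0.
- move=> w w'; rewrite subrr normr0; apply: mulr_ge0 => //.
  by apply: mulr_ge0; [exact: sqr_ge0|exact: enorm_ge0].
- by move=> n F _; exact: measurable_cst.
- move=> w uwr.
  have ur' : eball r u by exact: lt_le_trans ur rhor.
  have uwr' : eball r (u + w) by exact: lt_le_trans uwr rhor.
  have T := @taylor_dirpoly R m 2 r g u w (C * m%:R ^+ 2 * (enorm w ^+ 2 * enorm w `^ a)) C2 ur' uwr'.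
  have {}T := T _; move: T.
  rewrite (sum3_factorial (fun k => dirpoly k w g u)) addr0.
  move=> T; apply: (@le_trans _ _ (C * m%:R ^+ 2 * (enorm w ^+ 2 * enorm w `^ a))).
    apply: T => t t01; have := @dirpoly_dist R m 2 w g (u + t *: w) u (C * enorm w `^ a).
    move=> /(_ _)/le_trans; apply => [s s2|].
      apply: le_trans (HC s s2 _ _ (eball_segment ur' uwr' t01) ur') _.
      rewrite ler_wpM2l// addrAC subrr add0r enormZ.
      rewrite ge0_ler_powR ?nnegrE ?mulr_ge0 ?enorm_ge0 ?(ltW a0)//.
      by case/andP: t01 => t0 t1; rewrite ger0_norm// ler_piMl// enorm_ge0.
    apply: le_trans (ler_wpM2l _ (sum_absX_le w 2)) _; first by rewrite mulr_ge0 ?powR_ge0.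
    by apply: le_of_eq; ring.
  apply: ler_wpM2r; last by rewrite lerDr.
  by apply: mulr_ge0; [exact: sqr_ge0|exact: powR_ge0].
Qed.

(** Fourth-order Taylor: the cubic part is the third derivative divided by 6 and
    the quartic terms go into the remainder. *)
Lemma chart_expansion_C4 r g : 0 < r -> Ck_on 4 (eball r) g ->
  exists K rho, [/\ 0 <= K, 0 < rho, rho <= r & chart_expansion g 2 K rho].
Proof.
move=> r0 C4.
have [rho2 [B2 [rho20 rho2r B20 HB2]]] := partial_bound_near0 (isT : (2 <= 4)%N) r0 C4.
have [rho3 [B3 [rho30 rho3r B30 HB3]]] := partial_bound_near0 (isT : (3 <= 4)%N) r0 C4.
have [rho4 [B4 [rho40 rho4r B40 HB4]]] := partial_bound_near0 (leqnn 4) r0 C4.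
pose rho := Num.min rho2 (Num.min rho3 rho4).
have rho0 : 0 < rho by rewrite !lt_min rho20 rho30.
have rhor : rho <= r by rewrite ge_min rho2r.
pose K := B2 + B3 * m%:R ^+ 3 + 3 * B4 * m%:R ^+ 4.
have m3 : 0 <= m%:R ^+ 3 :> R by exact: exprn_ge0.
have m4 : 0 <= m%:R ^+ 4 :> R by exact: exprn_ge0.
have K0 : 0 <= K by rewrite !addr_ge0// !mulr_ge0.
have K2 : B2 <= K by rewrite /K -addrA lerDl addr_ge0// !mulr_ge0.
have K3 : B3 * m%:R ^+ 3 <= K.
  by rewrite /K addrAC lerDr addr_ge0// !mulr_ge0.
have K4 : 3 * B4 * m%:R ^+ 4 <= K by rewrite /K lerDr addr_ge0// !mulr_ge0.
exists K, rho; split => // u; rewrite /rho !lt_min => /and3P[u2 u3 u4].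
have ur : enorm u < rho by rewrite /rho !lt_min u2 u3.
split=> [s s2|]; first exact: le_trans (HB2 u s u2 s2) K2.
have d3le w : `|dirpoly 3 w g u| <= B3 * m%:R ^+ 3 * enorm w ^+ 3.
  have := dirpoly_le w (fun s s3 => HB3 u s u3 s3) => /le_trans; apply.
  by rewrite -mulrA ler_wpM2l// sum_absX_le.
exists (fun w => dirpoly 3 w g u / 6); split.
- by move=> w; rewrite dirpolyN exprS expr2 mulrNN !mulr1 mulN1r mulNr.
- move=> w; rewrite normrM normfV (ger0_norm (ler0n _ 6)) ler_pdivrMr//.
  apply: le_trans (d3le w) _; have := enorm_ge0 w => w0.
  have w3 : 0 <= enorm w ^+ 3 by exact: exprn_ge0.
  have := ler_wpM2r w3 K3; have := mulr_ge0 K0 w3; lra.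
- move=> w w'; rewrite -mulrBl normrM normfV (ger0_norm (ler0n _ 6)) ler_pdivrMr//.
  have S0 := enorm_ge0 w; have S0' := enorm_ge0 w'.
  have := @dirpoly_lip R m 3 (w + w') w g u B3 (m%:R * (enorm w + enorm w')) B30.
  move=> /(_ _ _ (fun s s3 => HB3 u s u3 s3)) H.
  apply: le_trans (H _ _) _.
  + by apply: le_trans (sum_abs_le _) _; rewrite ler_wpM2l// ler_enormD.
  + by apply: le_trans (sum_abs_le _) _; rewrite ler_wpM2l// lerDl.
  rewrite [w + w' - w]addrAC subrr add0r.
  apply: le_trans (ler_wpM2l _ (sum_abs_le w')) _.
    by apply: mulr_ge0; [exact: mulr_ge0|apply: sqr_ge0].
  rewrite (_ : _ * (m%:R * enorm w') = 3 * (B3 * m%:R ^+ 3 * ((enorm w + enorm w') ^+ 2 * enorm w'))); last first.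
    by rewrite /=; ring.
  have P0 : 0 <= (enorm w + enorm w') ^+ 2 * enorm w' by rewrite mulr_ge0 ?sqr_ge0.
  have := ler_wpM2r P0 K3; have := mulr_ge0 K0 P0; lra.
- by move=> n F mF; apply: measurable_funM; [exact: measurable_dirpoly|exact: measurable_cst].
- move=> w uwr.
  have ur' : eball rho u by [].
  have uwr' : eball rho (u + w) by [].
  have C4' := Ck_on_ball rhor C4.
  have b4 x : eball rho x -> `|dirpoly 4 w g x| <= B4 * m%:R ^+ 4 * enorm w ^+ 4.
    move=> xr; have xr4 : enorm x < rho4.
      by move: xr; rewrite /eball/= /rho !lt_min => /and3P[].
    have := dirpoly_le w (fun s s4 => HB4 x s xr4 s4) => /le_trans; apply.
    by rewrite -mulrA ler_wpM2l// sum_absX_le.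
  have w4 : enorm w ^+ 2 * enorm w `^ 2 = enorm w ^+ 4.
    by rewrite powR_mulrn ?enorm_ge0// -exprD.
  rewrite w4; have B4u := b4 u ur'.
  have T : `|g (u + w) - \sum_(k < 5) dirpoly k w g u / k`!%:R| <=
      2 * (B4 * m%:R ^+ 4 * enorm w ^+ 4).
    apply: (taylor_dirpoly C4' ur' uwr') => t t01.
    rewrite mulr_natl mulr2n; apply: le_trans (ler_normB _ _) _.
    by apply: lerD; [exact: b4 (eball_segment ur' uwr' t01)|].
  have Bw : 0 <= B4 * m%:R ^+ 4 * enorm w ^+ 4.
    by apply: mulr_ge0; [exact: mulr_ge0|apply: exprn_ge0; exact: enorm_ge0].
  move: T; rewrite (sum5_factorial (fun k => dirpoly k w g u)) opprD addrA.
  apply: (@tail_abs R _ _ (B4 * m%:R ^+ 4 * enorm w ^+ 4)) => //.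
  rewrite [3 * _]mulrA [3 * _]mulrA.
  apply: ler_wpM2r; last exact: K4.
  by apply: exprn_ge0; exact: enorm_ge0.
Qed.

End chart_expansion.

(** * Local charts *)

Section chart.
Variables (R : realType) (n : nat).
Local Notation V := 'rV[R]_n.+1.
Local Notation W := 'rV[R]_n.
Local Notation RTn n := (n.-tuple (measurableTypeR R)).
Local Notation D i f := ('D_(delta_mx ord0 i : W) f).
Variables (E : set V) (p : V) (T0 : 'M[R]_(n, n.+1)) (n0 : V) (g : W -> R).
Hypothesis fr0 : orthonormal_frame n0 T0.

Definition chart_coord (y : V) : W := (y - p) *m T0^T.
Definition chart_phi (y : V) : R := edot (y - p) n0 - g (chart_coord y).
Definition chart_grad (y : V) : W := \row_i D i g (chart_coord y).

(** The gradient of chart_phi. *)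
Definition chart_normal (y : V) : V := n0 - chart_grad y *m T0.
Definition chart_hess (y : V) : 'M[R]_n := \matrix_(i, j) D i (D j g) (chart_coord y).

(** The Hessian of chart_phi. *)
Definition chart_quad (y : V) : 'M[R]_n.+1 := - (T0^T *m chart_hess y *m T0).

Lemma chart_coordD x w : chart_coord (x + w) = chart_coord x + w *m T0^T.
Proof. by rewrite /chart_coord addrAC mulmxDl. Qed.

Lemma enorm_chart_coord y : enorm (chart_coord y) <= enorm (y - p).
Proof. by case: fr0 => TT _ _; exact: enorm_mulmx_tr_le. Qed.

(** The component of the gradient along n0 is 1. *)
Lemma chart_normal_ge1 y : 1 <= enorm (chart_normal y).
Proof.
case: fr0 => TT Tn nn.
have n01 : enorm n0 = 1 by apply/eqP; rewrite -edot_enorm nn.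
have := ler_edot (chart_normal y) n0.
rewrite n01 mulr1 edotBl nn edot_mulmx.
have -> : n0 *m T0^T = 0 by rewrite -[n0]trmxK -trmx_mul Tn trmx0.
by rewrite edot0r subr0.
Qed.

Lemma edot_chart_normal y w :
  edot (chart_normal y) w = edot w n0 - dirpoly 1 (w *m T0^T) g (chart_coord y).
Proof.
rewrite edotBl edot_mulmx (edotC n0); congr (_ - _).
by rewrite edotC /edot /=; apply: eq_bigr => i _; rewrite [chart_grad _ _ _]mxE.
Qed.

Lemma edot_chart_quad y w :
  edot (w *m chart_quad y) w = - dirpoly 2 (w *m T0^T) g (chart_coord y).
Proof.
rewrite mulmxN edotNl mulmxA edot_mulmx mulmxA; congr (- _).
rewrite /edot /=; apply: eq_bigr => i _; rewrite mulrC [(_ *m chart_hess y) _ _]mxE; congr (_ * _).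
by apply: eq_bigr => j _; rewrite [chart_hess _ _ _]mxE.
Qed.

Lemma chart_phiE x w : chart_phi x = 0 ->
  chart_phi (x + w) = edot w n0 - (g (chart_coord x + w *m T0^T) - g (chart_coord x)).
Proof.
move=> x0; rewrite -[LHS]subr0 -x0 /chart_phi chart_coordD.
rewrite (_ : x + w - p = (x - p) + w) 1?addrAC// edotDl.
by move: (g _) (g _) (edot w n0) (edot _ n0) => a1 a2 a3 a4; ring.
Qed.

Variables (b K rho r : R).
Hypotheses (K0 : 0 <= K) (rho0 : 0 < rho) (rhor : rho <= r).
Hypothesis C2 : Ck_on 2 (eball r) g.
Hypothesis exp_g : chart_expansion g b K rho.
Hypothesis sub_g : forall y, enorm (y - p) < r ->
  (edot (y - p) n0 < g (chart_coord y) -> E y) /\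
  (g (chart_coord y) < edot (y - p) n0 -> ~ E y).

Local Notation K' := (K + 3 * K * n%:R ^+ 2).

Let K'0 : 0 <= K'. Proof. by rewrite addr_ge0// !mulr_ge0// exprn_ge0. Qed.

Let KK' : K <= K'. Proof. by rewrite lerDl !mulr_ge0// exprn_ge0. Qed.

Lemma chart_coord_lt y s : enorm (y - p) < s -> enorm (chart_coord y) < s.
Proof. exact/le_lt_trans/enorm_chart_coord. Qed.

Lemma chart_hess_sym y : enorm (y - p) < rho -> (chart_hess y)^T = chart_hess y.
Proof.
move=> yr; apply/matrixP => i j; rewrite !mxE.
by apply: (clairaut j i C2); apply: lt_le_trans rhor; exact: chart_coord_lt.
Qed.

Lemma chart_quad_sym y : enorm (y - p) < rho -> (chart_quad y)^T = chart_quad y.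
Proof.
by move=> /chart_hess_sym HT; rewrite linearN/= !trmx_mul trmxK HT mulmxA.
Qed.

Lemma chart_hess_le y (v v' : W) : enorm (y - p) < rho ->
  `|edot (v *m chart_hess y) v'| <= K * n%:R ^+ 2 * (enorm v * enorm v').
Proof.
move=> yr; have [H _] := exp_g (chart_coord_lt yr).
rewrite /edot; apply: le_trans (ler_norm_sum _ _ _) _.
apply: (@le_trans _ _ (\sum_(j < n) K * (n%:R * enorm v) * `|v' ord0 j|)).
  apply: ler_sum => j _; rewrite normrM; apply: ler_wpM2r => //.
  rewrite mxE; apply: le_trans (ler_norm_sum _ _ _) _.
  apply: (@le_trans _ _ (K * \sum_(i < n) `|v ord0 i|)); last first.
    by apply: ler_wpM2l => //; exact: sum_abs_le.
  rewrite mulr_sumr; apply: ler_sum => i _; rewrite normrM mulrC.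
  by apply: ler_wpM2r => //; rewrite mxE; exact: (H [:: i; j]).
rewrite -mulr_sumr.
apply: le_trans (ler_wpM2l _ (sum_abs_le v')) _.
  by apply: mulr_ge0 => //; apply: mulr_ge0 => //; exact: enorm_ge0.
by apply: le_of_eq; ring.
Qed.

Lemma chart_quad_le y (v v' : V) : enorm (y - p) < rho ->
  `|edot (v *m chart_quad y) v'| <= K' * (enorm v * enorm v').
Proof.
move=> yr; case: fr0 => TT _ _.
rewrite mulmxN edotNl normrN mulmxA edot_mulmx mulmxA.
apply: le_trans (chart_hess_le _ _ yr) _.
have m2 : 0 <= n%:R ^+ 2 :> R by exact: exprn_ge0.
apply: ler_pM.
- exact: mulr_ge0.
- by apply: mulr_ge0; exact: enorm_ge0.
- by rewrite -[3 * K * _]mulrA mulr_natl; apply: (@le_trans _ _ (K * n%:R ^+ 2 *+ 3));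
    [rewrite mulrS lerDl mulrn_wge0 // mulr_ge0 | rewrite lerDr].
- by apply: ler_pM; rewrite ?enorm_ge0// enorm_mulmx_tr_le.
Qed.

Lemma chart_normal_derivative y : enorm (y - p) < rho -> forall e, 0 < e ->
  exists2 d0, 0 < d0 & forall z, enorm (z - y) < d0 ->
    enorm (chart_normal z - chart_normal y - (z - y) *m chart_quad y) <=
      e * enorm (z - y).
Proof.
move=> yr e e0; case: fr0 => TT _ _.
have e'0 : 0 < e / (n%:R + 1) by rewrite divr_gt0// ltr_wpDl.
have /boolp.choice[f Hf] : forall i : 'I_n, exists d, 0 < d /\ forall w, enorm w < d ->
    `|D i g (chart_coord y + w) - D i g (chart_coord y)
       - \sum_(j < n) w ord0 j * D j (D i g) (chart_coord y)| <= e / (n%:R + 1) * enorm w.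
  move=> i; have yr' : eball r (chart_coord y).
    by apply: lt_le_trans rhor; exact: chart_coord_lt.
  by have [d d0 H] := C1_on_grad (Ck_on_C1 (Ck_on_D i C2)) yr' e'0; exists d.
have [d0 d00 d0f] : exists2 d0, 0 < d0 & forall i, d0 <= f i.
  exists (\big[Num.min/1]_i f i) => [|i]; last exact: bigmin_le_cond.
  by apply: lt_bigmin => // i _; have [] := Hf i.
exists d0 => // z zy; set w := (z - y) *m T0^T.
have zE : chart_coord z = chart_coord y + w by rewrite /w -chart_coordD addrC subrK.
have wzy : enorm w <= enorm (z - y) by exact: enorm_mulmx_tr_le.
have -> : chart_normal z - chart_normal y - (z - y) *m chart_quad y =
    - ((chart_grad z - chart_grad y - w *m chart_hess y) *m T0).
  rewrite /chart_normal /chart_quad mulmxN opprK !mulmxA -/w !mulmxBl.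
  move: (chart_grad z *m T0) (chart_grad y *m T0) (w *m _ *m T0) => v1 v2 v3.
  by apply/rowP => i; rewrite !mxE; ring.
rewrite enormN enorm_isometry//; apply: le_trans (ler_enorm_sum _) _.
apply: (@le_trans _ _ (\sum_(i < n) e / (n%:R + 1) * enorm (z - y))).
  apply: ler_sum => i _; rewrite !mxE zE.
  have [_ /(_ w)] := Hf i; move=> /(_ (le_lt_trans wzy (lt_le_trans zy (d0f i)))).
  have -> : \sum_j w ord0 j * chart_hess y j i =
      \sum_(j < n) w ord0 j * D j (D i g) (chart_coord y).
    by apply: eq_bigr => j _; rewrite [chart_hess _ _ _]mxE.
  move=> /le_trans; apply; exact: ler_wpM2l (ltW e'0) _ _ wzy.
rewrite sumr_const card_ord -[X in X <= _]mulr_natl mulrA; apply: ler_wpM2r; first exact: enorm_ge0.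
rewrite mulrCA ger_pMr// ler_pdivrMr ?ltr_wpDl//; lra.
Qed.

(** Second-order Taylor with bounded second derivatives. *)
Lemma chart_defining : defining_function E p rho K' chart_phi chart_normal.
Proof.
case: (fr0) => TT _ _; split => //.
- move=> y yr; have [A B] := sub_g (lt_le_trans yr rhor).
  by rewrite /chart_phi subr_lt0 subr_gt0.
- by move=> y _; exact: chart_normal_ge1.
move=> x y xr yr; set w := (y - x) *m T0^T.
have yE : chart_coord y = chart_coord x + w by rewrite /w -chart_coordD addrC subrK.
have wyx : enorm w <= enorm (y - x) by exact: enorm_mulmx_tr_le.
have ur : eball rho (chart_coord x) by exact: chart_coord_lt.
have uwr : eball rho (chart_coord x + w) by rewrite -yE; exact: chart_coord_lt.
have C2' := Ck_on_ball rhor C2.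
have b2 z : eball rho z -> `|dirpoly 2 w g z| <= K * n%:R ^+ 2 * enorm w ^+ 2.
  move=> zr; have := dirpoly_le w (exp_g zr).1 => /le_trans; apply.
  by rewrite -mulrA ler_wpM2l// sum_absX_le.
have T : `|g (chart_coord x + w) - \sum_(k < 3) dirpoly k w g (chart_coord x) / k`!%:R| <=
    2 * (K * n%:R ^+ 2 * enorm w ^+ 2).
  apply: (taylor_dirpoly C2' ur uwr) => t t01.
  rewrite mulr_natl mulr2n; apply: le_trans (ler_normB _ _) _.
  by apply: lerD; [exact: b2 (eball_segment ur uwr t01)|exact: b2].
rewrite edot_chart_normal -/w /chart_phi yE.
have -> : edot (y - p) n0 = edot (y - x) n0 + edot (x - p) n0 by rewrite -edotDl subrKA.
have := b2 _ ur; move: T; rewrite (sum3_factorial (fun k => dirpoly k w g _)) [dirpoly 0 _ _ _]/=.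
set S := K * n%:R ^+ 2 * enorm w ^+ 2.
have SK : 3 * S <= K' * enorm (y - x) ^+ 2.
  rewrite /S [3 * _]mulrA [3 * _]mulrA; apply: ler_pM.
  - by apply: mulr_ge0; [exact: mulr_ge0|exact: exprn_ge0].
  - exact: exprn_ge0 (enorm_ge0 _).
  - by rewrite lerDr.
  - by rewrite lerXn2r ?nnegrE ?enorm_ge0.
move: S SK (dirpoly 1 _ _ _) (dirpoly 2 _ _ _) => S SK d1 d2.
move: (g _) (g _) (edot _ n0) (edot _ n0) (K' * _) SK => g1 g2 a1 a2 B SB T d2S.
apply: le_trans SB.
have := ler_normD (g2 - (g1 + d1 + 2^-1 * d2)) (2^-1 * d2).
have -> : a2 + a1 - g2 - (a1 - g1) - (a2 - d1) =
   - (g2 - (g1 + d1 + 2^-1 * d2) + 2^-1 * d2) by lra.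
rewrite normrN normrM [`|2^-1|]ger0_norm ?invr_ge0// => H.
have := normr_ge0 d2. lra.
Qed.

(** The frame of principal directions varies with the boundary point in no
    controlled way; all bounds are therefore stated for quadratic and cubic
    forms on the whole space, independently of the frame. *)
Lemma chart_local_graph_data : 0 < b <= 2 ->
  exists rho' M r', [/\ 0 < rho', 0 <= M, 0 < r' & local_graph_data E b p rho' M r'].
Proof.
move=> /andP[b0 b2]; have b02 : 0 <= b <= 2 by rewrite (ltW b0).
have rho20 : 0 < rho / 2 by rewrite divr_gt0.
have [M [r' [M0 r'0 sandwich]]] := graph_sandwich_of_taylor n K'0 b02 rho20.
exists (rho / 2), M, r'; split=> // x Ex xp; case: (fr0) => TT _ _.
have xr : enorm (x - p) < rho by lra.
have x0 := (boundary_defining chart_defining xr).1 Ex.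
have [T [frT TQ]] := principal_curvatures_frame chart_defining xr x0
  (chart_normal_derivative xr) (chart_quad_sym xr) fr0.
have nuE := outer_normal_defining chart_defining xr x0.
have [_ [c [codd cb clip cm ct]]] := exp_g (chart_coord_lt xr).
have wr w : enorm w < rho / 2 -> enorm (x + w - p) < rho.
  by move=> wr; rewrite addrAC; have := ler_enormD (x - p) w; lra.
have [||||||c' [k1 k2 k3 k4]] := sandwich E x (outer_normal E x) T (principal_curvatures E x)
  chart_phi (enorm (chart_normal x)) (chart_quad x) (fun w => - c (w *m T0^T))
  frT (chart_normal_ge1 x) (chart_quad_sym xr) TQ (fun v v' => chart_quad_le v v' xr).
- by move=> w; rewrite mulNmx codd.
- move=> w; rewrite normrN; apply: le_trans (cb _) _; apply: ler_pM => //.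
  + exact: exprn_ge0 (enorm_ge0 _).
  + by rewrite lerXn2r ?nnegrE ?enorm_ge0// enorm_mulmx_tr_le.
- move=> w w'; rewrite mulmxDl opprK addrC distrC; apply: le_trans (clip _ _) _.
  have le0 (v : V) : 0 <= enorm (v *m T0^T) <= enorm v.
    by rewrite enorm_ge0 enorm_mulmx_tr_le.
  have [/andP[w0 w1] /andP[w0' w1']] := (le0 w, le0 w').
  apply: ler_pM => //; first by rewrite mulr_ge0// exprn_ge0// addr_ge0.
  apply: ler_pM => //; first by rewrite exprn_ge0// addr_ge0.
  by rewrite lerXn2r ?nnegrE ?addr_ge0 ?enorm_ge0// lerD.
- apply: measurable_funN; apply: cm; apply: measurable_rV_mulmx.
  by apply: measurable_rV_mulmx; exact: measurable_rV_of_tuple.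
- by move=> w /wr xwr; case: chart_defining => _ H _ _; exact: H.
- move=> w /wr xwr; have := ct (w *m T0^T).
  rewrite -chart_coordD => /(_ (chart_coord_lt xwr)) H.
  rewrite chart_phiE// edot_chart_quad -chart_coordD.
  have -> : enorm (chart_normal x) * edot (outer_normal E x) w =
      edot w n0 - dirpoly 1 (w *m T0^T) g (chart_coord x).
    by rewrite nuE -edotZl -(gradientE chart_defining xr) edot_chart_normal.
  have wT := enorm_mulmx_tr_le w TT.
  apply: (@le_trans _ _ (K * (enorm (w *m T0^T) ^+ 2 * enorm (w *m T0^T) `^ b))); last first.
    apply: ler_pM => //; first by rewrite mulr_ge0 ?sqr_ge0 ?powR_ge0.
    apply: ler_pM; rewrite ?sqr_ge0 ?powR_ge0 ?lerXn2r ?nnegrE ?enorm_ge0//.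
    by apply: ge0_ler_powR; rewrite ?nnegrE ?enorm_ge0// ltW.
  apply: le_trans H; rewrite -normrN; apply: le_of_eq; congr (`|_|).
  move: (g _) (g _) (edot w n0) (dirpoly 1 _ _ _) (dirpoly 2 _ _ _) (c _).
  by move=> g1 g2 a1 d1 d2 c3; ring.
- by exists T, c'; split.
Qed.

End chart.

(** * The displacement estimate *)

(** The two regularity classes of the theorem differ only in the expansion they
    provide. *)
Lemma local_graph_data_of_expansion (R : realType) n (E : set 'rV[R]_n.+1) (b : R)
    (smooth : set 'rV[R]_n -> ('rV[R]_n -> R) -> Prop) : 0 < b <= 2 ->
  (forall r g, 0 < r -> smooth (eball r) g -> Ck_on 2 (eball r) g /\
     exists K rho, [/\ 0 <= K, 0 < rho, rho <= r & chart_expansion g b K rho]) ->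
  @subgraph_boundary R n.+1 smooth E ->
  forall p, boundary E p -> exists rho M r, [/\ 0 < rho, 0 <= M, 0 < r &
    local_graph_data E b p rho M r].
Proof.
move=> b02 smoothP sE p /sE[r [T [n0 [g [r0 fr sg sub]]]]].
have [C2 [K [rho [K0 rho0 rhor ex]]]] := smoothP r g r0 sg.
exact: (chart_local_graph_data fr K0 rho0 rhor C2 ex sub b02).
Qed.
Theorem theorem4p1 (R : realType) (d : nat) (alpha : R) (E0 : set 'rV[R]_d)
    (hd : (2 <= d)%N) (alpha_gt0 : 0 < alpha) (alpha_le1 : alpha <= 1)
    (E0_bounded : bounded_set E0)
    (E0_smooth : Ck_holder_boundary 2 alpha E0) :
  (exists C h0 : R, 0 < h0 /\
     forall (h : R) (x : 'rV[R]_d), 0 < h -> h < h0 -> boundary E0 x ->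
       (`|normal_displacement E0 h x - (- (h * mean_curvature E0 x))%:E|
          <= (C * h `^ (1 + alpha / 2))%:E)%E)
  /\
  (Ck_boundary 4 E0 ->
   exists C h0 : R, 0 < h0 /\
     forall (h : R) (x : 'rV[R]_d), 0 < h -> h < h0 -> boundary E0 x ->
       (`|normal_displacement E0 h x - (- (h * mean_curvature E0 x))%:E|
          <= (C * h ^+ 2)%:E)%E).

Proof.
case: d hd E0 E0_bounded E0_smooth => // n _ E bE sE.
split=> [|sE4].
- apply: displacement_uniform => //; first by rewrite alpha_gt0; lra.
  apply: (@local_graph_data_of_expansion _ _ _ _ (Ck_holder_on 2 alpha)) sE.
    by rewrite alpha_gt0; lra.
  move=> r g r0 sg; split; first by case: sg.
  exact: chart_expansion_holder r0 alpha_gt0 sg.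
- have [|||C [h0 [h00 H]]] := @displacement_uniform _ _ E 2 => //.
  + by rewrite ltr0n lexx.
  + apply: (@local_graph_data_of_expansion _ _ _ _ (Ck_on 4)) sE4.
      by rewrite ltr0n lexx.
    move=> r g r0 sg; split; first exact: Ck_on_le sg.
    exact: chart_expansion_C4 r0 sg.
  exists C, h0; split => // h x hpos hh0 Ex.
  have := H h x hpos hh0 Ex.
  have -> : h `^ (1 + 2 / 2) = h ^+ 2 by rewrite divff// -(natrD _ 1 1) powR_mulrn// ltW.
  by [].
Qed.
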